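(* Let $\lambda,\mu\in\mathbb{R}$ satisfy $\mu>0$ and $3\lambda+2\mu>0$, let $R>0$, and let $n\in\mathbb{N}$ with $n\ge 2$ be fixed. Set $$\zeta_1:=-1-\frac{3}{n-1},\qquad \zeta_2:=-\frac{(2n+2)\big((n-1)\lambda+(2n-2)\mu\big)}{(2n^2+1)\lambda+(2+2n(n-1))\mu},$$ $$\zeta_3:=-\frac{(2n^2+4n+3)\lambda+(2n^2+6n+6)\mu}{2n\big((n+2)\lambda+(3n+5)\mu\big)}.$$ For a constant $c$, consider the problem for $\bm{\psi}\in H^1_{loc}(\mathbb{R}^3)^3$, $\bm{\psi}:\mathbb{R}^3\to\mathbb{C}^3$: $$(P_c)\quad\begin{cases}\mathcal{L}_{\lambda_A,\mu_A}\bm{\psi}=\mathbf{0} & \text{in }\mathbb{R}^3,\\ \bm{\psi}|_-=\bm{\psi}|_+,\quad \partial_{\bm{\nu}_{\lambda_A,\mu_A}}\bm{\psi}|_-=\partial_{\bm{\nu}_{\lambda_A,\mu_A}}\bm{\psi}|_+ & \text{on }\partial B_R,\\ \bm{\psi}(x)=\mathcal{O}(\|x\|^{-1}) & \text{as }\|x\|\to\infty,\end{cases}$$ where $(\lambda_A,\mu_A)=A(x)(\lambda,\mu)$ with $A(x)=c$ for $\|x\|\le R$ and $A(x)=1$ for $\|x\|>R$. (i) If $c=\zeta_1$, then there exist non-trivial solutions $\bm{\psi}=\widehat{\bm{\psi}}_{n,k}\in H^1_{loc}(\mathbb{R}^3)^3$ of $(P_c)$, $k=1,2,\dots,2n+1$,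 of the form $$\widehat{\bm{\psi}}_{n,k}(x)=\begin{cases}\mathbf{G}^{n,\zeta_1,k}\,r^n\mathbf{Y}_n(\hat x), & r\le R,\\ \mathbf{G}^{n,\zeta_1,k}\,\dfrac{R^{2n+1}}{r^{n+1}}\mathbf{Y}_n(\hat x), & r>R,\end{cases}$$ where the complex $3\times(2n+1)$ coefficient matrices $\mathbf{G}^{n,\zeta_1,k}$ satisfy $\mathbf{t}^1_{n+1}=\mathbf{0}$ and $\mathbf{t}^3_{n-1}=\mathbf{0}$ (computed with $\mathbf{G}^n=\mathbf{G}^{n,\zeta_1,k}$). (ii) If $c=\zeta_2$, then there exist non-trivial solutions $\bm{\psi}=\widehat{\bm{\psi}}_{n,k}\in H^1_{loc}(\mathbb{R}^3)^3$ of $(P_c)$, $k=1,2,\dots,2n-1$, of the form $$\widehat{\bm{\psi}}_{n,k}(x)=\begin{cases}\mathbf{G}^{n,\zeta_2,k}\,r^n\mathbf{Y}_n(\hat x)-M_n(r^2-R^2)\begin{bmatrix}\mathbf{t}^3_{n-1}\mathbf{D}^{(n-2)x_1}_{n-1}\\ \mathbf{t}^3_{n-1}\mathbf{D}^{(n-2)x_2}_{n-1}\\ \mathbf{t}^3_{n-1}\mathbf{D}^{(n-2)x_3}_{n-1}\end{bmatrix}r^{n-2}\mathbf{Y}_{n-2}(\hat x), & r\le R,\\[2mm] \mathbf{G}^{n,\zeta_2,k}\,\dfrac{R^{2n+1}}{r^{n+1}}\mathbf{Y}_n(\hat x), & r>R,\end{cases}$$ where the complex $3\times(2n+1)$ matrices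 $\mathbf{G}^{n,\zeta_2,k}$ satisfy $\mathbf{t}^1_{n+1}=\mathbf{0}$ and $\mathbf{t}^3_{n-1}\neq\mathbf{0}$ (computed with $\mathbf{G}^n=\mathbf{G}^{n,\zeta_2,k}$). (iii) If $c=\zeta_3$, then there exist non-trivial solutions $\bm{\psi}=\widehat{\bm{\psi}}_{n,k}\in H^1_{loc}(\mathbb{R}^3)^3$ of $(P_c)$, $k=1,2,\dots,2n+3$, of the form $$\widehat{\bm{\psi}}_{n,k}(x)=\begin{cases}\mathbf{G}^{n,\zeta_3,k}\,r^n\mathbf{Y}_n(\hat x), & r\le R,\\[1mm] \mathbf{G}^{n,\zeta_3,k}\,\dfrac{R^{2n+1}}{r^{n+1}}\mathbf{Y}_n(\hat x)+k_n(r^2-R^2)\begin{bmatrix}\mathbf{t}^1_{n+1}\mathbf{D}^{(n+2)x_1}_{n+1}\\ \mathbf{t}^1_{n+1}\mathbf{D}^{(n+2)x_2}_{n+1}\\ \mathbf{t}^1_{n+1}\mathbf{D}^{(n+2)x_3}_{n+1}\end{bmatrix}\dfrac{R^{2n+1}}{r^{n+3}}\mathbf{Y}_{n+2}(\hat x), & r>R,\end{cases}$$ where the complex $3\times(2n+1)$ matrices $\mathbf{G}^{n,\zeta_3,k}$ satisfy $\mathbf{t}^1_{n+1}\neq\mathbf{0}$ and $\mathbf{t}^3_{n-1}=\mathbf{0}$ (computed with $\mathbf{G}^n=\mathbf{G}^{n,\zeta_3,k}$).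
   Context: Notation. $B_R$ is the ball of radius $R$ centred at the origin in $\mathbb{R}^3$; $r=\|x\|$, $\hat x=x/r$. For (piecewise constant) coefficients $\lambda',\mu'$, the Lamé operator is $\mathcal{L}_{\lambda',\mu'}\mathbf{u}=\nabla\cdot\big(\lambda'(\nabla\cdot\mathbf{u})I+2\mu'\nabla^s\mathbf{u}\big)$ with $\nabla^s\mathbf{u}=\frac12(\nabla\mathbf{u}+\nabla\mathbf{u}^T)$; where the coefficients are constant it equals $\mu'\Delta\mathbf{u}+(\lambda'+\mu')\nabla\nabla\cdot\mathbf{u}$. The conormal derivative (traction) is $\partial_{\bm{\nu}_{\lambda',\mu'}}\mathbf{u}=\lambda'(\nabla\cdot\mathbf{u})\bm{\nu}+\mu'(\nabla\mathbf{u}+\nabla\mathbf{u}^T)\bm{\nu}$, with $\bm{\nu}$ the exterior unit normal; $|_\pm$ denote traces from outside ($+$) and inside ($-$) of $B_R$. For $n\ge0$, $Y_n^m$ ($m=n,n-1,\dots,-n$) are the orthonormalized Laplace spherical harmonics of degree $n$ and order $m$, and $\mathbf{Y}_n(\hat x)$ is the column vector of size $2n+1$ with entries $Y_n^n(\hat x),\dots,Y_n^{-n}(\hat x)$. For $j=1,2,3$ the matrices $\mathbf{D}_{n+1}^{nx_j}$ and $\mathbf{D}_n^{(n+1)x_j}$ are defined by $$\frac{\partial}{\partial x_j}\big[r^{n+1}\mathbf{Y}_{n+1}(\hat x)\big]=\mathbf{D}_{n+1}^{nx_j}\,r^n\mathbf{Y}_n(\hat x),\qquad \frac{\partial}{\partial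 x_j}\big[r^{-n-1}\mathbf{Y}_n(\hat x)\big]=\mathbf{D}_n^{(n+1)x_j}\,r^{-n-2}\mathbf{Y}_{n+1}(\hat x).$$ For a complex $3\times(2n+1)$ matrix $\mathbf{G}^n$ with rows $\mathbf{G}^n_{1,:},\mathbf{G}^n_{2,:},\mathbf{G}^n_{3,:}$, $$\mathbf{t}^1_{n+1}:=\sum_{j=1}^3\mathbf{G}^n_{j,:}\mathbf{D}_n^{(n+1)x_j},\qquad \mathbf{t}^3_{n-1}:=\sum_{j=1}^3\mathbf{G}^n_{j,:}\mathbf{D}_n^{(n-1)x_j}.$$ Further, $$k_n:=\frac{\lambda+\mu}{2((n+2)\lambda+(3n+5)\mu)},\qquad M_n:=\frac{\lambda+\mu}{2((n-1)\lambda+(3n-2)\mu)}.$$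
   Formalization: In ζ_2 the numerator factor (n-1)λ+(2n-2)μ is corrected to (n-1)λ+(3n-2)μ; with the printed factor part (ii) is false, e.g. for λ=μ=1, n=2 the required value is c=-2, not the printed -6/5. *)

(* Defs.v *)
From HB Require Import structures.
From mathcomp Require Import all_boot all_order all_algebra.
From mathcomp Require Import all_classical all_reals all_analysis.
From mathcomp Require Import complex.

Set Implicit Arguments.
Unset Strict Implicit.
Unset Printing Implicit Defensive.

Import Order.TTheory GRing.Theory Num.Theory.
Import numFieldNormedType.Exports.
Import Normc.

Local Open Scope classical_set_scope.
Local Open Scope ring_scope.
Local Open Scope complex_scope.

Section Geometry.
Variable R : realType.

(* The library norm on ['rV[R]_3] is the sup norm; this is the Euclidean one. *)
Definition enorm (x : 'rV[R]_3) : R := Num.sqrt (\sum_(j < 3) x 0 j ^+ 2).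

(* [xhat 0 = 0]. *)
Definition xhat (x : 'rV[R]_3) : 'rV[R]_3 := (enorm x)^-1 *: x.

Definition partial (j : 'I_3) (f : 'rV[R]_3 -> R) (x : 'rV[R]_3) : R :=
  'D_(delta_mx 0 j) f x.

Definition partialC (j : 'I_3) (f : 'rV[R]_3 -> R[i]) (x : 'rV[R]_3) : R[i] :=
  partial j (fun y => complex.Re (f y)) x +i*
  partial j (fun y => complex.Im (f y)) x.

End Geometry.

Section SphericalHarmonics.
Variable R : realType.

(* Legendre polynomial, by Rodrigues' formula. *)
Definition legendre (n : nat) : {poly R} :=
  (2 ^+ n * n`!%:R)^-1 *: (('X^2 - 1) ^+ n)^`(n).

Definition Ynorm (n k : nat) : R :=
  Num.sqrt ((2 * n + 1)%:R / (4 * pi) * (n - k)`!%:R / (n + k)`!%:R).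

(* On the unit sphere x = (sin t cos p, sin t sin p, cos t) one has
   x_1 + i x_2 = sin t e^{ip}, so that for 0 <= k <= n this is
   Ynorm n k * P_n^k(cos t) * e^{ikp}, where
   P_n^k(s) = (-1)^k (1 - s^2)^{k/2} P_n^(k)(s) is the associated Legendre
   function with the Condon-Shortley phase. *)
Definition Ynonneg (n k : nat) (x : 'rV[R]_3) : R[i] :=
  (Ynorm n k)%:C * (-1) ^+ k * (x 0 0 +i* x 0 1) ^+ k
  * ((legendre n)^`(k)).[x 0 2]%:C.

Definition sphharm (n : nat) (m : int) (x : 'rV[R]_3) : R[i] :=
  match m with
  | Posz k => Ynonneg n k x
  | Negz k => (-1) ^+ k.+1 * (Ynonneg n k.+1 x)^*
  end.

(* The entries are Y_n^n, Y_n^{n-1}, ..., Y_n^{-n}. *)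
Definition Yvec (n : nat) (x : 'rV[R]_3) : 'cV[R[i]]_(n.*2.+1) :=
  \col_i sphharm n (n%:Z - i%:Z) x.

Definition regsolid (n : nat) (x : 'rV[R]_3) : 'cV[R[i]]_(n.*2.+1) :=
  (enorm x ^+ n)%:C *: Yvec n (xhat x).

Definition irrsolid (n : nat) (x : 'rV[R]_3) : 'cV[R[i]]_(n.*2.+1) :=
  (enorm x ^- n.+1)%:C *: Yvec n (xhat x).

(* [Dreg n j] is D_n^{(n-1)x_j}, meaningful for n >= 1. *)
Definition is_Dreg (n : nat) (j : 'I_3)
    (D : 'M[R[i]]_(n.*2.+1, n.-1.*2.+1)) : Prop :=
  forall (x : 'rV[R]_3) (i : 'I_(n.*2.+1)), x != 0 ->
    partialC j (fun y => regsolid n y i 0) x = (D *m regsolid n.-1 x) i 0.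

Definition Dreg (n : nat) (j : 'I_3) : 'M[R[i]]_(n.*2.+1, n.-1.*2.+1) :=
  xget 0 [set D | is_Dreg j D].

(* [Dirr n j] is D_n^{(n+1)x_j}. *)
Definition is_Dirr (n : nat) (j : 'I_3)
    (D : 'M[R[i]]_(n.*2.+1, n.+1.*2.+1)) : Prop :=
  forall (x : 'rV[R]_3) (i : 'I_(n.*2.+1)), x != 0 ->
    partialC j (fun y => irrsolid n y i 0) x = (D *m irrsolid n.+1 x) i 0.

Definition Dirr (n : nat) (j : 'I_3) : 'M[R[i]]_(n.*2.+1, n.+1.*2.+1) :=
  xget 0 [set D | is_Dirr j D].

(* [t1 G] is t^1_{n+1} and [t3 G] is t^3_{n-1}. *)
Definition t1 (n : nat) (G : 'M[R[i]]_(3, n.*2.+1)) : 'rV[R[i]]_(n.+1.*2.+1) :=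
  \sum_(j < 3) row j G *m Dirr n j.

Definition t3 (n : nat) (G : 'M[R[i]]_(3, n.*2.+1)) : 'rV[R[i]]_(n.-1.*2.+1) :=
  \sum_(j < 3) row j G *m Dreg n j.

End SphericalHarmonics.

Section Sobolev.
Variable R : realType.

(* R^3 as a measurable space, with the product Borel sigma-algebra. *)
Local Notation mR3 :=
  (measurableTypeR R * measurableTypeR R * measurableTypeR R)%type.

Definition vec3 (p : mR3) : 'rV[R]_3 :=
  \row_(j < 3) tnth [tuple p.1.1 : R; p.1.2 : R; p.2 : R] j.

Definition leb3 : {measure set mR3 -> \bar R} :=
  ((@lebesgue_measure R \x @lebesgue_measure R) \x @lebesgue_measure R)%E.

Definition integralC (f : 'rV[R]_3 -> R[i]) : R[i] :=
  (\int[leb3]_p complex.Re (f (vec3 p))) +i*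
  (\int[leb3]_p complex.Im (f (vec3 p))).

Definition L2loc (f : 'rV[R]_3 -> R[i]) : Prop :=
  [/\ measurable_fun [set: mR3] (fun p => complex.Re (f (vec3 p))),
      measurable_fun [set: mR3] (fun p => complex.Im (f (vec3 p))) &
      forall rho : R,
        (\int[leb3]_(p in [set p : mR3 | (enorm (vec3 p) <= rho)%R])
           (normc (f (vec3 p)) ^+ 2)%:E < +oo)%E].

(* Real-valued C_c^oo functions on R^3. *)
Definition test_fun (phi : 'rV[R]_3 -> R) : Prop :=
  (forall (s : seq 'I_3) (x : 'rV[R]_3),
     differentiable (foldr (@partial R) phi s) x) /\
  (exists rho : R, forall x : 'rV[R]_3, rho < enorm x -> phi x = 0).

(* [g x i j] is the weak derivative of the i-th component in direction x_j. *)
Definition weak_gradient (u : 'rV[R]_3 -> 'cV[R[i]]_3)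
    (g : 'rV[R]_3 -> 'M[R[i]]_3) : Prop :=
  forall i j : 'I_3,
    L2loc (fun x => g x i j) /\
    forall phi, test_fun phi ->
      integralC (fun x => u x i 0 * (partial j phi x)%:C) =
      - integralC (fun x => g x i j * (phi x)%:C).

Definition H1loc (u : 'rV[R]_3 -> 'cV[R[i]]_3) : Prop :=
  (forall i, L2loc (fun x => u x i 0)) /\ exists g, weak_gradient u g.

End Sobolev.

Section Lame.
Variable R : realType.

Definition symgrad (g : 'M[R[i]]_3) : 'M[R[i]]_3 := 2^-1 *: (g + g^T).

Definition stress (lam mu : R) (g : 'M[R[i]]_3) : 'M[R[i]]_3 :=
  (lam%:C * \tr g)%:M + (2 * mu%:C) *: symgrad g.

(* L_{lam,mu} u = 0 in the sense of distributions on R^3, for variable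
   coefficients. *)
Definition lame_eq (lam mu : 'rV[R]_3 -> R) (u : 'rV[R]_3 -> 'cV[R[i]]_3) : Prop :=
  exists g, weak_gradient u g /\
    forall (i : 'I_3) (phi : 'rV[R]_3 -> R), test_fun phi ->
      \sum_(j < 3) integralC
        (fun x => stress (lam x) (mu x) (g x) i j * (partial j phi x)%:C) = 0.

Definition gradient (u : 'rV[R]_3 -> 'cV[R[i]]_3) (x : 'rV[R]_3) : 'M[R[i]]_3 :=
  \matrix_(i, j) partialC j (fun y => u y i 0) x.

Definition conormal (lam mu : R) (nu : 'cV[R[i]]_3)
    (u : 'rV[R]_3 -> 'cV[R[i]]_3) (x : 'rV[R]_3) : 'cV[R[i]]_3 :=
  (lam%:C * \tr (gradient u x)) *: nu +
  mu%:C *: ((gradient u x + (gradient u x)^T) *m nu).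

Definition normal (x : 'rV[R]_3) : 'cV[R[i]]_3 := \col_j (xhat x 0 j)%:C.

Definition inner (Rad : R) (x : 'rV[R]_3) : set_system 'rV[R]_3 :=
  within [set y | enorm y < Rad] (nbhs x).

Definition outer (Rad : R) (x : 'rV[R]_3) : set_system 'rV[R]_3 :=
  within [set y | Rad < enorm y] (nbhs x).

Definition has_trace (F : set_system 'rV[R]_3) (f : 'rV[R]_3 -> 'cV[R[i]]_3)
    (L : 'cV[R[i]]_3) : Prop :=
  forall i : 'I_3,
    ((fun y => complex.Re (f y i 0)) @ F --> complex.Re (L i 0)) /\
    ((fun y => complex.Im (f y i 0)) @ F --> complex.Im (L i 0)).

Definition classical_at (u : 'rV[R]_3 -> 'cV[R[i]]_3) (y : 'rV[R]_3) : Prop :=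
  forall i : 'I_3,
    differentiable (fun z => complex.Re (u z i 0)) y /\
    differentiable (fun z => complex.Im (u z i 0)) y.

Definition contrast (Rad c : R) (x : 'rV[R]_3) : R :=
  if enorm x <= Rad then c else 1.

(* The problem (P_c). The traces on the sphere are one-sided pointwise limits;
   [classical_at] makes the gradient in the conormal derivative meaningful. *)
Definition solves (lam mu Rad c : R) (u : 'rV[R]_3 -> 'cV[R[i]]_3) : Prop :=
  [/\ H1loc u,
      lame_eq (fun x => contrast Rad c x * lam) (fun x => contrast Rad c x * mu) u,
      forall x : 'rV[R]_3, enorm x = Rad ->
        exists L, has_trace (inner Rad x) u L /\ has_trace (outer Rad x) u L,
      (forall y : 'rV[R]_3, enorm y != Rad -> classical_at u y) /\
      (forall x : 'rV[R]_3, enorm x = Rad ->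
         exists L,
           has_trace (inner Rad x) (conormal (c * lam) (c * mu) (normal x) u) L /\
           has_trace (outer Rad x) (conormal lam mu (normal x) u) L) &
      exists K M : R, 0 < M /\ forall x : 'rV[R]_3, M <= enorm x ->
        forall i : 'I_3, normc (u x i 0) <= K / enorm x].

End Lame.

Section Modes.
Variable R : realType.

Definition zeta1 (n : nat) : R := - 1 - 3 / (n%:R - 1).

(* The factor (n-1) lam + (3n-2) mu is the one in the denominator of [Mcoef].
   Some sources print (n-1) lam + (2n-2) mu here; with that factor the interior
   and exterior tractions of [mode2] do not match when [t3 G <> 0]. *)
Definition zeta2 (lam mu : R) (n : nat) : R :=
  let N := n%:R in
  - ((2 * N + 2) * ((N - 1) * lam + (3 * N - 2) * mu)) /
    ((2 * N ^+ 2 + 1) * lam + (2 + 2 * N * (N - 1)) * mu).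

Definition zeta3 (lam mu : R) (n : nat) : R :=
  let N := n%:R in
  - ((2 * N ^+ 2 + 4 * N + 3) * lam + (2 * N ^+ 2 + 6 * N + 6) * mu) /
    (2 * N * ((N + 2) * lam + (3 * N + 5) * mu)).

Definition kcoef (lam mu : R) (n : nat) : R :=
  (lam + mu) / (2 * ((n%:R + 2) * lam + (3 * n%:R + 5) * mu)).

Definition Mcoef (lam mu : R) (n : nat) : R :=
  (lam + mu) / (2 * ((n%:R - 1) * lam + (3 * n%:R - 2) * mu)).

Definition mode1 (Rad : R) (n : nat) (G : 'M[R[i]]_(3, n.*2.+1))
    (x : 'rV[R]_3) : 'cV[R[i]]_3 :=
  let r := enorm x in
  if r <= Rad then (r ^+ n)%:C *: (G *m Yvec n (xhat x))
  else (Rad ^+ n.*2.+1 / r ^+ n.+1)%:C *: (G *m Yvec n (xhat x)).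

Definition mode2 (lam mu Rad : R) (n : nat) (G : 'M[R[i]]_(3, n.*2.+1))
    (x : 'rV[R]_3) : 'cV[R[i]]_3 :=
  let r := enorm x in
  if r <= Rad then
    (r ^+ n)%:C *: (G *m Yvec n (xhat x)) -
    (Mcoef lam mu n * (r ^+ 2 - Rad ^+ 2) * r ^+ n.-2)%:C *:
      ((\matrix_(j < 3) (t3 G *m Dreg R n.-1 j)) *m Yvec n.-2 (xhat x))
  else (Rad ^+ n.*2.+1 / r ^+ n.+1)%:C *: (G *m Yvec n (xhat x)).

Definition mode3 (lam mu Rad : R) (n : nat) (G : 'M[R[i]]_(3, n.*2.+1))
    (x : 'rV[R]_3) : 'cV[R[i]]_3 :=
  let r := enorm x in
  if r <= Rad then (r ^+ n)%:C *: (G *m Yvec n (xhat x))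
  else
    (Rad ^+ n.*2.+1 / r ^+ n.+1)%:C *: (G *m Yvec n (xhat x)) +
    (kcoef lam mu n * (r ^+ 2 - Rad ^+ 2) * (Rad ^+ n.*2.+1 / r ^+ n.+3))%:C *:
      ((\matrix_(j < 3) (t1 G *m Dirr R n.+1 j)) *m Yvec n.+2 (xhat x)).

Definition lin_indep (N : nat) (u : 'I_N -> 'rV[R]_3 -> 'cV[R[i]]_3) : Prop :=
  forall a : 'I_N -> R[i],
    (forall x, \sum_(k < N) a k *: u k x = 0) -> forall k, a k = 0.

End Modes.

(* Main.v *)
(* A field that is continuous across the sphere |x| = Rad, with a divergence-
   free stress on each side and matching tractions, solves (P_c): its weak
   gradient is its pointwise one, by integration by parts against test functions
   cut off inside the sphere, and the same computation gives the distributional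
   equation. The fields of interest, and all their derivatives, are polynomials
   in the coordinates and 1/|x|, so they are handled through formal expressions
   with a formal derivative.

   If P is harmonic and homogeneous of degree s, then P + kappa (|x|^2 - Rad^2)
   grad div P agrees with P on the sphere and satisfies the Lame equations as
   soon as mu kappa (4 s - 2) + (lambda + mu)(1 + 2 kappa (s - 1)) = 0. With s =
   n this gives kappa = - M_n, and with s = - n - 1 it gives kappa = k_n; the
   three modes are this ansatz for P = G r^n Y_n inside and for its Kelvin
   transform outside.

   It remains to choose G and match the tractions. For (i), the kernel of G |->
   (t1 G, t3 G) has dimension at least 3 (2n+1) - (2n+3) - (2n-1) = 2n + 1, and
   on this kernel x . P = 0, which turns the traction condition into c (n - 1) =
   - (n + 2). For (ii), P is the Kelvin transform of the gradient of an
   irregular solid harmonic of degree n - 1; for (iii), P is the gradient of a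
   regular solid harmonic of degree n + 1. Their t3, resp. t1, is a nonzero
   multiple of a basis vector, which gives independence, and the tractions match
   exactly for zeta2, resp. zeta3. *)

Require Import Defs.
From HB Require Import structures.
From mathcomp Require Import all_boot all_order all_algebra.
From mathcomp Require Import all_classical all_reals all_analysis.
From mathcomp Require Import measurable_realfun.
From mathcomp Require Import complex ring lra zify.

Set Implicit Arguments.
Unset Strict Implicit.
Unset Printing Implicit Defensive.

Import Order.TTheory GRing.Theory Num.Theory.
Import numFieldNormedType.Exports.
Import Normc.

Local Open Scope classical_set_scope.
Local Open Scope ring_scope.
Local Open Scope complex_scope.

(** No surface integral over the sphere occurs. A piecewise field is split as its interior
    expression, taken on all of space, plus the jump times the indicator of the exterior. The first
    part is smooth because the interior expression is free of 1/|x|. In the second, the normal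
    component of the jump vanishes linearly at the sphere, so it absorbs the derivative of the
    cutoff, which is of size 1/distance, and dominated convergence removes that term in the limit.
    Hence the solid harmonics, defined through x/|x|, must be rewritten as genuine polynomials, and
    identities proved off the origin are extended to it by continuity. The matrices behind [t1] and
    [t3] are picked by [xget], so they mean something only once their existence is proved. It
    follows from ladder identities for d_3 and d_1 +- i d_2, which rest on recurrences for
    derivatives of Legendre polynomials; the same identities factor the Laplacian and give
    harmonicity. *)

Notation mR3 R :=
  (measurableTypeR R * measurableTypeR R * measurableTypeR R)%type.

Local Notation Re := complex.Re.
Local Notation Im := complex.Im.

(** * Integration on R^3 *)

Section Measurability.
Variable R : realType.

Lemma ord3P (P : 'I_3 -> Prop) :
  P 0 -> P 1 -> P (2%:R : 'I_3) -> forall j, P j.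
Proof.
move=> P0 P1 P2 [[|[|[|//]]] h].
- by rewrite (_ : Ordinal h = 0) //; apply: val_inj.
- by rewrite (_ : Ordinal h = 1) //; apply: val_inj.
- by rewrite (_ : Ordinal h = 2%:R) //; apply: val_inj.
Qed.

Lemma vec3_0 (p : mR3 R) : vec3 p 0 0 = p.1.1. Proof. by rewrite mxE. Qed.
Lemma vec3_1 (p : mR3 R) : vec3 p 0 1 = p.1.2. Proof. by rewrite mxE. Qed.
Lemma vec3_2 (p : mR3 R) : vec3 p 0 2%:R = p.2.
Proof. by rewrite mxE. Qed.

Lemma measurable_vec3_coord (j : 'I_3) :
  measurable_fun [set: mR3 R] (fun p => vec3 p 0 j : measurableTypeR R).
Proof.
elim/ord3P: j => /=.
- under eq_fun do rewrite vec3_0.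
  by apply: (measurableT_comp (f := fst)) => //; exact: measurable_fst.
- under eq_fun do rewrite vec3_1.
  by apply: (measurableT_comp (f := snd)) => //; exact: measurable_snd.
- under eq_fun do rewrite vec3_2.
  exact: measurable_snd.
Qed.

(** Balls for the library norm are cubes, so the preimage is a finite intersection of coordinate
    slabs. *)
Lemma measurable_vec3_ball (a : 'rV[R]_3) (e : R) :
  measurable ((@vec3 R) @^-1` ball a e).
Proof.
have [e0|e0] := ltP 0 e; last first.
  rewrite (_ : _ @^-1` _ = set0) //; apply/seteqP; split=> // p /=.
  by move=> [/lt_le_trans/(_ e0)]; rewrite ltxx.
rewrite (_ : _ @^-1` _ = \bigcap_j
   ((fun p => vec3 p 0 j : measurableTypeR R) @^-1` ball (a 0 j) e)).
  apply: fin_bigcap_measurable => // j _.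
  rewrite -[X in measurable X]setTI.
  apply: (measurable_vec3_coord j) => //.
  by apply: open_measurable; exact: ball_open.
apply/seteqP; split=> p /=; first by move=> [_ h] i _ /=; apply: h.
by move=> h; split=> // i j; rewrite ord1; exact: (h j).
Qed.

(** The topology lives on row vectors and the sigma-algebra on triples. They are compared by writing
    an open set as a countable union of cubes with rational centre and radius. *)
Lemma continuous_measurable_vec3 (f : 'rV[R]_3 -> R) :
  continuous f -> measurable_fun [set: mR3 R] (fun p => f (vec3 p)).
Proof.
move=> /continuousP cf.
apply: (measurability _ (RGenOpens.measurableE R)).
move=> _ [_ [a [b ->] <-]]; rewrite setTI.
set U := f @^-1` `]a, b[.
have oU : open U by apply: cf; exact: interval_open.
pose D (q : rat * rat * rat * rat) : set 'rV[R]_3 :=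
  ball (\row_(j < 3) tnth [tuple ratr q.1.1.1 : R; ratr q.1.1.2 : R; ratr q.1.2 : R] j)
       (ratr q.2).
rewrite (_ : (_ @^-1` _) = \bigcup_q
   (if `[< D q `<=` U >] then (@vec3 R) @^-1` D q else set0)); last first.
  apply/seteqP; split=> p /=; last first.
    by move=> [q _]; case: asboolP => // DU /= pD; exact: DU pD.
  move=> Up; have : nbhs (vec3 p) U by apply: open_nbhs_nbhs; split.
  move=> /nbhs_ballP[e /= e0 eU].
  (* A radius below e/2, so that a cube of radius [r] containing the point lies in the ball of
     radius [e] around it. *)
  have [r] := rat_in_itvoo (divr_gt0 e0 (ltr0n _ 2)).
  rewrite in_itv /= => /andP[r0 re].
  have hq (x : R) : exists q : rat, `|ratr q - x| < ratr r :> R.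
    have [|q] := @rat_in_itvoo R (x - ratr r) (x + ratr r); first by lra.
    by rewrite in_itv /= => /andP[h1 h2]; exists q; rewrite ltr_norml; lra.
  have [q0 h0] := hq p.1.1; have [q1 h1] := hq p.1.2; have [q2 h2] := hq p.2.
  exists (q0, q1, q2, r) => //.
  have pD : D (q0, q1, q2, r) (vec3 p).
    split=> // i; rewrite ord1; elim/ord3P; rewrite !mxE /=.
    + exact: h0.
    + exact: h1.
    + exact: h2.
  case: asboolP => //= -[]; apply: subset_trans eU => x Dx.
  split=> // i j; rewrite ord1; have := Dx.2 0 j; have := pD.2 0 j.
  rewrite /ball /= !ltr_norml; lra.
apply: countable_bigcupT_measurable => // q.
case: ifP => // _; exact: measurable_vec3_ball.
Qed.
End Measurability.

Section EuclideanNorm.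
Variable R : realType.
Implicit Type x : 'rV[R]_3.

Lemma sum_ord3 (V : zmodType) (F : 'I_3 -> V) :
  \sum_(j < 3) F j = F 0 + F 1 + F 2%:R.
Proof.
rewrite !big_ord_recr big_ord0 /= add0r.
by congr (F _ + F _ + F _); apply: val_inj.
Qed.

Lemma enorm_ge0 x : 0 <= enorm x. Proof. exact: sqrtr_ge0. Qed.

Lemma enorm_sqr x : enorm x ^+ 2 = \sum_(j < 3) x 0 j ^+ 2.
Proof. by rewrite sqr_sqrtr// sumr_ge0// => j _; rewrite sqr_ge0. Qed.

Lemma coord_le_enorm x (j : 'I_3) : `|x 0 j| <= enorm x.
Proof.
rewrite -(ler_pXn2r (_ : 0 < 2)%N) ?nnegrE ?enorm_ge0 //.
rewrite enorm_sqr -normrX ger0_norm ?sqr_ge0// (bigD1 j)//= lerDl.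
by rewrite sumr_ge0// => i _; rewrite sqr_ge0.
Qed.

Lemma enorm0 : enorm (0 : 'rV[R]_3) = 0.
Proof.
apply/eqP; rewrite -sqrf_eq0 enorm_sqr; apply/eqP/big1 => j _.
by rewrite mxE expr0n.
Qed.

Lemma enorm_eq0 x : (enorm x == 0) = (x == 0).
Proof.
apply/eqP/eqP => [x0|->]; last exact: enorm0.
apply/rowP => j; rewrite mxE; apply/eqP; rewrite -normr_le0 -x0.
exact: coord_le_enorm.
Qed.

Lemma enorm_gt0 x : (0 < enorm x) = (x != 0).
Proof. by rewrite lt0r enorm_eq0 enorm_ge0 andbT. Qed.

Lemma continuous_coord (j : 'I_3) : continuous (fun x : 'rV[R]_3 => x 0 j).
Proof. by move=> x; apply: differentiable_continuous; exact: differentiable_coord. Qed.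

Lemma continuous_enorm : continuous (@enorm R).
Proof.
move=> x; apply: (continuous_comp (f := fun x : 'rV[R]_3 => \sum_(j < 3) x 0 j ^+ 2)
  (g := Num.sqrt)); last exact: sqrt_continuous.
rewrite (_ : (fun _ => _) = fun x => x 0 0 * x 0 0 + x 0 1 * x 0 1 +
  x 0 2%:R * x 0 2%:R); last by apply/funext => y; rewrite sum_ord3 !expr2.
by apply: continuousD; [apply: continuousD|]; apply: continuousM;
  exact: continuous_coord.
Qed.

Lemma open_enorm_gt (rho : R) : open [set x : 'rV[R]_3 | rho < enorm x].
Proof.
rewrite (_ : mkset _ = (@enorm R) @^-1` [set y | rho < y]) //.
by apply: open_comp; [move=> x _; exact: continuous_enorm|exact: open_gt].
Qed.

Lemma open_enorm_lt (rho : R) : open [set x : 'rV[R]_3 | enorm x < rho].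
Proof.
rewrite (_ : mkset _ = (@enorm R) @^-1` [set y | y < rho]) //.
by apply: open_comp; [move=> x _; exact: continuous_enorm|exact: open_lt].
Qed.

End EuclideanNorm.

Section Integration.
Variable R : realType.

Definition supported_in (rho : R) (f : 'rV[R]_3 -> R) :=
  forall x, rho < enorm x -> f x = 0.

(** The strict inequality makes the region where [f] is known to vanish open, so the derivative
    there sees the zero function. *)
Lemma partial_supported (rho : R) j f :
  supported_in rho f -> supported_in rho (partial j f).
Proof.
move=> sf x rx; rewrite /partial (@near_eq_derive _ _ _ _ (fun=> 0)).
  by rewrite derive_cst.
near=> y; apply: sf; near: y.
by apply: open_nbhs_nbhs; split => //; exact: open_enorm_gt.
Unshelve. all: end_near. Qed.

Definition integrable3 (f : 'rV[R]_3 -> R) :=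
  (leb3 R).-integrable setT (fun p => (f (vec3 p))%:E).

(** Domination by [C] times the indicator of a cube, whose product measure is finite. *)
Lemma integrable3_bounded (f : 'rV[R]_3 -> R) (rho C : R) :
  measurable_fun [set: mR3 R] (fun p => f (vec3 p)) ->
  supported_in rho f -> (forall x, `|f x| <= C) -> integrable3 f.
Proof.
move=> mf sf fC.
pose I : set (measurableTypeR R) := `[- `|rho|, `|rho| ]%classic.
have mI : measurable I by exact: measurable_itv.
pose B := (I `*` I) `*` I.
have mB : measurable B by apply: measurableX => //; apply: measurableX.
have lI : (@lebesgue_measure R I < +oo)%E.
  by rewrite lebesgue_measure_itv /=; case: ifP => _; rewrite // ltry.
have lB : (leb3 R B < +oo)%E.
  have -> : (leb3 R B = @lebesgue_measure R I * @lebesgue_measure R I *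
      @lebesgue_measure R I)%E.
    rewrite [LHS](product_measure1E _ (@lebesgue_measure R)) //;
      last exact: measurableX.
    congr (_ * _)%E; exact: (product_measure1E _ (@lebesgue_measure R)).
  have lIf : (@lebesgue_measure R I \is a fin_num)%E by rewrite ge0_fin_numE.
  by rewrite -ge0_fin_numE ?mule_ge0// !fin_numM.
have iB : (leb3 R).-integrable setT (fun p => (C * \1_B p)%:E).
  apply/integrableP; split.
    by apply/measurable_EFinP; apply: measurable_funM => //.
  under eq_integral do rewrite EFinM abseM /= (@ger0_norm _ (\1_B _)) //.
  rewrite ge0_integralZl//=.
  - rewrite integral_indic// setIT lte_mul_pinfty//.
  - by apply/measurable_EFinP.
apply: le_integrable iB => //.
- exact/measurable_EFinP.
- move=> p _ /=; rewrite lee_fin indicE.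
  have C0 : 0 <= C by apply: le_trans (fC 0).
  have [pB|pB] := boolP (p \in B).
    by rewrite mulr1 (ger0_norm C0).
  rewrite mulr0 normr0 normr_le0; apply/eqP/sf; rewrite ltNge; apply/negP => prho.
  move/negP: pB; apply; rewrite inE /B /I /=.
  have h j : vec3 p 0 j \in `[- `|rho|, `|rho| ]%R.
    rewrite in_itv /= -ler_norml (le_trans (coord_le_enorm _ _))//.
    by rewrite (le_trans prho)// ler_norm.
  by have := h 0; have := h 1; have := h 2%:R; rewrite vec3_0 vec3_1 vec3_2.
Qed.

End Integration.

(* The library's sigma-finiteness instance for [\x] is shadowed by the one for
   subprobabilities, hence this alias. *)
Section PlaneMeasure.
Variable R : realType.

Definition leb2 : set (measurableTypeR R * measurableTypeR R) -> \bar R :=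
  (@lebesgue_measure R \x @lebesgue_measure R)%E.

HB.instance Definition _ := Measure.on leb2.

Let leb2_sigma_finite : sigma_finite setT leb2.
Proof.
pose I n : set (measurableTypeR R) := `[- n%:R, n%:R]%classic.
have mI n : measurable (I n) by exact: measurable_itv.
exists (fun n => I n `*` I n).
  apply/seteqP; split=> // -[x y] _.
  have [n hn] : exists n : nat, `|x| + `|y| < n%:R.
    by exists (Num.bound (`|x| + `|y|)); apply: archi_boundP; rewrite addr_ge0.
  exists n => //; split; rewrite /I /= in_itv /= -ler_norml; apply: ltW;
    apply: le_lt_trans hn; by rewrite ?lerDl ?lerDr.
move=> n; split; first exact: measurableX.
have lI : (@lebesgue_measure R (I n) \is a fin_num)%E.
  rewrite lebesgue_measure_itv /=; case: ifP => _ //.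
by rewrite /leb2 product_measure1E// -ge0_fin_numE ?mule_ge0// fin_numM.
Qed.

HB.instance Definition _ :=
  Measure_isSigmaFinite.Build _ _ _ leb2 leb2_sigma_finite.

End PlaneMeasure.

Section IntegralOfDerivative.
Variable R : realType.

Lemma is_derive_line (f : 'rV[R]_3 -> R) (x v : 'rV[R]_3) (t : R) :
  differentiable f (x + t *: v) ->
  is_derive t (1 : R) (fun s => f (x + s *: v)) ('D_v f (x + t *: v)).
Proof.
move=> df.
have E : (fun h => h^-1 *: ((fun s => f (x + s *: v)) (h *: 1 + t) -
    (fun s => f (x + s *: v)) t)) =
    (fun h : R => h^-1 *: (f (h *: v + (x + t *: v)) - f (x + t *: v))).
  apply/funext => h /=; congr (_ *: (f _ - _)).
  by rewrite scalerDl scaler1 addrCA.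
have := diff_derivable (v := v) df; rewrite /derivable => cf.
apply: DeriveDef.
  by rewrite /derivable E.
by rewrite /derive E.
Qed.

(** The fundamental theorem of calculus on [[- a, a]], with [a] beyond the support so that both
    boundary values vanish. *)
Lemma integral_derivative_eq0 (g g' : R -> R) (rho : R) :
  (forall t : R, is_derive t (1 : R) g (g' t)) -> continuous g' ->
  (forall t, rho < `|t| -> g t = 0) -> (forall t, rho < `|t| -> g' t = 0) ->
  (\int[@lebesgue_measure R]_t (g' t)%:E = 0)%E.
Proof.
move=> dg cg' sg sg'.
pose a := `|rho| + 1.
have a0 : 0 < a by rewrite ltr_wpDl.
have rhoa : rho < `|a|.
  by rewrite (gtr0_norm a0) (le_lt_trans (ler_norm _))// ltrDl.
rewrite (_ : (fun t => (g' t)%:E) = (fun t => (g' t)%:E) \_ `[- a, a]); last first.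
  apply/funext => t; rewrite patchE; case: ifPn => //.
  rewrite notin_setE /= in_itv /= -ler_norml => /negP; rewrite -ltNge => ta.
  by rewrite sg'//; apply: lt_trans rhoa _; rewrite (gtr0_norm a0).
rewrite -integral_mkcond.
have cg : continuous g.
  by move=> t; apply: differentiable_continuous; apply/derivable1_diffP; case: (dg t).
rewrite (@continuous_FTC2 _ g' g); first by rewrite !sg ?normrN// subee.
- lra.
- by apply: continuous_subspaceT.
- split.
  + by move=> t _; case: (dg t).
  + by apply: cvg_at_right_filter; exact: cg.
  + by apply: cvg_at_left_filter; exact: cg.
- by move=> t _; rewrite derive1E; case: (dg t).
Qed.

Lemma supported_bounded (f : 'rV[R]_3 -> R) (rho : R) :
  continuous f -> supported_in rho f -> exists C, forall x, `|f x| <= C.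
Proof.
move=> cf sf.
pose A : set 'rV[R]_3 := [set v | forall i, v ord0 i \in `[- rho, rho]].
have cA : compact A.
  by apply: (rV_compact (A := fun=> `[- rho, rho]%classic)) => _; exact: segment_compact.
have : compact (f @` A).
  by apply: continuous_compact cA; exact: continuous_subspaceT.
move=> /compact_bounded [M [_ hM]].
exists (Num.max 0 (M + 1)) => x.
have [/sf ->|xr] := ltP rho (enorm x); first by rewrite normr0 le_max lexx.
rewrite le_max; apply/orP; right; apply: (hM (M + 1)); first by rewrite ltrDl.
exists x => // i; rewrite in_itv /= -ler_norml.
exact: le_trans (coord_le_enorm _ _) xr.
Qed.

Definition row3 (a b c : R) : 'rV[R]_3 :=
  \row_(j < 3) tnth [tuple a; b; c] j.

Section Axes.
Variables (f : 'rV[R]_3 -> R) (rho : R).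
Hypothesis df : forall x, differentiable f x.
Hypothesis sf : supported_in rho f.

Lemma integral_partial_line (j : 'I_3) (x : 'rV[R]_3) : x 0 j = 0 -> continuous (partial j f) ->
  (\int[@lebesgue_measure R]_t (partial j f (x + t *: delta_mx 0 j))%:E = 0)%E.
Proof.
move=> xj cf.
have h t : rho < `|t| -> rho < enorm (x + t *: delta_mx 0 j).
  move=> /lt_le_trans; apply; apply: le_trans (coord_le_enorm _ j).
  by rewrite !mxE !eqxx xj mulr1 add0r.
apply: (@integral_derivative_eq0 (fun t => f (x + t *: delta_mx 0 j)) _ rho) => t.
- exact: is_derive_line.
- have cl : {for t, continuous (fun t : R => x + t *: delta_mx 0 j)}.
    by apply: continuousD; [exact: cst_continuous|exact: scalel_continuous].
  exact: (continuous_comp cl (cf _)).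
- by move=> /h /sf.
- by move=> /h /(partial_supported j sf).
Qed.

Lemma vec3_line0 (a b t : R) :
  vec3 ((t, a), b) = row3 0 a b + t *: delta_mx 0 0.
Proof.
apply/rowP; elim/ord3P; rewrite !mxE /= ?mulr1 ?mulr0 ?addr0 ?add0r //.
Qed.

Lemma vec3_line1 (a b t : R) :
  vec3 ((a, t), b) = row3 a 0 b + t *: delta_mx 0 1.
Proof.
apply/rowP; elim/ord3P; rewrite !mxE /= ?mulr1 ?mulr0 ?addr0 ?add0r //.
Qed.

Lemma vec3_line2 (q : measurableTypeR R * measurableTypeR R) (t : R) :
  vec3 (q, t) = row3 q.1 q.2 0 + t *: delta_mx 0 2%:R.
Proof.
apply/rowP; elim/ord3P; rewrite !mxE /= ?mulr1 ?mulr0 ?addr0 ?add0r //.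
Qed.

Let mu := @lebesgue_measure R.

(** Fubini with the variable x_j integrated innermost reduces this to a derivative along a line. *)
Lemma integral_partial_eq0 (j : 'I_3) : continuous (partial j f) ->
  (\int[leb3 R]_p (partial j f (vec3 p))%:E = 0)%E.
Proof.
move=> cf.
have [C fC] := supported_bounded cf (partial_supported j sf).
have int : (@leb2 R \x mu)%E.-integrable setT
    (fun p => (partial j f (vec3 p))%:E).
  apply: integrable3_bounded (partial_supported j sf) fC.
  exact: continuous_measurable_vec3.
(* For the first two directions the section at height [t] is a plane integral, to which Fubini is
   applied again. The section is known to be integrable only for almost every [t], hence the
   premise. *)
have fib (t : R) :
    (@leb2 R).-integrable setT (fun q => (partial j f (vec3 (q, t)))%:E) ->
    j != 2%:R -> (fubini_G (@leb2 R)
      (fun p => (partial j f (vec3 p))%:E) t = 0)%E.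
  rewrite /fubini_G; move: cf; elim/ord3P: (j) => cf1 it // _.
  - rewrite -integral21_prod_meas1//; apply: integral0_eq => a _.
    rewrite /fubini_G -[RHS](integral_partial_line (x := row3 0 a t) _ cf1).
      by apply: eq_integral => s _; rewrite vec3_line0.
    by rewrite mxE.
  - rewrite -integral12_prod_meas1//; apply: integral0_eq => a _.
    rewrite /fubini_F -[RHS](integral_partial_line (x := row3 a 0 t) _ cf1).
      by apply: eq_integral => s _; rewrite vec3_line1.
    by rewrite mxE.
have -> : (\int[leb3 R]_p (partial j f (vec3 p))%:E =
    \int[@leb2 R \x mu]_p (partial j f (vec3 p))%:E)%E by [].
have [j2|j2] := eqVneq j 2%:R.
  rewrite -[LHS](integral12_prod_meas1 int); apply: integral0_eq => q _.
  rewrite /fubini_F -[RHS](integral_partial_line (x := row3 q.1 q.2 0) _ cf).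
    by apply: eq_integral => s _; rewrite vec3_line2 j2.
  by rewrite j2 mxE.
rewrite -[LHS](integral21_prod_meas1 int).
rewrite -[RHS](integral0 mu setT); apply: ae_eq_integral => //.
  exact: (measurable_fubini_G int).
by apply: filterS (ae_integrable2 int) => t it _; exact: fib.
Qed.

End Axes.
End IntegralOfDerivative.

(** * Integration by parts outside a ball *)

Section Calculus.
Variable R : realType.
Implicit Types (f g : 'rV[R]_3 -> R) (x : 'rV[R]_3).

Lemma partialD j f g x : differentiable f x -> differentiable g x ->
  partial j (fun y => f y + g y) x = partial j f x + partial j g x.
Proof. by move=> df dg; apply: (@deriveD _ _ _ f g); exact: diff_derivable. Qed.

Lemma partialB j f g x : differentiable f x -> differentiable g x ->
  partial j (fun y => f y - g y) x = partial j f x - partial j g x.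
Proof. by move=> df dg; apply: (@deriveB _ _ _ f g); exact: diff_derivable. Qed.

Lemma partialM j f g x : differentiable f x -> differentiable g x ->
  partial j (fun y => f y * g y) x = partial j f x * g x + f x * partial j g x.
Proof.
move=> df dg; rewrite /partial [LHS](@deriveM _ _ f g); try exact: diff_derivable.
by rewrite addrC [_ *: _]mulrC.
Qed.

Lemma partial_cst j (c : R) x : partial j (fun=> c) x = 0.
Proof. exact: derive_cst. Qed.

Lemma partial_coord (j i : 'I_3) x :
  partial j (fun y : 'rV[R]_3 => y 0 i) x = (i == j)%:R.
Proof.
rewrite /partial /derive; apply/lim_near_cst => //; near=> h.
have h0 : h != 0 by near: h; exact: nbhs_dnbhs_neq.
by rewrite /= !mxE eqxx /= addrK scalerA mulVf// scale1r.
Unshelve. all: end_near. Qed.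

Lemma differentiable_chain (h : R -> R) (d : R) f x :
  is_derive (f x) (1 : R) h d -> differentiable f x ->
  differentiable (fun y => h (f y)) x.
Proof.
move=> [dh _] df; apply: (differentiable_comp df).
by apply/derivable1_diffP.
Qed.

Lemma partial_chain j (h : R -> R) (d : R) f x :
  is_derive (f x) (1 : R) h d -> differentiable f x ->
  partial j (fun y => h (f y)) x = d * partial j f x.
Proof.
move=> [dh hd] df; rewrite /partial.
have dh' : differentiable h (f x) by apply/derivable1_diffP.
rewrite (@deriveE _ _ _ (h \o f)); last exact: differentiable_comp.
rewrite diff_comp//= -(deriveE _ df).
rewrite -[X in 'd h _ X](mulr1) [X in 'd h _ X](_ : _ = 'D_(delta_mx 0 j) f x *: (1 : R))//.
rewrite linearZ/= -deriveE// hd.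
by rewrite mulrC.
Qed.

Lemma near_eq_partial j f g x : (\near x, f x = g x) ->
  partial j f x = partial j g x.
Proof. exact: near_eq_derive. Qed.

(** The first-order expansion involves only values near [x], so the differential of [f] serves for
    [g]. *)
Lemma near_eq_differentiable f g x : (\near x, f x = g x) ->
  differentiable f x -> differentiable g x.
Proof.
move=> fg /diff_locallyP[cf ef].
have eg : g \o shift x = cst (g x) + 'd f x +o_ (0 : 'rV[R]_3) id.
  apply/eqaddoP => e e0; move/eqaddoP: ef => /(_ e e0).
  rewrite !near_simpl; apply: filter_app.
  have := fg; rewrite (near_shift 0) subr0 => fg0; near=> y.
  suff -> : (g \o shift x - (cst (g x) + 'd f x)) y =
    (f \o shift x - (cst (f x) + 'd f x)) y by [].
  have fgx : f x = g x by exact: nbhs_singleton fg.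
  by rewrite !fctE /= /cst fgx; congr (_ - _); symmetry; near: y.
by apply/diff_locallyP; rewrite (diff_unique cf eg).
Unshelve. all: end_near. Qed.

Definition sqnorm (x : 'rV[R]_3) : R := \sum_(j < 3) x 0 j ^+ 2.

Lemma sqnorm_prod : sqnorm = fun x => x 0 0 * x 0 0 + x 0 1 * x 0 1 + x 0 2%:R * x 0 2%:R.
Proof. by apply/funext => x; rewrite /sqnorm sum_ord3 !expr2. Qed.

Lemma differentiable_sqnorm x : differentiable sqnorm x.
Proof.
rewrite sqnorm_prod.
by apply: differentiableD; [apply: differentiableD|]; apply: differentiableM;
  exact: differentiable_coord.
Qed.

Lemma partial_sqnorm j x : partial j sqnorm x = 2 * x 0 j.
Proof.
rewrite sqnorm_prod.
have dc i := @differentiable_coord R _ _ x 0 i.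
rewrite !partialD ?partialM ?partial_coord//; try exact: differentiableM;
  try (by apply: differentiableD; apply: differentiableM).
by elim/ord3P: j; rewrite /= ?(mulr0,mul0r,mulr1,mul1r,addr0,add0r); ring.
Qed.

End Calculus.

(** * Once differentiable cutoffs approximating the indicator of the positive half-line *)

Section Cutoff.
Variable R : realType.

Definition pospart (s : R) : R := Num.max s 0.

Lemma continuous_pospart : continuous pospart.
Proof.
move=> s; apply: (@continuous_max _ _ (fun x : R => x) (fun=> 0)) => //.
exact: cst_continuous.
Qed.

(** Squaring removes the corner of the positive part: at 0 the difference quotient lies between -|h|
    and |h|. *)
Lemma is_derive_pospart_sqr (s : R) :
  is_derive s (1 : R) (fun t => pospart t ^+ 2) (2 * pospart s).
Proof.
have [s0|s0|->] := ltgtP s 0.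
- apply: (@near_eq_is_derive _ _ _ (fun=> 0)).
    near=> t; rewrite /pospart max_r ?expr0n//; apply: ltW; near: t.
    exact: lt_nbhsl.
  by rewrite /pospart max_r ?(ltW s0)// mulr0; exact: is_derive_cst.
- apply: (@near_eq_is_derive R R R (fun t : R => t ^+ 2 : R)).
    near=> t; rewrite /pospart max_l//; apply: ltW; near: t.
    exact: lt_nbhsr.
  rewrite /pospart max_l ?(ltW s0)//.
  have h := @is_deriveX R R (fun t : R => t) 2 s 1 1 (is_derive_id _ _).
  rewrite exprfctE in h.
  by apply: (is_derive_eq h); rewrite -[_ *: _]/(_ * _) mulr1 expr1.
- have p0 : pospart 0 = 0 by exact: maxxx.
  have E : (fun h : R => h^-1 *: (pospart (h *: 1 + 0) ^+ 2 - pospart 0 ^+ 2)) @ 0^' --> (0 : R).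
    have c0 : pospart @ (0 : R)^' --> (0 : R).
      have h := @continuous_pospart 0; rewrite /continuous_at p0 in h.
      exact: cvg_within_filter h.
    apply: (@squeeze_cvgr _ _ _ _ (fun h : R => - `|h|) (fun h : R => `|h|)).
    + near=> h.
      have h0 : h != 0 by near: h; exact: nbhs_dnbhs_neq.
      rewrite [h *: 1]mulr1 addr0 p0 expr0n subr0 /pospart.
      rewrite -ler_norml /GRing.scale/= normrM normfV normrX.
      rewrite ler_pdivrMl ?normr_gt0// expr2.
      by rewrite ler_pM// maxEle; case: ifP => //; rewrite normr0.
    + rewrite -[X in _ --> X]oppr0; apply: cvgN; rewrite -[X in _ --> X](@normr0 R R).
      by apply: cvg_within_filter; exact: norm_continuous.
    + rewrite -[X in _ --> X](@normr0 R R).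
      by apply: cvg_within_filter; exact: norm_continuous.
  rewrite p0 mulr0; apply: DeriveDef.
    by apply/cvg_ex; exists 0; exact: E.
  by apply/cvg_lim => //; exact: E.
Unshelve. all: end_near. Qed.

(** This is y / (1 + y) with y = K s_+^2. The square makes it continuously differentiable, and the
    rational form gives bounds that do not depend on [K]. *)
Definition cutoff (K s : R) : R := K * pospart s ^+ 2 / (1 + K * pospart s ^+ 2).
Definition cutoff' (K s : R) : R := 2 * K * pospart s / (1 + K * pospart s ^+ 2) ^+ 2.

Lemma cutoff_den (K s : R) : 0 <= K -> 0 < 1 + K * pospart s ^+ 2.
Proof. by move=> K0; rewrite ltr_wpDr// mulr_ge0// sqr_ge0. Qed.

Lemma is_derive_cutoff (K s : R) : 0 <= K ->
  is_derive s (1 : R) (cutoff K) (cutoff' K s).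
Proof.
move=> K0; have d0 := cutoff_den s K0.
pose u (t : R) := pospart t ^+ 2.
pose D := is_derive_pospart_sqr s.
have dK : is_derive s (1 : R) (fun t => K * u t) (K * (2 * pospart s)).
  exact: (@is_deriveZ _ _ _ u K).
have d1 : is_derive s (1 : R) (fun t => 1 + K * u t) (K * (2 * pospart s)).
  have := @is_deriveD _ R R (fun=> 1) (fun t => K * u t) s 1 0 _ (is_derive_cst _ _ _) dK.
  by rewrite add0r.
have di := @is_deriveV _ (fun t => 1 + K * u t) s _ _ (lt0r_neq0 d0) d1.
have := @is_deriveM _ R (fun t => K * u t) _ s 1 _ _ dK di.
congr (is_derive _ _ _ _); rewrite /cutoff' /GRing.scale /= /u.
by field; exact: lt0r_neq0.
Qed.

Lemma cutoff_le0 (K s : R) : s <= 0 -> cutoff K s = 0.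
Proof. by move=> s0; rewrite /cutoff /pospart max_r// expr0n mulr0 mul0r. Qed.

Lemma cutoff'_le0 (K s : R) : s <= 0 -> cutoff' K s = 0.
Proof. by move=> s0; rewrite /cutoff' /pospart max_r// mulr0 mul0r. Qed.

Lemma cutoff_bounds (K s : R) : 0 <= K -> 0 <= cutoff K s <= 1.
Proof.
move=> K0; have d0 := cutoff_den s K0; have y0 : 0 <= K * pospart s ^+ 2.
  by rewrite mulr_ge0// sqr_ge0.
rewrite /cutoff; apply/andP; split; first by rewrite divr_ge0// ltW.
by rewrite ler_pdivrMr// mul1r lerDr.
Qed.

(** With y = K s_+^2 the product is 2 y / (1 + y)^2. Uniformity in [K] is the point: the steep
    derivative is harmless against a factor that vanishes linearly at the sphere. *)
Lemma cutoff'_bound (K s : R) : 0 <= K -> 0 <= cutoff' K s * pospart s <= 2.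
Proof.
move=> K0; have d0 := cutoff_den s K0.
set y := K * pospart s ^+ 2 in d0 *.
have y0 : 0 <= y by rewrite mulr_ge0// sqr_ge0.
have -> : cutoff' K s * pospart s = 2 * y / (1 + y) ^+ 2.
  by rewrite /cutoff' -/y; rewrite /y; field; exact: lt0r_neq0.
apply/andP; split.
  by apply: divr_ge0; [exact: mulr_ge0|exact/exprn_ge0/ltW].
rewrite ler_pdivrMr ?exprn_gt0// -subr_ge0.
rewrite (_ : _ - _ = 2 + 2 * y + 2 * y ^+ 2); last by ring.
by rewrite !addr_ge0// mulr_ge0// sqr_ge0.
Qed.

Lemma continuous_cutoff (K : R) : 0 <= K -> continuous (cutoff K).
Proof.
move=> K0 s; apply: differentiable_continuous; apply/derivable1_diffP.
by case: (is_derive_cutoff s K0).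
Qed.

Lemma continuous_cutoff' (K : R) : 0 <= K -> continuous (cutoff' K).
Proof.
move=> K0 s; have d0 := cutoff_den s K0.
have cp : {for s, continuous pospart} := @continuous_pospart s.
have c1 : {for s, continuous (fun s => 1 + K * (pospart s * pospart s))}.
  apply: continuousD; first exact: cst_continuous.
  by apply: continuousM; [exact: cst_continuous|exact: continuousM].
suff : {for s, continuous (fun s => 2 * K * pospart s *
  ((1 + K * (pospart s * pospart s)) * (1 + K * (pospart s * pospart s)))^-1)} by [].
apply: continuousM.
  by apply: continuousM; [exact: cst_continuous|exact: cp].
apply: (@continuousV _ _ (fun s => (1 + K * (pospart s * pospart s)) *
  (1 + K * (pospart s * pospart s)))); last exact: continuousM.
by rewrite -!expr2 expf_neq0// lt0r_neq0.
Qed.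

(** For s > 0 the distance to 1 is 1 / (1 + K s^2), at most s^-2 / K. *)
Lemma cutoff_cvg (s : R) :
  (fun k : nat => cutoff k.+1%:R s) @ \oo --> (if s <= 0 then 0 else 1 : R).
Proof.
case: ifPn => [s0|]; first by under eq_fun do rewrite cutoff_le0//; exact: cvg_cst.
rewrite -ltNge => s0.
have p0 : 0 < pospart s by rewrite /pospart lt_max s0.
apply: (@squeeze_cvgr _ _ _ _ (fun k => 1 - pospart s ^- 2 * harmonic k) (fun=> 1)).
- near=> k; have [_ ->] := andP (cutoff_bounds s (ler0n R k.+1)); rewrite andbT.
  rewrite /cutoff /harmonic; set K := k.+1%:R.
  have K0 : 0 < K by rewrite ltr0n.
  have d0 := cutoff_den s (ltW K0).
  rewrite lerBlDr -lerBlDl -[X in X - _](divff (lt0r_neq0 d0)) -mulrBl addrK mul1r.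
  by rewrite -invfM lef_pV2 ?posrE ?mulr_gt0 ?exprn_gt0// mulrC lerDr.
- rewrite -[X in _ --> X]subr0; apply: cvgB; first exact: cvg_cst.
  rewrite -[X in _ --> X](mulr0 (pospart s ^- 2)); apply: cvgM; first exact: cvg_cst.
  exact: cvg_harmonic.
- exact: cvg_cst.
Unshelve. all: end_near. Qed.

(** For s > 0 the denominator is at least (K s^2)^2, which leaves 2 s^-3 / K; for s <= 0 the
    derivative is zero, the value at the sphere included. *)
Lemma cutoff'_cvg (s : R) :
  (fun k : nat => cutoff' k.+1%:R s) @ \oo --> (0 : R).
Proof.
have [s0|s0] := leP s 0; first by under eq_fun do rewrite cutoff'_le0//; exact: cvg_cst.
have p0 : 0 < pospart s by rewrite /pospart lt_max s0.
apply: (@squeeze_cvgr _ _ _ _ (fun=> 0) (fun k => 2 * pospart s ^- 3 * harmonic k)).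
- near=> k; rewrite /cutoff' /harmonic; set K := k.+1%:R.
  have K0 : 0 < K by rewrite ltr0n.
  have d0 := cutoff_den s (ltW K0).
  rewrite divr_ge0 ?exprn_ge0 ?mulr_ge0 ?(ltW d0) ?(ltW p0) ?(ltW K0)//=.
  have -> : 2 * pospart s ^- 3 / K = 2 * K * pospart s / (K * pospart s ^+ 2) ^+ 2.
    by field; rewrite !lt0r_neq0.
  rewrite ler_wpM2l ?mulr_ge0 ?(ltW p0) ?(ltW K0)//.
  rewrite lef_pV2 ?posrE ?exprn_gt0// ?mulr_gt0 ?exprn_gt0//.
  have y0 : 0 <= K * pospart s ^+ 2 by rewrite mulr_ge0 ?(ltW K0)// sqr_ge0.
  by rewrite ler_pXn2r ?nnegrE ?(ltW d0)// lerDr.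
- exact: cvg_cst.
- rewrite -[X in _ --> X](mulr0 (2 * pospart s ^- 3)); apply: cvgM; first exact: cvg_cst.
  exact: cvg_harmonic.
Unshelve. all: end_near. Qed.

End Cutoff.

(** * Integration by parts on the exterior for fields of vanishing normal component *)

Section Outside.
Variables (R : realType) (Rad : R).
Hypothesis hRad : 0 < Rad.
Implicit Types (x : 'rV[R]_3).

(** A polynomial defining function of the sphere: unlike |x| - Rad it is differentiable at the
    origin. *)
Definition sph (x : 'rV[R]_3) : R := sqnorm x - Rad ^+ 2.

Lemma sphE x : sph x = enorm x ^+ 2 - Rad ^+ 2.
Proof. by rewrite enorm_sqr. Qed.

Lemma sph_le0 x : (sph x <= 0) = (enorm x <= Rad).
Proof. by rewrite sphE subr_le0 ler_pXn2r ?nnegrE ?enorm_ge0// ltW. Qed.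

Definition outside (x : 'rV[R]_3) : R := if enorm x <= Rad then 0 else 1.

Lemma differentiable_sph x : differentiable sph x.
Proof. by apply: differentiableB => //; exact: differentiable_sqnorm. Qed.

Lemma partial_sph j x : partial j sph x = 2 * x 0 j.
Proof.
rewrite partialB ?partial_cst ?subr0 ?partial_sqnorm//.
exact: differentiable_sqnorm.
Qed.

Lemma continuous_sph : continuous sph.
Proof. by move=> x; apply: differentiable_continuous; exact: differentiable_sph. Qed.

Lemma near_inside x : enorm x < Rad -> \near x, enorm x <= Rad.
Proof.
move=> xR; near=> y; apply: ltW; near: y.
by apply: open_nbhs_nbhs; split => //; exact: open_enorm_lt.
Unshelve. all: end_near. Qed.

Lemma neq0_outside x : Rad <= enorm x -> x != 0.
Proof. by move=> Rx; rewrite -enorm_gt0 (lt_le_trans hRad). Qed.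

Section Vanishing.
Variable h : R -> R.
Hypothesis h0 : forall s, s <= 0 -> h s = 0.

Lemma near_vanish (b : 'rV[R]_3 -> R) x : enorm x < Rad ->
  \near x, 0 = h (sph x) * b x.
Proof.
move=> /near_inside; apply: filterS => y; rewrite -sph_le0 => /h0 ->.
by rewrite mul0r.
Qed.

(** The factor [h] of [sph] is zero on a whole ball around the origin and so hides the singularity
    of [b] there. *)
Lemma vanish_continuous (b : 'rV[R]_3 -> R) : continuous h ->
  (forall x, x != 0 -> {for x, continuous b}) ->
  continuous (fun x => h (sph x) * b x).
Proof.
move=> ch cb x; have [xR|xR] := ltP (enorm x) Rad.
  rewrite /continuous_at -(nbhs_singleton (near_vanish b xR)).
  apply: cvg_trans; first exact: (near_eq_cvg (near_vanish b xR)).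
  exact: cvg_cst.
apply: (@continuousM _ _ (fun y => h (sph y)) b).
  exact: (continuous_comp (@continuous_sph x) (ch _)).
exact/cb/neq0_outside.
Qed.

End Vanishing.

Section Chi.
Variable K : R.
Hypothesis K0 : 0 <= K.

Definition chi x : R := cutoff K (sph x).

Lemma differentiable_chi x : differentiable chi x.
Proof.
exact: (differentiable_chain (is_derive_cutoff _ K0) (differentiable_sph x)).
Qed.

Lemma partial_chi j x : partial j chi x = cutoff' K (sph x) * (2 * x 0 j).
Proof.
by rewrite (partial_chain j (is_derive_cutoff _ K0) (differentiable_sph x)) partial_sph.
Qed.

Variable b : 'rV[R]_3 -> R.
Hypothesis db : forall x, x != 0 -> differentiable b x.

Lemma differentiable_chiM x : differentiable (fun y => chi y * b y) x.
Proof.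
have [xR|xR] := ltP (enorm x) Rad.
  by apply: near_eq_differentiable (near_vanish (@cutoff_le0 R K) b xR) _.
apply: differentiableM; first exact: differentiable_chi.
exact/db/neq0_outside.
Qed.

Lemma partial_chiM j x : partial j (fun y => chi y * b y) x =
  cutoff' K (sph x) * (2 * x 0 j * b x) + chi x * partial j b x.
Proof.
have [xR|xR] := ltP (enorm x) Rad.
  rewrite -(near_eq_partial j (near_vanish (@cutoff_le0 R K) b xR)) partial_cst.
  have s0 : sph x <= 0 by rewrite sph_le0 ltW.
  by rewrite /chi cutoff_le0// cutoff'_le0// !mul0r addr0.
rewrite partialM ?partial_chi ?mulrA//; first exact: differentiable_chi.
exact/db/neq0_outside.
Qed.

End Chi.

Definition shell_bounded (f : 'rV[R]_3 -> R) :=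
  forall rho, exists C, forall x, Rad <= enorm x <= rho -> `|f x| <= C.

Section Parts.
Variables (B : 'I_3 -> 'rV[R]_3 -> R) (phi : 'rV[R]_3 -> R) (rho : R).
Hypothesis dB : forall j x, x != 0 -> differentiable (B j) x.
Hypothesis cB : forall j x, x != 0 -> {for x, continuous (partial j (B j))}.
Hypothesis bB : forall j, shell_bounded (B j).
Hypothesis bdB : forall j, shell_bounded (partial j (B j)).
Hypothesis nB : forall r, exists C, forall x, Rad <= enorm x <= r ->
  `|\sum_(j < 3) x 0 j * B j x| <= C * sph x.
Hypothesis dphi : forall x, differentiable phi x.
Hypothesis cphi : forall j, continuous (partial j phi).
Hypothesis sphi : supported_in rho phi.

Let divB x := \sum_(j < 3) partial j (B j) x.
Let gradB x := \sum_(j < 3) B j x * partial j phi x.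
Let xB x := \sum_(j < 3) x 0 j * B j x.

Let f_ (k : nat) x := \sum_(j < 3) partial j
   (fun y => chi k.+1%:R y * B j y * phi y) x.

Let cBx j x : x != 0 -> {for x, continuous (B j)}.
Proof. by move=> x0; apply: differentiable_continuous; exact: dB. Qed.

Let cphi0 : continuous phi.
Proof. by move=> x; exact: differentiable_continuous. Qed.

Let partial_f j k x : partial j (fun y => chi k.+1%:R y * B j y * phi y) x =
  (cutoff' k.+1%:R (sph x) * (2 * x 0 j * B j x) + chi k.+1%:R x * partial j (B j) x)
   * phi x + chi k.+1%:R x * B j x * partial j phi x.
Proof.
rewrite partialM ?partial_chiM//; try exact: dB.
by apply: differentiable_chiM => //; exact: dB.
Qed.

(** Separates the normal component, weighted by the derivative of the cutoff, from the part that
    survives in the limit. *)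
Let fE k x : f_ k x = cutoff' k.+1%:R (sph x) * (2 * xB x * phi x) +
  chi k.+1%:R x * (divB x * phi x + gradB x).
Proof.
rewrite /f_ /xB /divB /gradB !sum_ord3 !partial_f; ring.
Qed.

Let cf j k : continuous (partial j (fun y => chi k.+1%:R y * B j y * phi y)).
Proof.
rewrite (funext (partial_f j k)).
pose b1 x := 2 * x 0 j * B j x * phi x.
pose b2 x := partial j (B j) x * phi x + B j x * partial j phi x.
rewrite (_ : (fun x => _) = fun x => cutoff' k.+1%:R (sph x) * b1 x +
   cutoff k.+1%:R (sph x) * b2 x); last first.
  by apply/funext => x; rewrite /chi /b1 /b2; ring.
move=> x; apply: (@continuousD _ _ _ (fun x => cutoff' k.+1%:R (sph x) * b1 x)).
  apply: (vanish_continuous (@cutoff'_le0 R _)); first exact: continuous_cutoff'.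
  move=> y y0; apply: continuousM; last exact: cphi0.
  apply: continuousM; last exact: cBx.
  by apply: continuousM; [exact: cst_continuous|exact: continuous_coord].
apply: (vanish_continuous (@cutoff_le0 R _)); first exact: continuous_cutoff.
move=> y y0; apply: continuousD; apply: continuousM.
- exact: cB.
- exact: cphi0.
- exact: cBx.
- exact: cphi.
Qed.

Let supp_f j k : supported_in rho (fun y => chi k.+1%:R y * B j y * phi y).
Proof. by move=> x /sphi ->; rewrite mulr0. Qed.

Let diff_f j k x : differentiable (fun y => chi k.+1%:R y * B j y * phi y) x.
Proof.
by apply: differentiableM => //; apply: differentiable_chiM => //; exact: dB.
Qed.

Let integral_f k : (\int[leb3 R]_p (f_ k (vec3 p))%:E = 0)%E.
Proof.
have int j : integrable3 (partial j (fun y => chi k.+1%:R y * B j y * phi y)).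
  have [C hC] := supported_bounded (@cf j k) (partial_supported j (@supp_f j k)).
  apply: integrable3_bounded hC; last exact: partial_supported.
  exact: continuous_measurable_vec3.
under eq_integral do rewrite /f_ sum_ord3 !EFinD.
have I j := integral_partial_eq0 (@diff_f j k) (@supp_f j k) (@cf j k).
rewrite integralD//=; last first.
- exact: int.
- exact: (integrableD measurableT (int 0) (int 1)).
by rewrite integralD ?I ?adde0//=; exact: int.
Qed.

(** The integrable majorant for dominated convergence: its constants must not depend on [k]. *)
Let g_bound : exists C D : R, [/\ 0 <= C, 0 <= D & forall x k,
  `|f_ k x| <= C * `|phi x| + D * \sum_(j < 3) `|partial j phi x|].
Proof.
have [C1 h1] := nB rho.
have /choice[C2 h2] : forall j, exists C, forall x, Rad <= enorm x <= rho -> `|B j x| <= C.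
  by move=> j; exact: bB.
have /choice[C3 h3] : forall j, exists C, forall x, Rad <= enorm x <= rho ->
    `|partial j (B j) x| <= C.
  by move=> j; exact: bdB.
pose C := 4 * `|C1| + \sum_j `|C3 j|; pose D := \sum_j `|C2 j|.
have C0 : 0 <= C by rewrite addr_ge0 ?mulr_ge0 ?sumr_ge0.
have D0 : 0 <= D by rewrite sumr_ge0.
exists C, D; split => // x k.
have nn : 0 <= C * `|phi x| + D * \sum_(j < 3) `|partial j phi x|.
  by rewrite addr_ge0 ?mulr_ge0 ?sumr_ge0.
have [xr|xr] := ltP rho (enorm x).
  suff -> : f_ k x = 0 by rewrite normr0.
  rewrite fE /gradB big1 ?sphi ?(mulr0,addr0)// => j _.
  by rewrite (partial_supported j sphi)// mulr0.
have [xR|xR] := leP (enorm x) Rad.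
  have s0 : sph x <= 0 by rewrite sph_le0.
  by rewrite fE /chi cutoff_le0// cutoff'_le0// !mul0r addr0 normr0.
have xs : Rad <= enorm x <= rho by rewrite ltW.
have s0 : 0 < sph x by rewrite ltNge sph_le0 -ltNge.
rewrite fE (le_trans (ler_normD _ _))//.
have [c0 c1] := andP (cutoff_bounds (sph x) (ler0n R k.+1)).
have := cutoff'_bound (sph x) (ler0n R k.+1).
have -> : pospart (sph x) = sph x by rewrite /pospart max_l// ltW.
move=> /andP[d0 d1].
have {}d0 : 0 <= cutoff' k.+1%:R (sph x) by move: d0; rewrite pmulr_lge0.
rewrite /chi; move: (cutoff' _ _) d0 d1 => d d0 d1.
move: (cutoff _ _) c0 c1 => c c0 c1.
(* The normal component is at most C1 times [sph x], and d times [sph x] is at most 2; with the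
   factor 2 in front this gives 4. *)
have e1 : `|d * (2 * xB x * phi x)| <= 4 * `|C1| * `|phi x|.
  rewrite !normrM (ger0_norm d0) (ger0_norm (ler0n _ 2)).
  rewrite [X in X <= _](_ : _ = 2 * (d * `|xB x|) * `|phi x|); last by ring.
  rewrite ler_wpM2r// (_ : 4 = 2 * 2); last by ring.
  rewrite -mulrA ler_wpM2l//.
  apply: (le_trans (ler_wpM2l d0 (h1 _ xs))).
  apply: (@le_trans _ _ (d * (`|C1| * sph x))).
    by rewrite ler_wpM2l// ler_wpM2r ?ler_norm// ltW.
  by rewrite mulrCA [X in X <= _]mulrC ler_wpM2r.
have e2 : `|divB x| <= \sum_j `|C3 j|.
  apply: (le_trans (ler_norm_sum _ _ _)); apply: ler_sum => j _.
  exact: le_trans (h3 _ _ xs) (ler_norm _).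
have e3 : `|gradB x| <= D * \sum_(j < 3) `|partial j phi x|.
  apply: (le_trans (ler_norm_sum _ _ _)); rewrite mulr_sumr; apply: ler_sum => j _.
  rewrite normrM ler_wpM2r// (le_trans (h2 _ _ xs))// (le_trans (ler_norm _))//.
  by rewrite /D (bigD1 j)//= lerDl sumr_ge0.
rewrite /C [X in _ <= X + _]mulrDl -[X in _ <= X]addrA lerD// normrM (ger0_norm c0).
apply: (le_trans (ler_wpM2r (normr_ge0 _) c1)); rewrite mul1r.
rewrite (le_trans (ler_normD _ _))// lerD// normrM ler_wpM2r//.
Qed.

(** The divergence theorem on the exterior with no boundary term. Each truncated field has integral
    zero, and the truncations converge pointwise under the majorant [g]. *)
Lemma outside_parts : integrable3 (fun x => outside x * (divB x * phi x + gradB x)) /\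
  (\int[leb3 R]_p (outside (vec3 p) * (divB (vec3 p) * phi (vec3 p) + gradB (vec3 p)))%:E = 0)%E.
Proof.
have [C [D [C0 D0 hg]]] := g_bound.
pose g x := C * `|phi x| + D * \sum_(j < 3) `|partial j phi x|.
have cg : continuous g.
  rewrite (_ : g = fun x => C * `|phi x| + D * (`|partial 0 phi x| +
     `|partial 1 phi x| + `|partial 2%:R phi x|)); last first.
    by apply/funext => x; rewrite /g sum_ord3.
  have cn (u : 'rV[R]_3 -> R) : continuous u -> continuous (fun x => `|u x|).
    by move=> cu x; exact: (continuous_comp (@cu x) (@norm_continuous _ R _)).
  move=> x; apply: (@continuousD _ _ _ (fun x => C * `|phi x|));
    apply: continuousM; try exact: cst_continuous.
    exact: cn.
  by apply: continuousD; [apply: continuousD|]; apply: cn; exact: cphi.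
have sg : supported_in rho g.
  move=> x xr; rewrite /g sphi// normr0 mulr0 add0r big1 ?mulr0// => j _.
  by rewrite (partial_supported j sphi)// normr0.
have ig : integrable3 g.
  have [M hM] := supported_bounded cg sg.
  apply: (integrable3_bounded _ sg hM); exact: continuous_measurable_vec3 cg.
have mf k : measurable_fun [set: mR3 R] (fun p => (f_ k (vec3 p))%:E).
  apply/measurable_EFinP; under eq_fun do rewrite /f_ sum_ord3.
  by apply: measurable_funD; [apply: measurable_funD|];
    exact: (continuous_measurable_vec3 (@cf _ k)).
have fcvg p : (fun k => (f_ k (vec3 p))%:E) @ \oo -->
   (outside (vec3 p) * (divB (vec3 p) * phi (vec3 p) + gradB (vec3 p)))%:E.
  suff h : (fun k => f_ k (vec3 p)) @ \oo --> outside (vec3 p) *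
      (divB (vec3 p) * phi (vec3 p) + gradB (vec3 p)).
    by apply: cvg_EFin h; exact: nearW.
  have c1 : (fun k => cutoff' k.+1%:R (sph (vec3 p)) *
      (2 * xB (vec3 p) * phi (vec3 p))) @ \oo --> 0 * (2 * xB (vec3 p) * phi (vec3 p)).
    by apply: cvgM; [exact: cutoff'_cvg|exact: cvg_cst].
  have c2 : (fun k => chi k.+1%:R (vec3 p) *
      (divB (vec3 p) * phi (vec3 p) + gradB (vec3 p))) @ \oo -->
      outside (vec3 p) * (divB (vec3 p) * phi (vec3 p) + gradB (vec3 p)).
    apply: cvgM; last exact: cvg_cst.
    by have := @cutoff_cvg R (sph (vec3 p)); rewrite sph_le0.
  have := cvgD c1 c2; rewrite mul0r add0r => h.
  by rewrite (funext (fun k => fE k (vec3 p))); exact: h.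
have mlim : measurable_fun [set: mR3 R] (fun p => (outside (vec3 p) *
    (divB (vec3 p) * phi (vec3 p) + gradB (vec3 p)))%:E).
  exact: (emeasurable_fun_cvg _ _ mf (fun p _ => fcvg p)).
have [||i _ h] := @dominated_convergence _ _ R (leb3 R) setT measurableT
  (fun k p => (f_ k (vec3 p))%:E) _ (fun p => (g (vec3 p))%:E) mf mlim _ ig _.
- by apply: aeW => p _; exact: fcvg.
- by apply: aeW => p k _; rewrite lee_fin; exact: hg.
split => //.
have e0 : (fun k => \int[leb3 R]_p (f_ k (vec3 p))%:E)%E = fun=> 0%E.
  by apply/funext => k; exact: integral_f.
move: h; rewrite /mk_sequence e0 => h.
exact: (esym (cvg_unique _ (cvg_cst 0%E) h)).
Qed.

End Parts.
End Outside.

(** * Polynomials in the coordinates and 1/|x| *)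

Section Expressions.
Variable R : realType.
Local Notation C := R[i].
Implicit Types x : 'rV[R]_3.

Lemma re_add (a b : C) : Re (a + b) = Re a + Re b.
Proof. by case: a b => ? ? []. Qed.
Lemma im_add (a b : C) : Im (a + b) = Im a + Im b.
Proof. by case: a b => ? ? []. Qed.
Lemma re_mul (a b : C) : Re (a * b) =
  Re a * Re b - Im a * Im b.
Proof. by case: a b => ? ? []. Qed.
Lemma im_mul (a b : C) : Im (a * b) =
  Re a * Im b + Im a * Re b.
Proof. by case: a b => ? ? []. Qed.

(* [Rinv] stands for 1/|x|; the expressions without it ([rfree]) are smooth at 0. *)
Inductive expr :=
| Cst of C
| Crd of 'I_3
| Rinv
| Add of expr & expr
| Mul of expr & expr.

Fixpoint eval (e : expr) (x : 'rV[R]_3) : C :=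
  match e with
  | Cst c => c
  | Crd j => (x 0 j)%:C
  | Rinv => ((enorm x)^-1)%:C
  | Add a b => eval a x + eval b x
  | Mul a b => eval a x * eval b x
  end.

Lemma eval_Mul a b x : eval (Mul a b) x = eval a x * eval b x. Proof. by []. Qed.
Lemma eval_Add a b x : eval (Add a b) x = eval a x + eval b x. Proof. by []. Qed.
Lemma eval_Cst c x : eval (Cst c) x = c. Proof. by []. Qed.
Lemma eval_Crd j x : eval (Crd j) x = (x 0 j)%:C. Proof. by []. Qed.

Fixpoint rfree (e : expr) : bool :=
  match e with
  | Rinv => false
  | Add a b | Mul a b => rfree a && rfree b
  | _ => true
  end.

Fixpoint der (j : 'I_3) (e : expr) : expr :=
  match e with
  | Cst _ => Cst 0
  | Crd i => Cst (i == j)%:R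
  | Rinv => Mul (Cst (-1)) (Mul (Crd j) (Mul Rinv (Mul Rinv Rinv)))
  | Add a b => Add (der j a) (der j b)
  | Mul a b => Add (Mul (der j a) b) (Mul a (der j b))
  end.

Lemma der_Mul j a b x : eval (der j (Mul a b)) x =
  eval (der j a) x * eval b x + eval a x * eval (der j b) x.
Proof. by []. Qed.
Lemma der_Add j a b x : eval (der j (Add a b)) x = eval (der j a) x + eval (der j b) x.
Proof. by []. Qed.
Lemma der_Cst j c x : eval (der j (Cst c)) x = 0. Proof. by []. Qed.
Lemma der_Crd j i x : eval (der j (Crd i)) x = (i == j)%:R. Proof. by []. Qed.

Lemma rfree_der j e : rfree e -> rfree (der j e).
Proof.
elim: e => //= a ha b hb /andP[fa fb]; first by rewrite ha// hb.
by rewrite ha// hb// fa fb.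
Qed.

Definition dom (e : expr) x := rfree e || (x != 0).

Lemma differentiable_enorm_inv x : x != 0 ->
  differentiable (fun y : 'rV[R]_3 => (enorm y)^-1) x /\
  forall j, partial j (fun y : 'rV[R]_3 => (enorm y)^-1) x = - (x 0 j * (enorm x)^-1 ^+ 3).
Proof.
move=> x0; have r0 : 0 < enorm x by rewrite enorm_gt0.
have s0 : 0 < sqnorm x by rewrite -[sqnorm x]enorm_sqr exprn_gt0.
have ds : is_derive (sqnorm x) (1 : R) Num.sqrt (2 * enorm x)^-1.
  exact: is_derive1_sqrt.
have di := @is_deriveV _ Num.sqrt (sqnorm x) _ _ (lt0r_neq0 r0) ds.
split; first exact: (differentiable_chain di (differentiable_sqnorm x)).
move=> j; rewrite (partial_chain j di (differentiable_sqnorm x)) partial_sqnorm.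
rewrite /GRing.scale /= -[Num.sqrt (sqnorm x)]/(enorm x).
by field; rewrite lt0r_neq0.
Qed.

Lemma differentiable_eval e x : dom e x ->
  [/\ differentiable (fun y => Re (eval e y)) x,
      differentiable (fun y => Im (eval e y)) x,
      forall j, partial j (fun y => Re (eval e y)) x = Re (eval (der j e) x) &
      forall j, partial j (fun y => Im (eval e y)) x = Im (eval (der j e) x)].
Proof.
rewrite /dom; elim: e => [c|i| |a ha b hb|a ha b hb] /=.
- by move=> _; split => // j; rewrite partial_cst.
- move=> _; split => // [|j|j]; first exact: differentiable_coord.
  + by rewrite partial_coord; case: eqP.
  + by rewrite partial_cst; case: eqP.
- move=> /differentiable_enorm_inv [d p]; split => // j.
  + by rewrite p; simpc; ring.
  + by rewrite partial_cst; simpc.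
- move=> h.
  have [|ra ia pra pia] := ha _; first by case/orP: h => [/andP[->]|->]; rewrite ?orbT.
  have [|rb ib prb pib] := hb _; first by case/orP: h => [/andP[_ ->]|->]; rewrite ?orbT.
  rewrite (funext (fun y => re_add (eval a y) (eval b y))) (funext (fun y => im_add (eval a y) (eval b y))).
  split=> [||j|j]; try exact: differentiableD.
  + by rewrite partialD// pra prb re_add.
  + by rewrite partialD// pia pib im_add.
- move=> h.
  have [|ra ia pra pia] := ha _; first by case/orP: h => [/andP[->]|->]; rewrite ?orbT.
  have [|rb ib prb pib] := hb _; first by case/orP: h => [/andP[_ ->]|->]; rewrite ?orbT.
  rewrite (funext (fun y => re_mul (eval a y) (eval b y))) (funext (fun y => im_mul (eval a y) (eval b y))).
  split=> [||j|j].
  + by apply: differentiableB; exact: differentiableM.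
  + by apply: differentiableD; exact: differentiableM.
  + rewrite partialB ?partialM ?pra ?prb ?pia ?pib;
      try done; try exact: differentiableM.
    by rewrite re_add !re_mul; ring.
  + rewrite partialD ?partialM ?pra ?prb ?pia ?pib;
      try done; try exact: differentiableM.
    by rewrite im_add !im_mul; ring.
Qed.

Lemma der_comm i j e x : eval (der i (der j e)) x = eval (der j (der i e)) x.
Proof.
elim: e => //= [|a -> b ->|a ha b hb] //; last by rewrite ha hb; ring.
rewrite eq_sym; ring.
Qed.

(** The origin is excluded because [Rinv] takes there the junk value 0. *)
Definition eqe (e1 e2 : expr) := forall x, x != 0 -> eval e1 x = eval e2 x.

Lemma near_neq0 x : x != 0 -> \near x, x != 0.
Proof.
move=> x0; near=> y; rewrite -enorm_gt0; near: y.
by apply: open_nbhs_nbhs; split; [exact: open_enorm_gt|rewrite /= enorm_gt0].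
Unshelve. all: end_near. Qed.

(** Off the origin the formal derivative is the true one, and the true one depends only on values on
    an open set. An expression may thus be replaced by an equal one before differentiating. *)
Lemma der_eqe j e1 e2 : eqe e1 e2 -> eqe (der j e1) (der j e2).
Proof.
move=> e12 x x0.
have [_ _ r1 i1] := @differentiable_eval e1 x (introT orP (or_intror x0)).
have [_ _ r2 i2] := @differentiable_eval e2 x (introT orP (or_intror x0)).
have nz := near_neq0 x0.
apply/eqP; rewrite eq_complex -r1 -r2 -i1 -i2; apply/andP; split; apply/eqP;
  apply: near_eq_partial; apply: filterS nz => y y0; by rewrite e12.
Qed.

End Expressions.

Local Arguments real_complex_def : simpl never.
Local Arguments normc : simpl never.

Section Bounds.
Variables (R : realType).
Implicit Types (x : 'rV[R]_3) (e : expr R).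

Lemma normc_real (r : R) : normc (r%:C) = `|r|.
Proof. by rewrite /normc /= expr0n addr0 sqrtr_sqr. Qed.

Lemma normc_ge0 (z : R[i]) : 0 <= normc z.
Proof. by case: z => a b; exact: sqrtr_ge0. Qed.

Lemma Re_le_normc (z : R[i]) : `|Re z| <= normc z.
Proof.
case: z => a b /=; rewrite -sqrtr_sqr ler_sqrt ?addr_ge0 ?sqr_ge0//.
by rewrite lerDl sqr_ge0.
Qed.

Lemma Im_le_normc (z : R[i]) : `|Im z| <= normc z.
Proof.
case: z => a b /=; rewrite -sqrtr_sqr ler_sqrt ?addr_ge0 ?sqr_ge0//.
by rewrite lerDr sqr_ge0.
Qed.

Lemma eval_bounded e (a b : R) : 0 < a -> exists C, 0 <= C /\
  forall x, rfree e || (a <= enorm x) -> enorm x <= b -> normc (eval e x) <= C.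
Proof.
move=> a0; elim: e => [c|i| |e1 [C1 [C10 h1]] e2 [C2 [C20 h2]]|e1 [C1 [C10 h1]] e2 [C2 [C20 h2]]] /=.
- by exists (normc c); split => //; exact: normc_ge0.
- exists `|b|; split => // x _ xb; rewrite normc_real.
  by rewrite (le_trans (coord_le_enorm _ _))// (le_trans xb)// ler_norm.
- exists a^-1; split => [|x ax _]; first by rewrite invr_ge0 ltW.
  have r0 : 0 < enorm x by exact: lt_le_trans ax.
  by rewrite normc_real ger0_norm ?invr_ge0 ?enorm_ge0// lef_pV2.
- exists (C1 + C2); split => [|x h xb]; first by rewrite addr_ge0.
  rewrite (le_trans (le_normcD _ _))// lerD//.
    by apply: h1 => //; case/orP: h => [/andP[->]|->]; rewrite ?orbT.
  by apply: h2 => //; case/orP: h => [/andP[_ ->]|->]; rewrite ?orbT.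
- exists (C1 * C2); split => [|x h xb]; first by rewrite mulr_ge0.
  rewrite normcM ler_pM ?normc_ge0//.
    by apply: h1 => //; case/orP: h => [/andP[->]|->]; rewrite ?orbT.
  by apply: h2 => //; case/orP: h => [/andP[_ ->]|->]; rewrite ?orbT.
Qed.

Lemma enormZ (c : R) x : enorm (c *: x) = `|c| * enorm x.
Proof.
apply/eqP; rewrite -(eqrXn2 (_ : 0 < 2)%N) ?mulr_ge0 ?enorm_ge0//.
rewrite exprMn !enorm_sqr -normrX ger0_norm ?sqr_ge0// mulr_sumr.
by apply/eqP; apply: eq_bigr => j _; rewrite mxE exprMn.
Qed.

(** Compares a point with its radial projection to the sphere of radius [r0], by induction on the
    expression. An expression that is zero on the sphere is thereby bounded by a multiple of |x| -
    r0. *)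
Lemma eval_radial_lipschitz e (r0 rho : R) : 0 < r0 -> exists C, 0 <= C /\
  forall x, r0 <= enorm x <= rho ->
   normc (eval e x - eval e ((r0 / enorm x) *: x)) <= C * (enorm x - r0).
Proof.
move=> r00; elim: e => [c|i| |e1 [C1 [C10 h1]] e2 [C2 [C20 h2]]|e1 [C1 [C10 h1]] e2 [C2 [C20 h2]]] /=.
- by exists 0; split => // x _; rewrite subrr mul0r normc0.
- exists 1; split => // x /andP[rx _]; have x0 : 0 < enorm x by exact: lt_le_trans rx.
  rewrite -rmorphB normc_real !mxE -[X in `|X - _|]mul1r -mulrBl normrM mul1r.
  rewrite ger0_norm ?subr_ge0 ?ler_pdivrMr ?mul1r//.
  rewrite [X in _ <= X](_ : _ = (1 - r0 / enorm x) * enorm x); last first.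
    by rewrite mulrBl mul1r divfK// lt0r_neq0.
  by rewrite ler_wpM2l ?coord_le_enorm// subr_ge0 ler_pdivrMr ?mul1r.
- exists (r0 ^- 2); split => [|x /andP[rx _]]; first by rewrite invr_ge0 sqr_ge0.
  have x0 : 0 < enorm x by exact: lt_le_trans rx.
  rewrite enormZ ger0_norm ?divr_ge0 ?(ltW r00) ?(ltW x0)// divfK ?lt0r_neq0//.
  rewrite -rmorphB normc_real distrC ger0_norm ?subr_ge0 ?lef_pV2//.
  rewrite (_ : _ - _ = (r0 * enorm x)^-1 * (enorm x - r0)); last first.
    by field; rewrite !lt0r_neq0.
  rewrite ler_wpM2r ?subr_ge0// lef_pV2 ?posrE ?mulr_gt0 ?exprn_gt0//.
  by rewrite expr2 ler_pM2l.
- exists (C1 + C2); split => [|x h]; first by rewrite addr_ge0.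
  rewrite opprD addrACA (le_trans (le_normcD _ _))// mulrDl lerD//; [exact: h1|exact: h2].
- have [B1 [B10 b1]] := eval_bounded e1 rho r00.
  have [B2 [B20 b2]] := eval_bounded e2 rho r00.
  exists (C1 * B2 + B1 * C2); split => [|x h]; first by rewrite addr_ge0 ?mulr_ge0.
  have /andP[rx xr] := h; have x0 : 0 < enorm x by exact: lt_le_trans rx.
  set y := (r0 / enorm x) *: x.
  have ey : enorm y = r0.
    by rewrite enormZ ger0_norm ?divr_ge0 ?(ltW r00) ?(ltW x0)// divfK ?lt0r_neq0.
  rewrite (_ : _ - _ = (eval e1 x - eval e1 y) * eval e2 x + eval e1 y * (eval e2 x - eval e2 y));
    last by ring.
  rewrite (le_trans (le_normcD _ _))// !normcM [X in _ <= X]mulrDl -[B1 * _ * _]mulrA [C1 * _ * _]mulrAC.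
  have n1 : normc (eval e1 y) <= B1 by rewrite b1 ?ey ?lexx ?orbT ?(le_trans rx).
  have n2 : normc (eval e2 x) <= B2 by rewrite b2 ?rx ?orbT.
  by rewrite lerD// ler_pM ?normc_ge0 ?h1 ?h2// mulr_ge0// subr_ge0.
Qed.

(** The inverse is the pointwise limit of the continuous functions y / (y^2 + 1/(k+1)); at y = 0
    these are 0, in agreement with the convention for the inverse of 0. *)
Lemma measurable_inv : measurable_fun [set: measurableTypeR R] (fun y : R => y^-1 : measurableTypeR R).
Proof.
apply: (measurable_fun_cvg (h := fun k (y : measurableTypeR R) =>
   y / (y * y + k.+1%:R^-1))) => [k|y _].
  apply: continuous_measurable_fun => y.
  apply: (@continuousM _ _ (fun y : R => y) (fun y : R => (y * y + k.+1%:R^-1)^-1)) => //.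
  apply: (@continuousV _ _ (fun y : R => y * y + k.+1%:R^-1)).
    by rewrite lt0r_neq0// ltr_wpDl ?invr_gt0// -expr2 sqr_ge0.
  by apply: continuousD; [exact: continuousM|exact: cst_continuous].
have [->|y0] := eqVneq y 0.
  by rewrite invr0; under eq_fun do rewrite mul0r; exact: cvg_cst.
rewrite (_ : y^-1 = y / (y * y + 0)); last by rewrite addr0 invfM mulrA mulfV// mul1r.
apply: cvgM; first exact: cvg_cst.
apply: cvgV; first by rewrite addr0 mulf_neq0.
by apply: cvgD; [exact: cvg_cst|exact: cvg_harmonic].
Qed.

Lemma measurable_eval e :
  measurable_fun [set: mR3 R] (fun p => Re (eval e (vec3 p))) /\
  measurable_fun [set: mR3 R] (fun p => Im (eval e (vec3 p))).
Proof.
elim: e => [c|i| |a [ra ia] b [rb ib]|a [ra ia] b [rb ib]] /=.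
- by split.
- by split => //; exact: measurable_vec3_coord.
- split => //; apply: (measurableT_comp measurable_inv).
  exact: (continuous_measurable_vec3 (@continuous_enorm R)).
- split; [under eq_fun do rewrite re_add|under eq_fun do rewrite im_add];
  exact: measurable_funD.
- split; [under eq_fun do rewrite re_mul|under eq_fun do rewrite im_mul].
    by apply: measurable_funB; exact: measurable_funM.
  by apply: measurable_funD; exact: measurable_funM.
Qed.

End Bounds.

Section Piecewise.
Variables (R : realType) (Rad : R).
Hypothesis hRad : 0 < Rad.
Implicit Types (x : 'rV[R]_3) (e : expr R) (F : 'I_3 -> expr R).

Definition piece (a b : expr R) x : R[i] :=
  if enorm x <= Rad then eval a x else eval b x.

Definition ediv F : expr R := Add (Add (der 0 (F 0)) (der 1 (F 1))) (der 2%:R (F 2%:R)).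

Lemma eval_ediv F x : eval (ediv F) x = \sum_(j < 3) eval (der j (F j)) x.
Proof. by rewrite sum_ord3. Qed.

Lemma piece_bounded (a b : expr R) (rho : R) : rfree a ->
  exists C, 0 <= C /\ forall x, enorm x <= rho -> normc (piece a b x) <= C.
Proof.
move=> fa; have [C1 [C10 h1]] := eval_bounded a rho hRad.
have [C2 [C20 h2]] := eval_bounded b rho hRad.
exists (C1 + C2); split => [|x xr]; first by rewrite addr_ge0.
rewrite /piece; case: ifPn => [_|]; last rewrite -ltNge => xR.
  by rewrite (le_trans (h1 _ _ xr)) ?fa// lerDl.
by rewrite (le_trans (h2 _ _ xr)) ?(ltW xR) ?orbT// lerDr.
Qed.

Lemma measurable_ball_fun (r : R) :
  measurable_fun [set: mR3 R] (fun p => enorm (vec3 p) <= r).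
Proof.
apply: measurable_fun_ler => //.
exact: (continuous_measurable_vec3 (@continuous_enorm R)).
Qed.

Lemma measurable_piece (a b : expr R) :
  measurable_fun [set: mR3 R] (fun p => Re (piece a b (vec3 p))) /\
  measurable_fun [set: mR3 R] (fun p => Im (piece a b (vec3 p))).
Proof.
have [ra ia] := measurable_eval a; have [rb ib] := measurable_eval b.
by split; rewrite /piece; under eq_fun do rewrite fun_if;
  apply: measurable_fun_ifT => //; exact: measurable_ball_fun.
Qed.

Lemma L2loc_piece (a b : expr R) : rfree a -> L2loc (piece a b).
Proof.
move=> fa; have [mr mi] := measurable_piece a b; split => // rho.
have [C [C0 hC]] := piece_bounded b rho fa.
pose f x := if enorm x <= rho then normc (piece a b x) ^+ 2 else 0.
have int : integrable3 f.
  apply: (@integrable3_bounded _ _ rho (C ^+ 2)).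
  - apply: measurable_fun_ifT => //; first exact: measurable_ball_fun.
    have E p : normc (piece a b (vec3 p)) ^+ 2 =
       Re (piece a b (vec3 p)) ^+ 2 + Im (piece a b (vec3 p)) ^+ 2.
      by case: (piece _ _ _) => u v; rewrite /normc /= sqr_sqrtr// addr_ge0 ?sqr_ge0.
    under eq_fun do rewrite E.
    by apply: measurable_funD; exact: measurable_funX.
  - by move=> x xr; rewrite /f leNgt xr.
  - move=> x; rewrite /f; case: ifP => xr; last by rewrite normr0 sqr_ge0.
    rewrite ger0_norm ?sqr_ge0// ler_pXn2r ?nnegrE ?normc_ge0//; exact: hC.
have -> : (\int[leb3 R]_(p in [set p : mR3 R | (enorm (vec3 p) <= rho)%R])
   (normc (piece a b (vec3 p)) ^+ 2)%:E = \int[leb3 R]_p (f (vec3 p))%:E)%E.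
  rewrite integral_mkcond; apply: eq_integral => p _; rewrite patchE /f.
  case: ifPn; first by rewrite inE /= => ->.
  by rewrite notin_setE /= => /negP/negbTE ->.
have /integrableP[_] := int.
congr (_ < _)%E; apply: eq_integral => p _.
by rewrite gee0_abs// lee_fin /f; case: ifP => // _; exact: sqr_ge0.
Qed.

Definition integrableC (f : 'rV[R]_3 -> R[i]) :=
  integrable3 (fun x => Re (f x)) /\ integrable3 (fun x => Im (f x)).

Lemma integrable_piece (a b : expr R) (psi : 'rV[R]_3 -> R) (rho : R) : rfree a ->
  continuous psi -> supported_in rho psi ->
  integrableC (fun x => piece a b x * (psi x)%:C).
Proof.
move=> fa cpsi spsi; have [C [C0 hC]] := piece_bounded b rho fa.
have [M hM] := supported_bounded cpsi spsi.
have [mr mi] := measurable_piece a b.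
have mp := continuous_measurable_vec3 cpsi.
have bd (z : R[i]) x : normc z <= C -> `|Re z * psi x| <= C * M /\
    `|Im z * psi x| <= C * M.
  by move=> zC; rewrite !normrM !ler_pM// ?(le_trans (Re_le_normc _))// ?(le_trans (Im_le_normc _)).
have M0 : 0 <= M by rewrite (le_trans _ (hM 0)).
have S (f : R[i] -> R) : measurable_fun [set: mR3 R] (fun p => f (piece a b (vec3 p))) ->
    (forall z, `|f z| <= normc z) -> integrable3 (fun x => f (piece a b x) * psi x).
  move=> mf hf; apply: (@integrable3_bounded _ _ rho (C * M)).
  - exact: measurable_funM.
  - by move=> x /spsi ->; rewrite mulr0.
  - move=> x; rewrite normrM; have [/spsi ->|xr] := ltP rho (enorm x).
      by rewrite normr0 mulr0 mulr_ge0.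
    by rewrite ler_pM// (le_trans (hf _))// hC.
have Er x : Re (piece a b x * (psi x)%:C) = Re (piece a b x) * psi x.
  by rewrite re_mul /= mulr0 subr0.
have Ei x : Im (piece a b x * (psi x)%:C) = Im (piece a b x) * psi x.
  by rewrite im_mul /= mulr0 add0r.
split; rewrite ?(funext Er) ?(funext Ei); apply: S => // z.
  exact: Re_le_normc.
exact: Im_le_normc.
Qed.

Lemma integralCD (f g : 'rV[R]_3 -> R[i]) : integrableC f -> integrableC g ->
  integralC (fun x => f x + g x) = integralC f + integralC g.
Proof.
move=> [fr fi] [gr gi]; rewrite /integralC; apply/eqP; rewrite eq_complex /=.
apply/andP; split; apply/eqP.
  by under eq_Rintegral do rewrite re_add; rewrite RintegralD.
by under eq_Rintegral do rewrite im_add; rewrite RintegralD.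
Qed.

Lemma integrableCD (f g : 'rV[R]_3 -> R[i]) : integrableC f -> integrableC g ->
  integrableC (fun x => f x + g x).
Proof.
move=> [fr fi] [gr gi]; split.
  by under eq_fun do rewrite re_add; exact: (integrableD measurableT fr gr).
by under eq_fun do rewrite im_add; exact: (integrableD measurableT fi gi).
Qed.

End Piecewise.

Section Parts.
Variables (R : realType) (Rad : R).
Hypothesis hRad : 0 < Rad.
Implicit Types (x : 'rV[R]_3) (e : expr R) (F : 'I_3 -> expr R).
Local Notation piece := (piece Rad).

Lemma continuous_eval e x : dom e x ->
  {for x, continuous (fun y => Re (eval e y))} /\
  {for x, continuous (fun y => Im (eval e y))}.
Proof.
by move=> /differentiable_eval[dr di _ _]; split; exact: differentiable_continuous.
Qed.

Lemma test_funP (phi : 'rV[R]_3 -> R) : test_fun phi ->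
  [/\ forall x, differentiable phi x, forall j, continuous (partial j phi) &
      exists rho, supported_in rho phi].
Proof.
move=> [d [rho s]]; split; [exact: (d [::])| |by exists rho].
by move=> j x; apply: differentiable_continuous; exact: (d [:: j]).
Qed.

Section TestFunction.
Variables (phi : 'rV[R]_3 -> R) (rho : R).
Hypothesis dphi : forall x, differentiable phi x.
Hypothesis cphi : forall j, continuous (partial j phi).
Hypothesis sphi : supported_in rho phi.

Let cphi0 : continuous phi.
Proof. by move=> x; exact: differentiable_continuous. Qed.

(** The integrand is the divergence of phi F, which is smooth enough on all of space and compactly
    supported. *)
Lemma smooth_parts F : (forall j, rfree (F j)) ->
  let f x := Re (eval (ediv F) x) * phi x +
     \sum_(j < 3) Re (eval (F j) x) * partial j phi x in
  integrable3 f /\ (\int[leb3 R]_p (f (vec3 p))%:E = 0)%E.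
Proof.
move=> fF f.
pose g j x := Re (eval (F j) x) * phi x.
have dF j x : differentiable (fun y => Re (eval (F j) y)) x.
  by have [] := @differentiable_eval _ (F j) x; rewrite /dom ?fF.
have pF i j x : partial i (fun y => Re (eval (F j) y)) x =
    Re (eval (der i (F j)) x).
  by have [_ _ -> _] := @differentiable_eval _ (F j) x (introT orP (or_introl (fF j))).
have cF e : rfree e -> continuous (fun y => Re (eval e y)).
  by move=> fe x; have [] := @continuous_eval e x; rewrite /dom ?fe.
have dg j x : differentiable (g j) x by apply: differentiableM.
have pg j x : partial j (g j) x = Re (eval (der j (F j)) x) * phi x +
    Re (eval (F j) x) * partial j phi x.
  by rewrite partialM// pF.
have cg j : continuous (partial j (g j)).
  rewrite (funext (pg j)) => x.
  apply: (@continuousD _ _ _ (fun x => Re (eval (der j (F j)) x) * phi x));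
    apply: continuousM.
  - by apply: cF; exact: rfree_der.
  - exact: cphi0.
  - exact: cF.
  - exact: cphi.
have sg j : supported_in rho (g j) by move=> x /sphi; rewrite /g => ->; rewrite mulr0.
have int j : integrable3 (partial j (g j)).
  have [C hC] := supported_bounded (@cg j) (partial_supported j (@sg j)).
  apply: integrable3_bounded hC; last exact: partial_supported.
  exact: continuous_measurable_vec3 (@cg j).
have I j := integral_partial_eq0 (@dg j) (@sg j) (@cg j).
have -> : f = fun x => partial 0 (g 0) x + partial 1 (g 1) x + partial 2%:R (g 2%:R) x.
  apply/funext => x; rewrite /f !pg eval_ediv !sum_ord3 !re_add.
  have E (p a b c d e h A B C : R) : (A + B + C) * p + (a * d + b * e + c * h) =
      (A * p + a * d) + (B * p + b * e) + (C * p + c * h) by ring.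
  exact: E.
have i01 : integrable3 (fun x => partial 0 (g 0) x + partial 1 (g 1) x).
  exact: (integrableD measurableT (int 0) (int 1)).
split; first exact: (integrableD measurableT i01 (int 2%:R)).
rewrite [LHS](integralD measurableT i01 (int 2%:R)).
by rewrite (integralD measurableT (int 0) (int 1)) !I !adde0.
Qed.

(** The piecewise field is F on all of space plus the indicator of the exterior times H = G - F.
    [smooth_parts] handles the first summand; [outside_parts] handles the second, because x . H
    vanishes on the sphere. *)
Lemma piece_parts_Re (F G : 'I_3 -> expr R) : (forall j, rfree (F j)) ->
  (forall x, enorm x = Rad ->
    \sum_(j < 3) (x 0 j)%:C * (eval (G j) x - eval (F j) x) = 0) ->
  (\int[leb3 R]_p (Re (piece (ediv F) (ediv G) (vec3 p)) * phi (vec3 p) +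
    \sum_(j < 3) Re (piece (F j) (G j) (vec3 p)) * partial j phi (vec3 p))%:E = 0)%E.
Proof.
move=> fF hs.
have [i1 s1] := smooth_parts fF.
pose H j := Add (G j) (Mul (Cst (-1)) (F j)).
have HE j x : Re (eval (H j) x) = Re (eval (G j) x) - Re (eval (F j) x).
  by rewrite /= re_add re_mul /=; ring.
pose B j x := Re (eval (H j) x).
have dB j x : x != 0 -> differentiable (B j) x.
  by move=> x0; have [] := @differentiable_eval _ (H j) x; rewrite /dom ?x0 ?orbT.
have pB j x : x != 0 -> partial j (B j) x = Re (eval (der j (H j)) x).
  by move=> x0; have [] := @differentiable_eval _ (H j) x; rewrite /dom ?x0 ?orbT.
have bE e : shell_bounded Rad (fun x => Re (eval e x)).
  move=> r; have [C [_ hC]] := eval_bounded e r hRad.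
  exists C => x /andP[h1 h2]; apply: (le_trans (Re_le_normc _)).
  by apply: hC => //; rewrite h1 orbT.
have [||||i2 s2] := @outside_parts _ _ hRad B phi rho dB _ _ _ _ dphi cphi sphi.
- move=> j x x0.
  have [c _] := @continuous_eval (der j (H j)) x (introT orP (or_intror x0)).
  suff : partial j (B j) @ x --> Re (eval (der j (H j)) x).
    by rewrite -pB.
  have e : {near x, (fun y => Re (eval (der j (H j)) y)) =1 partial j (B j)}.
    by apply: filterS (near_neq0 x0) => y y0; rewrite pB.
  by apply: cvg_trans; [exact: (near_eq_cvg e)|exact: c].
- by move=> j; exact: bE.
- move=> j r; have [C hC] := bE (der j (H j)) r; exists C => x h.
  by rewrite pB ?hC// (neq0_outside hRad)//; case/andP: h.
- move=> r.
  pose E := Add (Add (Mul (Crd R 0) (H 0)) (Mul (Crd R 1) (H 1))) (Mul (Crd R 2%:R) (H 2%:R)).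
  have EE x : eval E x = \sum_(j < 3) (x 0 j)%:C * (eval (G j) x - eval (F j) x).
    by rewrite sum_ord3 /= !mulN1r.
  have [C [C0 hC]] := eval_radial_lipschitz E r hRad.
  (* The Lipschitz bound is in terms of |x| - Rad; passing to |x|^2 - Rad^2 gains the factor |x| +
     Rad, which is at least [Rad]. *)
  exists (C / Rad) => x h; have /andP[Rx xr] := h.
  have x0 : 0 < enorm x by exact: lt_le_trans Rx.
  rewrite (_ : \sum_(j < 3) x 0 j * B j x = Re (eval E x)); last first.
    by rewrite /= !re_add !re_mul !mul0r !subr0 sum_ord3.
  have := hC x h; rewrite [X in _ - X]EE hs ?subr0; last first.
    by rewrite enormZ ger0_norm ?divr_ge0 ?(ltW hRad) ?(ltW x0)// divfK ?lt0r_neq0.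
  move=> /(le_trans (Re_le_normc _))/le_trans; apply.
  rewrite sphE -mulrA ler_wpM2l// mulrC ler_pdivlMr// subr_sqr ler_wpM2l ?subr_ge0//.
  by rewrite lerDr enorm_ge0.
pose f1 x := Re (eval (ediv F) x) * phi x +
     \sum_(j < 3) Re (eval (F j) x) * partial j phi x.
pose f2 x := outside Rad x * ((\sum_(j < 3) partial j (B j) x) * phi x +
  \sum_(j < 3) B j x * partial j phi x).
rewrite -[RHS](adde0 0%E) -{1}s1 -s2 -(integralD measurableT i1 i2).
apply: eq_integral => p _; rewrite -EFinD; congr _%:E.
move: (vec3 p) => x; rewrite /piece /outside; case: ifPn => xR.
  by rewrite mul0r addr0.
rewrite mul1r.
have x0 : x != 0 by apply: (neq0_outside hRad); rewrite ltW// ltNge.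
have dH j : Re (eval (der j (H j)) x) =
    Re (eval (der j (G j)) x) - Re (eval (der j (F j)) x).
  have mE (g z w : R[i]) : Re (g + (0 * z + -1 * w)) = Re g - Re w.
    by rewrite mul0r add0r mulN1r re_add; case: w.
  exact: mE.
rewrite !eval_ediv !sum_ord3 !pB// !dH /B !HE !re_add.
have E (q a0 a1 a2 b0 b1 b2 t0 t1 t2 c0 c1 c2 d0 d1 d2 : R) :
    (c0 + c1 + c2) * q + (a0 * t0 + a1 * t1 + a2 * t2) +
    (((d0 - c0) + (d1 - c1) + (d2 - c2)) * q +
     ((b0 - a0) * t0 + (b1 - a1) * t1 + (b2 - a2) * t2)) =
    (d0 + d1 + d2) * q + (b0 * t0 + b1 * t1 + b2 * t2) by ring.
exact/esym/E.
Qed.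

End TestFunction.

Lemma piece_parts (F G : 'I_3 -> expr R) (phi : 'rV[R]_3 -> R) :
  (forall j, rfree (F j)) ->
  (forall x, enorm x = Rad ->
    \sum_(j < 3) (x 0 j)%:C * (eval (G j) x - eval (F j) x) = 0) ->
  test_fun phi ->
  \sum_(j < 3) integralC (fun x => piece (F j) (G j) x * (partial j phi x)%:C) =
  - integralC (fun x => piece (ediv F) (ediv G) x * (phi x)%:C).
Proof.
move=> fF hs /test_funP[dphi cphi [rho sphi]].
have cphi0 : continuous phi by move=> x; exact: differentiable_continuous.
have fd : rfree (ediv F) by rewrite /= !rfree_der.
have ij j : integrableC (fun x => piece (F j) (G j) x * (partial j phi x)%:C).
  by apply: (integrable_piece hRad _ (fF j) (@cphi j) (partial_supported j sphi)).
have id : integrableC (fun x => piece (ediv F) (ediv G) x * (phi x)%:C).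
  exact: (integrable_piece hRad _ fd cphi0 sphi).
apply/eqP; rewrite -addr_eq0 sum_ord3 -!integralCD//; try exact: integrableCD;
  try (by apply: integrableCD => //; exact: integrableCD).
have Er (z : R[i]) (r : R) : Re (z * r%:C) = Re z * r.
  by rewrite re_mul /= mulr0 subr0.
have Ei (z : R[i]) (r : R) : Im (z * r%:C) = Im z * r.
  by rewrite im_mul /= mulr0 add0r.
have Er4 (a b c d : R[i]) (r s t u : R) :
    Re (a * r%:C + b * s%:C + c * t%:C + d * u%:C) =
    Re d * u + (Re a * r + Re b * s + Re c * t).
  by rewrite !re_add !Er addrC.
have Ei4 (a b c d : R[i]) (r s t u : R) :
    Im (a * r%:C + b * s%:C + c * t%:C + d * u%:C) =
    Im d * u + (Im a * r + Im b * s + Im c * t).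
  by rewrite !im_add !Ei addrC.
rewrite eq_complex /=; apply/andP; split; apply/eqP.
  rewrite /Rintegral -[RHS]/(fine 0%E) -(piece_parts_Re dphi cphi sphi fF hs).
  congr fine; apply: eq_integral => p _; congr _%:E.
  by rewrite sum_ord3 Er4.
(* The imaginary part of z is the real part of -i z, so the real statement is reused on the rotated
   fields. *)
pose m e := Mul (Cst (0 -i* 1)) e : expr R.
have mE a b x : Re (piece (m a) (m b) x) = Im (piece a b x).
  by rewrite /piece; case: ifP => _ /=; rewrite re_mul /=; ring.
have fm j : rfree (m (F j)) by exact: fF.
have hm x : enorm x = Rad ->
    \sum_(j < 3) (x 0 j)%:C * (eval (m (G j)) x - eval (m (F j)) x) = 0.
  move=> /hs h0; transitivity ((0 -i* 1) * (\sum_(j < 3)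
      (x 0 j)%:C * (eval (G j) x - eval (F j) x))); last by rewrite h0 mulr0.
  by rewrite mulr_sumr; apply: eq_bigr => j _ /=; ring.
rewrite /Rintegral -[RHS]/(fine 0%E) -(piece_parts_Re dphi cphi sphi fm hm).
congr fine; apply: eq_integral => p _; congr _%:E.
rewrite sum_ord3 Ei4 !mE.
have -> : Re (piece (ediv (fun j => m (F j))) (ediv (fun j => m (G j))) (vec3 p)) =
  Im (piece (ediv F) (ediv G) (vec3 p)).
  have E3 (c u v w a b d : R[i]) : (0 * u + c * a) + (0 * v + c * b) + (0 * w + c * d) =
      c * (a + b + d) by ring.
  by rewrite -mE /piece; case: ifP => _; congr Re; exact: E3.
by [].
Qed.

End Parts.

(** * From pointwise transmission conditions to the weak problem *)

Section Transmission.
Variables (R : realType) (Rad : R).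
Hypothesis hRad : 0 < Rad.
Implicit Types (x : 'rV[R]_3) (e : expr R) (F : 'I_3 -> expr R).
Local Notation piece := (piece Rad).

Lemma integralC0 : integralC (fun=> 0 : R[i]) = 0.
Proof.
rewrite /integralC; apply/eqP; rewrite eq_complex /=.
by rewrite /Rintegral integral0 /= eqxx.
Qed.

(** [piece_parts] for the vector field whose only nonzero component is u_i in direction [j]:
    continuity across the sphere makes its whole jump vanish there, and its divergence is the
    derivative sought. *)
Lemma weak_gradient_piece (uin uout : 'I_3 -> expr R) (u : 'rV[R]_3 -> 'cV[R[i]]_3) :
  (forall i, rfree (uin i)) ->
  (forall x i, enorm x = Rad -> eval (uin i) x = eval (uout i) x) ->
  (forall x i, u x i 0 = piece (uin i) (uout i) x) ->
  weak_gradient u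
    (fun x => \matrix_(i, j) piece (der j (uin i)) (der j (uout i)) x).
Proof.
move=> fu hs uE i j; split.
  rewrite (_ : (fun _ => _) = piece (der j (uin i)) (der j (uout i))); last first.
    by apply/funext => x; rewrite mxE.
  by apply: L2loc_piece => //; exact: rfree_der.
move=> phi tphi.
pose F k := if k == j then uin i else Cst 0.
pose G k := if k == j then uout i else Cst 0.
have fF k : rfree (F k) by rewrite /F; case: ifP.
have hFG x : enorm x = Rad ->
    \sum_(k < 3) (x 0 k)%:C * (eval (G k) x - eval (F k) x) = 0.
  move=> xR; apply: big1 => k _; rewrite /F /G; case: ifP => _.
    by rewrite hs// subrr mulr0.
  by rewrite subrr mulr0.
have := piece_parts hRad fF hFG tphi.
rewrite (bigD1 j)//= [X in _ + X]big1 ?addr0; last first.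
  move=> k /negbTE kj; rewrite /F /G kj /piece -[RHS]integralC0; congr integralC.
  by apply/funext => x; case: ifP => _ /=; rewrite mul0r.
rewrite /F /G eqxx => h.
transitivity (integralC (fun x => piece (uin i) (uout i) x * (partial j phi x)%:C)).
  by congr integralC; apply/funext => x; rewrite uE.
rewrite h; congr (- integralC _); apply/funext => x; rewrite mxE; congr (_ * _).
have D (a : expr R) : eval (ediv (fun k => if k == j then a else Cst 0)) x =
    eval (der j a) x.
  rewrite eval_ediv (bigD1 j)//= eqxx big1 ?addr0// => k /negbTE -> //.
by rewrite /piece !D.
Qed.

Definition estress (L U : R) (u : 'I_3 -> expr R) (i j : 'I_3) : expr R :=
  Add (Mul (Cst (L%:C *+ (i == j))) (ediv u))
      (Mul (Cst U%:C) (Add (der j (u i)) (der i (u j)))).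

Definition econormal (L U : R) (nu : 'cV[R[i]]_3) (u : 'I_3 -> expr R) (i : 'I_3) : expr R :=
  let s j := Mul (Cst (nu j 0)) (estress L U u i j) in
  Add (Add (s 0) (s 1)) (s 2%:R).

Lemma rfree_estress L U u i j : (forall i, rfree (u i)) -> rfree (estress L U u i j).
Proof. by move=> fu; rewrite /= !rfree_der. Qed.

Lemma stress_piece (c L U : R) (uin uout : 'I_3 -> expr R) x i j :
  stress (contrast Rad c x * L) (contrast Rad c x * U)
    (\matrix_(i, j) piece (der j (uin i)) (der j (uout i)) x) i j =
  piece (estress (c * L) (c * U) uin i j) (estress L U uout i j) x.
Proof.
have S (a b : R) (w : 'I_3 -> expr R) :
    stress a b (\matrix_(i, j) eval (der j (w i)) x) i j = eval (estress a b w i j) x.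
  rewrite /stress /symgrad mxE [in X in X + _]mxE /mxtrace sum_ord3 !mxE /= mulrnAl.
  by congr (_ + _); field.
rewrite /piece /contrast; case: ifP => _; rewrite -S ?mul1r; congr (stress _ _ _ _ _);
  by apply/matrixP => k l; rewrite !mxE.
Qed.

(** Continuity along the first coordinate axis. Calculations with homogeneity and [eqe] say nothing
    at the origin, and this fills the gap for interior expressions. *)
Lemma rfree_eq0 e : rfree e -> (forall x, x != 0 -> eval e x = 0) -> eval e 0 = 0.
Proof.
move=> fe h.
have [cr ci] := @continuous_eval _ e 0 (introT orP (or_introl fe)).
have cl : (fun t : R => t *: (delta_mx 0 0 : 'rV[R]_3)) @ (0 : R)^' --> (0 : 'rV[R]_3).
  apply: cvg_within_filter.
  have := @scalel_continuous R 'rV[R]_3 (delta_mx 0 0) 0.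
  by rewrite /continuous_at scale0r.
have nz (t : R) : t != 0 -> t *: (delta_mx 0 0 : 'rV[R]_3) != 0.
  move=> t0; apply/negP => /eqP /rowP /(_ 0); rewrite !mxE !eqxx mulr1 => t0'.
  by rewrite t0' eqxx in t0.
have S (f : R[i] -> R) : f 0 = 0 -> {for 0, continuous (fun y => f (eval e y))} ->
    f (eval e 0) = 0.
  move=> f0 cf.
  have c1 := cvg_comp _ _ cl cf.
  have c2 : (fun t : R => f (eval e (t *: (delta_mx 0 0 : 'rV[R]_3)))) @ (0 : R)^' --> (0 : R).
    have n0 : \forall t \near (0 : R)^', (fun=> 0) t = f (eval e (t *: (delta_mx 0 0 : 'rV[R]_3))).
      near=> t; have t0 : t != 0 by near: t; exact: nbhs_dnbhs_neq.
      by rewrite h ?f0//; exact: nz.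
    by apply: cvg_trans; [exact: (near_eq_cvg n0)|exact: cvg_cst].
  exact: (cvg_unique _ c1 c2).
by apply/eqP; rewrite eq_complex /= (S (@complex.Re R) erefl cr) (S (@complex.Im R) erefl ci) eqxx.
Unshelve. all: end_near. Qed.

Lemma has_trace_eval (D : set 'rV[R]_3) (f : 'rV[R]_3 -> 'cV[R[i]]_3)
    (w : 'I_3 -> expr R) x : x != 0 ->
  (forall y i, D y -> f y i 0 = eval (w i) y) ->
  has_trace (within D (nbhs x)) f (\col_i eval (w i) x).
Proof.
move=> x0 fw i; rewrite mxE.
have [cr ci] := @continuous_eval _ (w i) x (introT orP (or_intror x0)).
have S (g : R[i] -> R) : {for x, continuous (fun y => g (eval (w i) y))} ->
    (fun y => g (f y i 0)) @ within D (nbhs x) --> g (eval (w i) x).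
  move=> cg; apply: cvg_trans; last exact: (cvg_within_filter D cg).
  apply: near_eq_cvg; rewrite near_withinE; apply: nearW => y Dy.
  by rewrite fw.
by split; exact: S.
Qed.

Section Solves.
Variables (lam mu c : R) (uin uout : 'I_3 -> expr R) (u : 'rV[R]_3 -> 'cV[R[i]]_3).
Hypothesis fu : forall i, rfree (uin i).
Hypothesis uE : forall x i, u x i 0 = piece (uin i) (uout i) x.
Hypothesis hcont : forall x i, enorm x = Rad -> eval (uin i) x = eval (uout i) x.
Hypothesis hin : forall i x, x != 0 -> eval (ediv (estress (c * lam) (c * mu) uin i)) x = 0.
Hypothesis hout : forall i x, x != 0 -> eval (ediv (estress lam mu uout i)) x = 0.
Hypothesis hflux : forall i x, enorm x = Rad ->
  \sum_(j < 3) (x 0 j)%:C * (eval (estress lam mu uout i j) x -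
     eval (estress (c * lam) (c * mu) uin i j) x) = 0.
Hypothesis hdecay : exists K M : R, 0 < M /\ forall x, M <= enorm x ->
  forall i, normc (eval (uout i) x) <= K / enorm x.

Let g x : 'M[R[i]]_3 := \matrix_(i, j) piece (der j (uin i)) (der j (uout i)) x.

Let weak_g : weak_gradient u g. Proof. exact: weak_gradient_piece. Qed.

Let near_in y : enorm y < Rad -> \near y, forall i, u y i 0 = eval (uin i) y.
Proof. by move=> /near_inside; apply: filterS => z zR i; rewrite uE /piece zR. Qed.

Let near_out y : Rad < enorm y -> \near y, forall i, u y i 0 = eval (uout i) y.
Proof.
move=> yR; have : \near y, Rad < enorm y.
  by apply: open_nbhs_nbhs; split => //; exact: open_enorm_gt.
by apply: filterS => z zR i; rewrite uE /piece leNgt zR.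
Qed.

Let gradient_near y (w : 'I_3 -> expr R) : (forall i, dom (w i) y) ->
  (\near y, forall i, u y i 0 = eval (w i) y) ->
  classical_at u y /\ gradient u y = \matrix_(i, j) eval (der j (w i)) y.
Proof.
move=> dw n; split.
  move=> i; have [dr di _ _] := differentiable_eval (dw i).
  by split; [apply: near_eq_differentiable dr|apply: near_eq_differentiable di];
    apply: filterS n => z ->.
apply/matrixP => i j; rewrite !mxE /partialC.
have [_ _ pr pi] := differentiable_eval (dw i).
apply/eqP; rewrite eq_complex /= -pr -pi; apply/andP; split; apply/eqP;
  by apply: near_eq_partial; apply: filterS n => z ->.
Qed.

Let conormalE (L U : R) (nu : 'cV[R[i]]_3) y (w : 'I_3 -> expr R) i :
  gradient u y = \matrix_(i, j) eval (der j (w i)) y ->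
  conormal L U nu u y i 0 = eval (econormal L U nu w i) y.
Proof.
move=> gE; rewrite /conormal gE !mxE /mxtrace !sum_ord3 !mxE /=.
have K (T n0 n1 n2 a b d : R[i]) (k : 'I_3) : L%:C * T * (if k == 0 then n0 else if k == 1 then n1 else n2) +
   U%:C * (a * n0 + b * n1 + d * n2) =
   n0 * (L%:C *+ (k == 0) * T + U%:C * a) + n1 * (L%:C *+ (k == 1) * T + U%:C * b) +
   n2 * (L%:C *+ (k == 2%:R) * T + U%:C * d).
  by move: k; elim/ord3P => /=; rewrite ?mulr1n ?mulr0n; ring.
rewrite -K; congr (_ * _ + _).
by move: i; elim/ord3P.
Qed.

(** The distributional equation is [piece_parts] applied to each row of the stress: [hflux] kills
    the interface term and the pointwise divergence vanishes on either side. *)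
Lemma transmission_solves : solves lam mu Rad c u.
Proof.
have x0 x : enorm x = Rad -> x != 0 by move=> xR; rewrite -enorm_gt0 xR.
have dout y i : Rad < enorm y -> dom (uout i) y.
  by move=> yR; rewrite /dom -enorm_gt0 (lt_trans hRad) ?orbT.
have din y i : dom (uin i) y by rewrite /dom fu.
split.
- split; last by exists g; exact: weak_g.
  move=> i; rewrite (_ : (fun x => u x i 0) = piece (uin i) (uout i)).
    exact: L2loc_piece.
  by apply/funext => x; rewrite uE.
- exists g; split; first exact: weak_g.
  move=> i phi tphi.
  under eq_bigr => j _.
    under [X in integralC X]eq_fun do rewrite stress_piece.
    over.
  rewrite (piece_parts hRad _ _ tphi).
  + apply/eqP; rewrite oppr_eq0 -integralC0; apply/eqP; congr integralC.
    apply/funext => x; rewrite /piece; case: ifPn => [xR|].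
      (* The interior equation is assumed off the origin only; its divergence is free of [Rinv],
         hence also zero at 0. *)
      have [->|xn0] := eqVneq x 0; last by rewrite hin// mul0r.
      rewrite rfree_eq0 ?mul0r//; last exact: hin.
      by rewrite /= !rfree_der//; apply: rfree_der; apply: rfree_der.
    rewrite -ltNge => xR; rewrite hout ?mul0r// -enorm_gt0.
    exact: lt_trans xR.
  + by move=> j; exact: rfree_estress.
  + by move=> x xR; exact: hflux.
- move=> x xR; exists (\col_i eval (uin i) x); split.
    apply: has_trace_eval => [|y i /= yR]; first exact: x0.
    by rewrite uE /piece ltW.
  rewrite (_ : (\col_i eval (uin i) x) = \col_i eval (uout i) x).
    apply: has_trace_eval => [|y i /= yR]; first exact: x0.
    by rewrite uE /piece leNgt yR.
  by apply/colP => i; rewrite !mxE hcont.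
- split.
    move=> y yR; have [yl|yl|/eqP] := ltgtP (enorm y) Rad; last by rewrite (negbTE yR).
      by have [] := gradient_near (din y) (near_in yl).
    by have [] := gradient_near (fun i => dout y i yl) (near_out yl).
  move=> x xR.
  exists (\col_i eval (econormal (c * lam) (c * mu) (normal x) uin i) x); split.
    apply: has_trace_eval => [|y i /= yR]; first exact: x0.
    apply: conormalE.
    by have [] := gradient_near (din y) (near_in yR).
  rewrite (_ : (\col_i eval (econormal (c * lam) (c * mu) (normal x) uin i) x) =
     \col_i eval (econormal lam mu (normal x) uout i) x).
    apply: has_trace_eval => [|y i /= yR]; first exact: x0.
    apply: conormalE.
    by have [] := gradient_near (fun i => dout y i yR) (near_out yR).
  apply/colP => i; rewrite !mxE.
  (* The flux hypothesis is written with [x] in place of the unit normal; on the sphere they differ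
     by the factor 1/Rad. *)
  have nE j : normal x j 0 = (Rad^-1)%:C * (x 0 j)%:C.
    by rewrite !mxE xR rmorphM.
  have ecE L U w : eval (econormal L U (normal x) w i) x =
      (Rad^-1)%:C * (x 0 0)%:C * eval (estress L U w i 0) x +
      (Rad^-1)%:C * (x 0 1)%:C * eval (estress L U w i 1) x +
      (Rad^-1)%:C * (x 0 2%:R)%:C * eval (estress L U w i 2%:R) x.
    by rewrite -!nE.
  have := hflux i xR; rewrite sum_ord3 !ecE.
  have E (r a b p a0 a1 a2 b0 b1 b2 : R[i]) :
      a * (a0 - b0) + b * (a1 - b1) + p * (a2 - b2) = 0 ->
      r * a * b0 + r * b * b1 + r * p * b2 = r * a * a0 + r * b * a1 + r * p * a2.
    move=> h; apply/esym/eqP; rewrite -subr_eq0.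
    by rewrite -(mulr0 r) -[in X in _ == X]h; apply/eqP; ring.
  exact: E.
- have [K [M [M0 hK]]] := hdecay.
  (* The threshold is moved strictly past [Rad], where [u] is given by the exterior expression. *)
  exists K, (Num.max M (Rad + 1)); split; first by rewrite lt_max M0.
  move=> x; rewrite ge_max => /andP[xM xR] i.
  have {}xR : Rad < enorm x by apply: lt_le_trans xR; rewrite ltrDl.
  by rewrite uE /piece [enorm x <= Rad]leNgt xR; exact: hK.
Qed.

End Solves.
End Transmission.

(** * Solid harmonics *)

Section Legendre.
Variable R : realType.
Local Notation P := (legendre R).

Lemma derivn_mulX (p : {poly R}) (k : nat) :
  ('X * p)^`(k.+1) = 'X * p^`(k.+1) + k.+1%:R *: p^`(k).
Proof.
elim: k => [|k ih].
  by rewrite derivn1 derivM derivX mul1r derivn1 derivn0 scale1r addrC.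
rewrite derivnS ih derivD derivM derivX mul1r derivZ -!derivnS.
by rewrite -!mul_polyC -(natr1 k.+1); ring.
Qed.

Local Notation W n := (('X^2 - 1 : {poly R}) ^+ n).

Lemma deriv_W n : (W n.+1)^`() = (2 * n.+1%:R) *: ('X * W n).
Proof.
rewrite deriv_exp derivB derivXn derivC subr0 /= -!mul_polyC; ring.
Qed.

Let coef n : R := (2 ^+ n * n`!%:R)^-1.

Let coefS n : coef n.+1 * (2 * n.+1%:R) = coef n.
Proof.
rewrite /coef factS natrM exprS; field.
by rewrite expf_neq0 ?pnatr_eq0 -?lt0n ?fact_gt0 //= addrC natr1 pnatr_eq0.
Qed.

(** In Rodrigues' formula one derivative of (X^2 - 1)^(n+1) produces X (X^2 - 1)^n; the Leibniz rule
    with the linear factor X leaves two terms. *)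
Lemma legendre_derivS n : (P n.+1)^`() = n.+1%:R *: P n + 'X * (P n)^`().
Proof.
rewrite /legendre !derivZ -!derivnS derivSn deriv_W derivnZ derivn_mulX.
rewrite -/(coef n) -/(coef n.+1) -(coefS n) -!mul_polyC; ring.
Qed.

(** Two derivatives are taken inside Rodrigues' formula; X^2 is then rewritten as (X^2 - 1) + 1,
    which brings out both lower polynomials. *)
Lemma legendre_derivSS n : (P n.+2)^`() = (2 * n.+1 + 1)%:R *: P n.+1 + (P n)^`().
Proof.
rewrite /legendre !derivZ -!derivnS [in LHS]derivSn deriv_W derivnZ [in LHS]derivSn.
have -> : ('X * W n.+1)^`() = (2 * n.+1 + 1)%:R *: W n.+1 + (2 * n.+1%:R) *: W n.
  rewrite derivM derivX mul1r deriv_W -!mul_polyC exprS; ring.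
rewrite derivnD !derivnZ.
rewrite -/(coef n) -/(coef n.+1) -/(coef n.+2) -(coefS n) -(coefS n.+1) -!mul_polyC; ring.
Qed.

(** The associated Legendre function without sign and without (1 - t^2)^(k/2); that power is carried
    by sin t e^{ip} to the power k. *)
Definition legder n k : {poly R} := (P n)^`(k).
Local Notation p n k t := ((legder n k).[t]).

Lemma legderA n k t : p n.+1 k.+1 t = (n.+1 + k)%:R * p n k t + t * p n k.+1 t.
Proof.
rewrite /legder derivSn legendre_derivS derivnD derivnZ.
case: k => [|k]; first by rewrite !derivn0 derivn1 addn0 !hornerE.
rewrite derivn_mulX -!derivSn !hornerE natrD; rewrite /=; ring.
Qed.

Lemma legderE n k t :
  p n k.+1 t = t * p n.+1 k.+1 t - (n.+1%:R - k%:R) * p n.+1 k t.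
Proof.
have := legderA n.+1 k t.
rewrite {1}/legder derivSn legendre_derivSS derivnD derivnZ -derivSn !hornerE -!/(legder _ _).
rewrite !natrD !natrM => h; apply/eqP; rewrite -subr_eq0; apply/eqP.
move: h => /eqP; rewrite -subr_eq0 => /eqP <-; rewrite -(natr1 n.+1); ring.
Qed.

Lemma legderC n k t : (1 - t ^+ 2) * p n.+1 k.+1 t =
  (n.+1 + k)%:R * p n k t - (n.+1%:R - k%:R) * t * p n.+1 k t.
Proof.
have h1 := legderA n k t; have h2 := legderE n k t.
rewrite mulrBl mul1r {1}h1 h2; ring.
Qed.

Lemma legderC' n k t : (1 - t ^+ 2) * p n k.+1 t =
  (n.+1 + k)%:R * t * p n k t - (n.+1%:R - k%:R) * p n.+1 k t.
Proof.
have h1 := legderA n k t; have h2 := legderE n k t.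
rewrite mulrBl mul1r {1}h2 h1; ring.
Qed.

(** Bonnet's recurrence in the degree at fixed order, from two expressions of (1 - t^2) times the
    same derivative. *)
Lemma legderD n k t : (n.+2%:R - k%:R) * p n.+2 k t =
  (2 * n.+1 + 1)%:R * t * p n.+1 k t - (n.+1 + k)%:R * p n k t.
Proof.
have h1 := legderC n k t; have := legderC' n.+1 k t; rewrite h1.
rewrite !natrD !natrM -(natr1 n.+1) => h; apply/eqP; rewrite -subr_eq0; apply/eqP.
move: h => /eqP; rewrite -subr_eq0 => /eqP <-; ring.
Qed.

(** The latitude part of d_1 - i d_2 acting on a regular solid harmonic of degree n + 1 and order k
    + 1. *)
Lemma legder_lower n k t :
  n.+1%:R * (1 - t ^+ 2) * p n.+1 k.+1 t + k.+1%:R * (1 + t ^+ 2) * p n.+1 k.+1 t -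
  (1 - t ^+ 2) * t * p n.+1 k.+2 t = (n.+2 + k)%:R * (n.+1 + k)%:R * p n k t.
Proof.
have eA := legderA n k t; have eE := legderE n k.+1 t; have eC := legderC' n k.+1 t.
move/eqP: eA; rewrite -subr_eq0 => /eqP eA.
move/eqP: eE; rewrite -subr_eq0 => /eqP eE.
move/eqP: eC; rewrite -subr_eq0 => /eqP eC.
apply/eqP; rewrite -subr_eq0; apply/eqP.
(* The zeros stand for the three recurrences just put in the form of an expression equal to 0; with
   these multipliers they add up to the difference of the two sides. *)
transitivity ((n.+2 + k)%:R * 0 + (1 - t ^+ 2) * 0 - 0 : R); last by ring.
by rewrite -{1}eA -{1}eE -eC; rewrite !natrD -!natr1; ring.
Qed.

(** The counterpart for irregular solid harmonics, where d_1 - i d_2 raises the degree. *)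
Lemma legder_raise n k t :
  - n.+1%:R * (1 - t ^+ 2) * p n k.+1 t + k.+1%:R * (1 + t ^+ 2) * p n k.+1 t -
  (1 - t ^+ 2) * t * p n k.+2 t =
  (n%:R - k%:R) * (n.+1%:R - k%:R) * p n.+1 k t.
Proof.
have eA := legderA n k.+1 t; have eE := legderE n k t; have eC := legderC n k.+1 t.
move/eqP: eA; rewrite -subr_eq0 => /eqP eA.
move/eqP: eE; rewrite -subr_eq0 => /eqP eE.
move/eqP: eC; rewrite -subr_eq0 => /eqP eC.
apply/eqP; rewrite -subr_eq0; apply/eqP.
transitivity ((1 - t ^+ 2) * 0 - (n%:R - k%:R) * 0 - 0 : R); last by ring.
by rewrite -{1}eA -{1}eE -eC; rewrite !natrD -!natr1; ring.
Qed.

Lemma legendre0 : P 0 = 1.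
Proof. by rewrite /legendre expr0 mul1r invr1 scale1r expr0. Qed.

Lemma legder_eq0 n k t : (n < k)%N -> p n k t = 0.
Proof.
elim: n k => [|n ih] [//|k].
  by move=> _; rewrite /legder legendre0 -polyC1 derivnC horner0.
by rewrite ltnS => nk; rewrite legderA !ih ?mulr0 ?addr0// ltnW.
Qed.

(** The constant is (2n - 1)!!, built up by raising degree and order together. *)
Lemma legder_nn_gt0 n : exists c : R, 0 < c /\ forall t, p n n t = c.
Proof.
elim: n => [|n [c [c0 h]]].
  by exists 1; split=> // t; rewrite /legder legendre0 -polyC1 derivn0 hornerC.
exists ((n.+1 + n)%:R * c); split; first by rewrite mulr_gt0// ltr0n.
by move=> t; rewrite legderA h (legder_eq0 t (ltnSn n)) mulr0 addr0.
Qed.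

End Legendre.

(** * Ladder identities for solid harmonics *)

Section SolidHarmonics.
Variable R : realType.
Local Notation C := R[i].
Local Notation ci := (Complex (0 : R) 1).
Implicit Types (x : 'rV[R]_3) (e : expr R).

Fixpoint epow e n : expr R := if n is n'.+1 then Mul e (epow e n') else Cst 1.

Lemma eval_epow e n x : eval (epow e n) x = eval e x ^+ n.
Proof. by elim: n => [|n ih] /=; rewrite ?expr0// ih exprS. Qed.

Lemma rfree_epow e n : rfree e -> rfree (epow e n).
Proof. by move=> fe; elim: n => //= n ->; rewrite fe. Qed.

Lemma der_epow j e n x :
  eval (der j (epow e n)) x = n%:R * eval e x ^+ n.-1 * eval (der j e) x.
Proof.
elim: n => [|n ih] /=; first by rewrite !mul0r.
rewrite ih eval_epow; case: n {ih} => [|n] /=; first by rewrite expr0; ring.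
by rewrite exprS -(natr1 n.+1); ring.
Qed.

Definition epoly (p : {poly R}) e : expr R :=
  foldr (fun c acc => Add (Mul acc e) (Cst c%:C)) (Cst 0) p.

Lemma epolyE (p : {poly R}) e x (s : R) : eval e x = s%:C ->
  eval (epoly p e) x = (p.[s])%:C /\
  forall j, eval (der j (epoly p e)) x = (p^`().[s])%:C * eval (der j e) x.
Proof.
move=> es; rewrite /epoly -[in X in X /\ _](polyseqK p) -[in X in _ /\ X](polyseqK p).
rewrite -[in X in _ /\ X]/(id p).
have H (l : seq R) :
    eval (foldr (fun c acc => Add (Mul acc e) (Cst c%:C)) (Cst 0) l) x = ((Poly l).[s])%:C /\
    forall j, eval (der j (foldr (fun c acc => Add (Mul acc e) (Cst c%:C)) (Cst 0) l)) x =
      ((Poly l)^`().[s])%:C * eval (der j e) x.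
  elim: l => [|c l [ih1 ih2]] /=.
    by rewrite horner0 deriv0 horner0; split => // j; rewrite mul0r.
  rewrite cons_poly_def; split.
    by rewrite ih1 es !hornerE /= rmorphD rmorphM.
  move=> j; rewrite ih1 ih2 es derivD derivM derivX derivC addr0 mulr1.
  by rewrite !hornerE /= rmorphD rmorphM; ring.
have [h1 h2] := H p; rewrite !polyseqK in h1 h2 *.
by split.
Qed.

Definition esq : expr R := Add (Add (Mul (Crd R 0) (Crd R 0)) (Mul (Crd R 1) (Crd R 1)))
  (Mul (Crd R 2%:R) (Crd R 2%:R)).

Lemma eval_esq x : eval esq x = (enorm x)%:C ^+ 2.
Proof. by rewrite -rmorphXn/= enorm_sqr sum_ord3 !rmorphD !rmorphXn/= -!expr2. Qed.

(** The norm as |x|^2 times 1/|x|, which is correct at the origin as well since both are 0 there. *)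
Definition enrm : expr R := Mul esq (Rinv R).

Lemma eval_enrm x : eval enrm x = (enorm x)%:C.
Proof.
have -> : eval enrm x = eval esq x * ((enorm x)^-1)%:C by [].
rewrite eval_esq -rmorphXn -rmorphM; congr _%:C.
have [->|r0] := eqVneq (enorm x) 0; first by rewrite expr0n mul0r.
by rewrite expr2 mulfK.
Qed.

Definition om x : C := xhat x 0 0 +i* xhat x 0 1.
Definition ang n k x : C := om x ^+ k * ((legder R n k).[xhat x 0 2%:R])%:C.

Definition eom : expr R := Mul (Add (Crd R 0) (Mul (Cst ci) (Crd R 1))) (Rinv R).
Definition ez : expr R := Mul (Crd R 2%:R) (Rinv R).
Definition eang n k : expr R := Mul (epow eom k) (epoly (legder R n k) ez).

Lemma eval_eom x : eval eom x = om x.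
Proof.
rewrite /om /xhat !mxE /=; apply/eqP; rewrite eq_complex; apply/andP.
by rewrite re_mul im_mul re_add im_add re_mul im_mul /=; split; apply/eqP; ring.
Qed.

Lemma eval_ez x : eval ez x = (xhat x 0 2%:R)%:C.
Proof. by rewrite /= -rmorphM /xhat mxE mulrC. Qed.

Lemma eval_eang n k x : eval (eang n k) x = ang n k x.
Proof.
rewrite /= eval_epow eval_eom; congr (_ * _).
by have [-> _] := epolyE (legder R n k) (eval_ez x).
Qed.

(** Unnormalised solid harmonics of order k >= 0, with the radial factor kept apart from the angular
    one. This form contains [Rinv] even though its values are those of a polynomial. *)
Definition reg n k : expr R := Mul (epow enrm n) (eang n k).
Definition irr n k : expr R := Mul (epow (Rinv R) n.+1) (eang n k).

Lemma eval_reg n k x : eval (reg n k) x = (enorm x)%:C ^+ n * ang n k x.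
Proof.
have -> : eval (reg n k) x = eval (epow enrm n) x * eval (eang n k) x by [].
by rewrite eval_epow eval_enrm eval_eang.
Qed.

Lemma eval_irr n k x : eval (irr n k) x = ((enorm x)^-1)%:C ^+ n.+1 * ang n k x.
Proof.
have -> : eval (irr n k) x = eval (epow (Rinv R) n.+1) x * eval (eang n k) x by [].
by rewrite eval_epow eval_eang.
Qed.

Section Pointwise.
Variable x : 'rV[R]_3.
Hypothesis x0 : x != 0.
Local Notation rho := ((enorm x)^-1)%:C.
Local Notation r := ((enorm x)%:C).
Local Notation y j := ((xhat x 0 j)%:C).
Local Notation t := (y 2%:R).
Local Notation w := (om x).
Local Notation wc := (conjc (om x)).
Local Notation P n k := (((legder R n k).[xhat x 0 2%:R])%:C).

Lemma rho_r : rho * r = 1.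
Proof. by rewrite -rmorphM mulVf ?enorm_eq0. Qed.

Lemma xhatC j : (x 0 j)%:C = r * y j.
Proof. by rewrite -rmorphM mxE mulrA divff ?enorm_eq0// mul1r. Qed.

Lemma xhatC' j : (x 0 j)%:C * rho = y j.
Proof. by rewrite xhatC mulrAC [_ * rho]mulrC rho_r mul1r. Qed.

Lemma om_y : w = y 0 + ci * y 1.
Proof. by rewrite /om; apply/eqP; rewrite eq_complex /= ; simpc. Qed.

Lemma omc_y : wc = y 0 - ci * y 1.
Proof. by rewrite /om; apply/eqP; rewrite eq_complex /= ; simpc. Qed.

Lemma y_sqr : y 0 ^+ 2 + y 1 ^+ 2 + t ^+ 2 = 1.
Proof.
have : r ^+ 2 = (x 0 0)%:C ^+ 2 + (x 0 1)%:C ^+ 2 + (x 0 2%:R)%:C ^+ 2.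
  by rewrite -[LHS]eval_esq /= -!expr2.
rewrite !xhatC !exprMn -!mulrDr -{1}[r ^+ 2]mulr1 => /mulfI -> //.
by rewrite expf_neq0// -(rmorph0 (real_complex R)) (inj_eq (@complexI R)) enorm_eq0.
Qed.

Lemma om_omc : w * wc = 1 - t ^+ 2.
Proof.
rewrite omc_y om_y -y_sqr; have hi : ci ^+ 2 = -1 := sqr_i R.
rewrite [LHS](_ : _ = y 0 ^+ 2 - ci ^+ 2 * y 1 ^+ 2); last by ring.
by rewrite hi; ring.
Qed.

(** The gradient of x_1 + i x_2. With it, [dang] below is |x| times the gradient of the angular
    factor [ang]. *)
Definition cc (j : 'I_3) : C := if j == 0 then 1 else if j == 1 then ci else 0.
Definition dang n k j : C := k%:R * w ^+ k.-1 * (cc j - w * y j) * P n k +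
  w ^+ k * P n k.+1 * ((j == 2%:R)%:R - t * y j).

Lemma der_rho j : eval (der j (Rinv R)) x = - rho ^+ 2 * y j.
Proof.
rewrite /= -xhatC' -[rho * (rho * rho)]/(rho * (rho * rho)); ring.
Qed.

Lemma der_eom j : eval (der j eom) x = rho * (cc j - w * y j).
Proof.
pose e := Add (Crd R 0) (Mul (Cst ci) (Crd R 1)).
have -> : eval (der j eom) x = eval (der j e) x * rho + eval e x * eval (der j (Rinv R)) x by [].
have -> : eval (der j e) x = cc j.
  by move: j; elim/ord3P; rewrite /cc /=; ring.
have -> : w = eval e x * rho by rewrite -eval_eom.
by rewrite der_rho; ring.
Qed.

Lemma der_ez j : eval (der j ez) x = rho * ((j == 2%:R)%:R - t * y j).
Proof.
have -> : eval (der j ez) x = (2%:R == j)%:R * rho + (x 0 2%:R)%:C * eval (der j (Rinv R)) x by [].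
by rewrite der_rho -[t]xhatC' eq_sym; ring.
Qed.

Lemma der_enrm j : eval (der j enrm) x = y j.
Proof.
have -> : eval (der j enrm) x = eval (der j esq) x * rho + eval esq x * eval (der j (Rinv R)) x by [].
have -> : eval (der j esq) x = 2 * (x 0 j)%:C.
  by move: j; elim/ord3P => /=; ring.
rewrite der_rho eval_esq.
rewrite [LHS](_ : _ = 2 * ((x 0 j)%:C * rho) - (rho * r) ^+ 2 * y j); last by ring.
by rewrite rho_r xhatC'; ring.
Qed.

Lemma der_eang n k j : eval (der j (eang n k)) x = rho * dang n k j.
Proof.
have -> : eval (der j (eang n k)) x =
  eval (der j (epow eom k)) x * eval (epoly (legder R n k) ez) x +
  eval (epow eom k) x * eval (der j (epoly (legder R n k) ez)) x by [].
have [h1 h2] := epolyE (legder R n k) (eval_ez x).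
rewrite h1 h2 der_epow eval_epow eval_eom der_eom.
rewrite der_ez /dang -[(legder R n k)^`()]/((legendre R n)^`(k)^`()) -derivnS -/(legder R n k.+1).
ring.
Qed.

Lemma dang_z n k : dang n k 2%:R =
  w ^+ k * ((1 - t ^+ 2) * P n k.+1 - k%:R * t * P n k).
Proof.
rewrite /dang /cc /=; case: k => [|k]; first by rewrite expr0; ring.
by rewrite exprS /=; ring.
Qed.

Lemma dang_p n k : dang n k 0 + ci * dang n k 1 =
  - w ^+ k.+1 * (k%:R * P n k + t * P n k.+1).
Proof.
have hi : ci ^+ 2 = -1 := sqr_i R.
rewrite /dang /cc /= !exprS.
rewrite [LHS](_ : _ = k%:R * w ^+ k.-1 * P n k * ((1 + ci ^+ 2) - w * (y 0 + ci * y 1)) -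
   w ^+ k * P n k.+1 * t * (y 0 + ci * y 1)); last by ring.
rewrite hi -om_y; case: k => [|k] /=; first by rewrite expr0; ring.
by rewrite exprS; ring.
Qed.

Lemma dang_mE n k : dang n k 0 - ci * dang n k 1 =
  k%:R * w ^+ k.-1 * P n k * (2 - w * wc) - w ^+ k * P n k.+1 * t * wc.
Proof.
have hi : ci ^+ 2 = -1 := sqr_i R.
rewrite omc_y /dang /cc /=.
rewrite [LHS](_ : _ = k%:R * w ^+ k.-1 * P n k * ((1 - ci ^+ 2) - w * (y 0 - ci * y 1)) -
   w ^+ k * P n k.+1 * t * (y 0 - ci * y 1)); last by ring.
by rewrite hi; ring.
Qed.

Lemma dang_m n k : dang n k.+1 0 - ci * dang n k.+1 1 =
  w ^+ k * (k.+1%:R * (1 + t ^+ 2) * P n k.+1 - (1 - t ^+ 2) * t * P n k.+2).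
Proof.
rewrite dang_mE succnK exprS [LHS](_ : _ = w ^+ k * (k.+1%:R * (2 - w * wc) * P n k.+1 -
   (w * wc) * t * P n k.+2)); last by ring.
by rewrite om_omc; ring.
Qed.

Lemma dang_m0 n : dang n 0 0 - ci * dang n 0 1 = - wc * t * P n 1.
Proof. by rewrite dang_mE expr0; ring. Qed.

(** The angular factor is constant along rays, so its gradient is tangential. *)
Lemma euler_dang n k : \sum_(j < 3) y j * dang n k j = 0.
Proof.
rewrite sum_ord3 /dang /cc /=.
rewrite [LHS](_ : _ = k%:R * w ^+ k.-1 * P n k * ((y 0 + ci * y 1) -
  w * (y 0 ^+ 2 + y 1 ^+ 2 + t ^+ 2)) +
  w ^+ k * P n k.+1 * t * (1 - (y 0 ^+ 2 + y 1 ^+ 2 + t ^+ 2))); last by ring.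
by rewrite y_sqr -om_y; ring.
Qed.

Lemma der_reg n k j : eval (der j (reg n.+1 k)) x =
  r ^+ n * (n.+1%:R * (y j * ang n.+1 k x) + dang n.+1 k j).
Proof.
have -> : eval (der j (reg n.+1 k)) x =
  eval (der j (epow enrm n.+1)) x * eval (eang n.+1 k) x +
  eval (epow enrm n.+1) x * eval (der j (eang n.+1 k)) x by [].
rewrite der_epow eval_epow eval_enrm eval_eang der_enrm// der_eang// exprS /=.
rewrite [LHS](_ : _ = r ^+ n * (n.+1%:R * (y j * ang n.+1 k x) +
  (rho * r) * dang n.+1 k j)); last by ring.
by rewrite rho_r// mul1r.
Qed.

Lemma der_irr n k j : eval (der j (irr n k)) x =
  rho ^+ n.+2 * (- n.+1%:R * (y j * ang n k x) + dang n k j).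
Proof.
have -> : eval (der j (irr n k)) x =
  eval (der j (epow (Rinv R) n.+1)) x * eval (eang n k) x +
  eval (epow (Rinv R) n.+1) x * eval (der j (eang n k)) x by [].
rewrite der_epow eval_epow eval_eang der_rho// der_eang// !exprS /=; ring.
Qed.

Lemma conjcM (a b : C) : conjc (a * b) = conjc a * conjc b. Proof. exact: rmorphM. Qed.
Lemma conjcX (a : C) m : conjc (a ^+ m) = conjc a ^+ m. Proof. exact: rmorphXn. Qed.
Lemma realC (a : R) : forall b, a = b -> a%:C = b%:C. Proof. by move=> b ->. Qed.

Let rm := (rmorphB, rmorphD, rmorphM, rmorphXn, rmorph1, rmorph_nat, rmorphN).

(** First of the ladder identities: on regular harmonics all operators lower the degree by one,
    while d_3 keeps the order, d_1 + i d_2 raises it and d_1 - i d_2 lowers it. Each identity is one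
    recurrence for [legder] in disguise. *)
Lemma reg_z n k : eval (der 2%:R (reg n.+1 k)) x = (n.+1 + k)%:R * eval (reg n k) x.
Proof.
rewrite der_reg eval_reg dang_z /ang.
have := realC (legderC n k (xhat x 0 2%:R)).
rewrite !rm /= => ->.
ring.
Qed.

Lemma reg_p n k : eval (der 0 (reg n.+1 k)) x + ci * eval (der 1 (reg n.+1 k)) x =
  - eval (reg n k.+1) x.
Proof.
rewrite !der_reg eval_reg /ang.
rewrite [LHS](_ : _ = r ^+ n * (n.+1%:R * (y 0 + ci * y 1) * (w ^+ k * P n.+1 k) +
  (dang n.+1 k 0 + ci * dang n.+1 k 1))); last by ring.
rewrite -om_y dang_p.
have := realC (legderE n k (xhat x 0 2%:R)).
rewrite !rm /= => ->.
rewrite exprS; ring.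
Qed.

Lemma reg_m n k : eval (der 0 (reg n.+1 k.+1)) x - ci * eval (der 1 (reg n.+1 k.+1)) x =
  (n.+2 + k)%:R * (n.+1 + k)%:R * eval (reg n k) x.
Proof.
rewrite !der_reg eval_reg /ang.
rewrite [LHS](_ : _ = r ^+ n * (n.+1%:R * (y 0 - ci * y 1) * (w ^+ k.+1 * P n.+1 k.+1) +
  (dang n.+1 k.+1 0 - ci * dang n.+1 k.+1 1))); last by ring.
rewrite -omc_y dang_m// [w ^+ k.+1]exprS.
rewrite [LHS](_ : _ = r ^+ n * w ^+ k * (n.+1%:R * (w * wc) * P n.+1 k.+1 +
  k.+1%:R * (1 + t ^+ 2) * P n.+1 k.+1 - (1 - t ^+ 2) * t * P n.+1 k.+2)); last by ring.
rewrite om_omc//; have := realC (legder_lower n k (xhat x 0 2%:R)).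
rewrite !rm /= => ->; ring.
Qed.

(** Lowering order 0 leads to order -1, which is available only as the conjugate of order 1. *)
Lemma reg_m0 n : eval (der 0 (reg n.+1 0)) x - ci * eval (der 1 (reg n.+1 0)) x =
  - conjc (eval (reg n 1) x).
Proof.
rewrite !der_reg eval_reg /ang.
rewrite [LHS](_ : _ = r ^+ n * (n.+1%:R * (y 0 - ci * y 1) * (w ^+ 0 * P n.+1 0) +
  (dang n.+1 0 0 - ci * dang n.+1 0 1))); last by ring.
rewrite -omc_y dang_m0// conjcM conjcX conjcM conjcX !conjc_real.
have := realC (legderE n 0 (xhat x 0 2%:R)).
rewrite !rm /= => ->; rewrite expr0 expr1; ring.
Qed.

(** On irregular harmonics the operators act on the order as before but raise the degree. *)
Lemma irr_z n k : eval (der 2%:R (irr n k)) x =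
  - (n.+1%:R - k%:R) * eval (irr n.+1 k) x.
Proof.
rewrite der_irr eval_irr dang_z /ang.
have := realC (legderC' n k (xhat x 0 2%:R)).
rewrite !rm /= => ->; ring.
Qed.

Lemma irr_p n k : eval (der 0 (irr n k)) x + ci * eval (der 1 (irr n k)) x =
  - eval (irr n.+1 k.+1) x.
Proof.
rewrite !der_irr eval_irr /ang.
rewrite [LHS](_ : _ = rho ^+ n.+2 * (- n.+1%:R * (y 0 + ci * y 1) * (w ^+ k * P n k) +
  (dang n k 0 + ci * dang n k 1))); last by ring.
rewrite -om_y dang_p.
have := realC (legderA n k (xhat x 0 2%:R)).
rewrite !rm /= => ->; rewrite [w ^+ k.+1]exprS; ring.
Qed.

Lemma irr_m n k : eval (der 0 (irr n k.+1)) x - ci * eval (der 1 (irr n k.+1)) x =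
  (n%:R - k%:R) * (n.+1%:R - k%:R) * eval (irr n.+1 k) x.
Proof.
rewrite !der_irr eval_irr /ang.
rewrite [LHS](_ : _ = rho ^+ n.+2 * (- n.+1%:R * (y 0 - ci * y 1) * (w ^+ k.+1 * P n k.+1) +
  (dang n k.+1 0 - ci * dang n k.+1 1))); last by ring.
rewrite -omc_y dang_m// [w ^+ k.+1]exprS.
rewrite [LHS](_ : _ = rho ^+ n.+2 * w ^+ k * (- n.+1%:R * (w * wc) * P n k.+1 +
  k.+1%:R * (1 + t ^+ 2) * P n k.+1 - (1 - t ^+ 2) * t * P n k.+2)); last by ring.
rewrite om_omc//; have := realC (legder_raise n k (xhat x 0 2%:R)).
rewrite !rm /= => ->; ring.
Qed.

Lemma irr_m0 n : eval (der 0 (irr n 0)) x - ci * eval (der 1 (irr n 0)) x =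
  - conjc (eval (irr n.+1 1) x).
Proof.
rewrite !der_irr eval_irr /ang.
rewrite [LHS](_ : _ = rho ^+ n.+2 * (- n.+1%:R * (y 0 - ci * y 1) * (w ^+ 0 * P n 0) +
  (dang n 0 0 - ci * dang n 0 1))); last by ring.
rewrite -omc_y dang_m0// conjcM conjcX conjcM conjcX !conjc_real.
have := realC (legderA n 0 (xhat x 0 2%:R)).
rewrite !rm /= => ->; rewrite expr0 expr1; ring.
Qed.

Lemma euler_irr n k : \sum_(j < 3) (x 0 j)%:C * eval (der j (irr n k)) x =
  - n.+1%:R * eval (irr n k) x.
Proof.
rewrite sum_ord3 !der_irr eval_irr (xhatC 0) (xhatC 1) (xhatC 2%:R) -[RHS]addr0.
rewrite [LHS](_ : _ = rho ^+ n.+1 * (rho * r) * (- n.+1%:R * ang n k x *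
    (y 0 ^+ 2 + y 1 ^+ 2 + t ^+ 2) +
    (y 0 * dang n k 0 + y 1 * dang n k 1 + t * dang n k 2%:R))); last first.
  by rewrite exprS; ring.
rewrite rho_r// y_sqr//; have := euler_dang n k; rewrite sum_ord3 => ->; ring.
Qed.

End Pointwise.
End SolidHarmonics.

(** * Polynomial representatives and spans of solid harmonics *)

Section SolidVectors.
Variable R : realType.
Local Notation C := R[i].
Implicit Types (x : 'rV[R]_3) (e : expr R).

Lemma natrC (m : nat) : (m%:R : R)%:C = m%:R :> C.
Proof. exact: rmorph_nat. Qed.

Lemma enorm_xhat x j : (enorm x)%:C * (xhat x 0 j)%:C = (x 0 j)%:C.
Proof.
have [->|x0] := eqVneq x 0; first by rewrite enorm0 mul0r mxE.
exact: (esym (xhatC x0 j)).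
Qed.

Lemma enorm_om x : (enorm x)%:C * om x = eval (Add (Crd R 0) (Mul (Cst (Complex 0 1)) (Crd R 1))) x.
Proof.
transitivity ((x 0 0)%:C + Complex 0 1 * (x 0 1)%:C); last by [].
by rewrite -(enorm_xhat x 0) -(enorm_xhat x 1) om_y; ring.
Qed.

(** Multiplied by the right power of |x|, the recurrence [legderD] only involves x_3 and |x|^2, so
    polynomials in degrees n and n + 1 give one in degree n + 2. Order equal to the degree gives a
    multiple of (x_1 + i x_2)^n, larger orders give 0. *)
Lemma reg_rfree n k : exists e, rfree e /\ forall x, eval e x = eval (reg R n k) x.
Proof.
(* Two consecutive degrees are carried along, as the recurrence has two steps. *)
suff H m : (forall k, exists e, rfree e /\ forall x, eval e x = eval (reg R m k) x) /\
   (forall k, exists e, rfree e /\ forall x, eval e x = eval (reg R m.+1 k) x).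
  by have [h _] := H n; exact: h.
have big (a b : nat) : (a < b)%N -> exists e, rfree e /\ forall x, eval e x = eval (reg R a b) x.
  by move=> ab; exists (Cst 0); split => // x; rewrite eval_reg /ang legder_eq0//= !mulr0.
have diag (a : nat) : exists e, rfree e /\ forall x, eval e x = eval (reg R a a) x.
  have [c [_ hc]] := legder_nn_gt0 R a.
  pose e := Add (Crd R 0) (Mul (Cst (Complex 0 1)) (Crd R 1)).
  exists (Mul (epow e a) (Cst c%:C)); split; first by rewrite /= rfree_epow.
  move=> x; rewrite eval_reg /ang hc mulrA -exprMn enorm_om.
  by rewrite eval_Mul eval_epow.
elim: m => [|m [h0 h1]].
  split=> [[|k']|[|k']]; [exact: diag|exact: big| |].
    exists (Crd R 2%:R); split => // x.
    rewrite eval_reg eval_Crd /ang expr1 expr0 mul1r -(enorm_xhat x 2%:R); congr (_ * _%:C).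
    have := legderC' 0 0 (xhat x 0 2%:R); rewrite legder_eq0//.
    have [c [_ hc]] := legder_nn_gt0 R 0.
    rewrite {1}/legder legendre0 derivn0 -polyC1 hornerC mulr0 addn0 !mulr1 mul1r subr0 mul1r.
    by move=> /eqP; rewrite eq_sym subr_eq0 => /eqP.
  by case: k' => [|k']; [exact: diag|exact: big].
split=> // {}k; have [km|mk] := ltnP k m.+2; last first.
  by move: mk; rewrite leq_eqVlt => /orP[/eqP <-|]; [exact: diag|exact: big].
have [e0 [f0 E0]] := h0 k; have [e1 [f1 E1]] := h1 k.
(* The leading coefficient of the recurrence, invertible because the case k >= m + 2 has been set
   aside. *)
pose d : C := (m.+2%:R - k%:R)^-1.
exists (Mul (Cst d) (Add (Mul (Cst (2 * m.+1 + 1)%:R) (Mul (Crd R 2%:R) e1))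
  (Mul (Cst (- (m.+1 + k)%:R)) (Mul (esq R) e0)))).
split; first by rewrite /= f0 f1.
move=> x.
rewrite [RHS]eval_reg eval_Mul eval_Add !eval_Mul !eval_Cst eval_Crd.
rewrite E0 E1 eval_esq !eval_reg -(enorm_xhat x 2%:R) /ang.
set t := xhat x 0 2%:R.
have h : (m.+2%:R - k%:R) * ((legder R m.+2 k).[t])%:C =
    (2 * m.+1 + 1)%:R * t%:C * ((legder R m.+1 k).[t])%:C -
    (m.+1 + k)%:R * ((legder R m k).[t])%:C.
  by rewrite -!natrC -rmorphB -!rmorphM legderD rmorphB.
have d0 : (m.+2%:R - k%:R : C) != 0.
  by rewrite subr_eq0 eqr_nat gtn_eqF.
apply: (canLR (mulKf d0)); rewrite !exprS.
set r := (enorm x)%:C in h *; set p2 := ((legder R m.+2 k).[_])%:C in h *.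
rewrite [RHS](_ : _ = r * (r * r ^+ m) * om x ^+ k * ((m.+2%:R - k%:R) * p2)); last by ring.
by rewrite h; ring.
Qed.

Fixpoint econj e : expr R :=
  match e with
  | Cst c => Cst (conjc c)
  | Add a b => Add (econj a) (econj b)
  | Mul a b => Mul (econj a) (econj b)
  | _ => e
  end.

Lemma conjcD (a b : C) : conjc (a + b) = conjc a + conjc b. Proof. exact: rmorphD. Qed.

Lemma eval_econj e x : eval (econj e) x = conjc (eval e x).
Proof.
elim: e => [c|j||a iha b ihb|a iha b ihb] //.
- by rewrite eval_Crd conjc_real.
- by rewrite [RHS]conjc_real.
- by rewrite eval_Add conjcD -iha -ihb.
- by rewrite eval_Mul conjcM -iha -ihb.
Qed.

Lemma der_econj j e x : eval (der j (econj e)) x = conjc (eval (der j e) x).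
Proof.
elim: e => [c|i||a iha b ihb|a iha b ihb].
- by rewrite der_Cst conjc0.
- by rewrite !der_Crd conjc_nat.
- have E : eval (der j (Rinv R)) x = -1 * ((x 0 j)%:C *
      (((enorm x)^-1)%:C * (((enorm x)^-1)%:C * ((enorm x)^-1)%:C))) by [].
  have N1 : conjc (-1 : C) = -1 by apply/eqP; rewrite eq_complex /= !oppr0 !eqxx.
  by rewrite [LHS]E E !conjcM !conjc_real N1.
- by rewrite !der_Add conjcD iha ihb.
- by rewrite !der_Mul conjcD !conjcM iha ihb !eval_econj.
Qed.

Lemma rfree_econj e : rfree (econj e) = rfree e.
Proof. by elim: e => //= a -> b ->. Qed.

Definition yc n k : C := (Ynorm R n k)%:C * (-1) ^+ k.

Lemma yc_neq0 n k : yc n k != 0.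
Proof.
rewrite mulf_neq0 ?expf_neq0 ?oppr_eq0 ?oner_eq0//.
rewrite -(rmorph0 (real_complex R)) (inj_eq (@complexI R)) lt0r_neq0//.
rewrite /Ynorm sqrtr_gt0 !(mulr_gt0, invr_gt0)// ?ltr0n ?fact_gt0 ?addn1// ?pi_gt0//.
Qed.

(** The family [b] is [reg] or [irr]; keeping it abstract lets both kinds share the span argument.
    Negative orders are signed conjugates, as in [sphharm]. *)
Definition solid (b : nat -> nat -> expr R) (n : nat) (m : int) : expr R :=
  match m with
  | Posz k => Mul (Cst (yc n k)) (b n k)
  | Negz k => Mul (Cst ((-1) ^+ k.+1)) (econj (Mul (Cst (yc n k.+1)) (b n k.+1)))
  end.

Lemma sphharmE n m x : sphharm n m (xhat x) =
  match m with
  | Posz k => yc n k * ang n k x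
  | Negz k => (-1) ^+ k.+1 * conjc (yc n k.+1 * ang n k.+1 x)
  end.
Proof.
have H k : Ynonneg n k (xhat x) = yc n k * ang n k x by rewrite /Ynonneg /yc /ang -mulrA.
by case: m => k; rewrite /sphharm H.
Qed.

Lemma solidE b s n m x : (forall k, eval (b n k) x = s%:C * ang n k x) ->
  eval (solid b n m) x = s%:C * sphharm n m (xhat x).
Proof.
move=> hb; rewrite sphharmE; case: m => k; rewrite /solid.
  by rewrite eval_Mul eval_Cst hb mulrCA.
rewrite eval_Mul eval_Cst eval_econj eval_Mul eval_Cst hb.
rewrite (conjcM _ (s%:C * _)) (conjcM s%:C) conjc_real (conjcM _ (ang _ _ _)).
ring.
Qed.

Lemma solid_negE b n k x : eval (solid b n (Negz k)) x =
  ((-1) ^+ k.+1 * conjc (yc n k.+1)) * conjc (eval (b n k.+1) x).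
Proof. by rewrite eval_Mul eval_econj eval_Mul !eval_Cst (conjcM (yc _ _)) mulrA. Qed.

Lemma regsolidE n x i : regsolid n x i 0 = eval (solid (@reg R) n (n%:Z - i%:Z)) x.
Proof.
rewrite (@solidE _ (enorm x ^+ n)) => [|k]; first by rewrite mxE mxE.
by rewrite eval_reg rmorphXn.
Qed.

Lemma irrsolidE n x i : irrsolid n x i 0 = eval (solid (@irr R) n (n%:Z - i%:Z)) x.
Proof.
rewrite (@solidE _ (enorm x ^- n.+1)) => [|k]; first by rewrite mxE mxE.
by rewrite eval_irr -rmorphXn exprVn.
Qed.

Section Span.
Variables (b : nat -> nat -> expr R) (s : nat -> 'rV[R]_3 -> R).
Hypothesis hb : forall n k x, eval (b n k) x = (s n x)%:C * ang n k x.

Definition in_span n (f : 'rV[R]_3 -> C) := exists a : 'I_(n.*2.+1) -> C,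
  forall x, x != 0 -> f x = \sum_i a i * eval (solid b n (n%:Z - (i : nat)%:Z)) x.

Lemma eq_in_span n f g : (forall x, x != 0 -> f x = g x) -> in_span n f -> in_span n g.
Proof. by move=> fg [a ha]; exists a => x x0; rewrite -fg// ha. Qed.

Lemma in_spanD n f g : in_span n f -> in_span n g -> in_span n (fun x => f x + g x).
Proof.
move=> [a ha] [c hc]; exists (fun i => a i + c i) => x x0; rewrite ha// hc// -big_split.
by apply: eq_bigr => i _; rewrite mulrDl.
Qed.

Lemma in_spanZ n (c : C) f : in_span n f -> in_span n (fun x => c * f x).
Proof.
move=> [a ha]; exists (fun i => c * a i) => x x0; rewrite ha// mulr_sumr.
by apply: eq_bigr => i _; rewrite mulrA.
Qed.

Lemma in_span0 n : in_span n (fun=> 0).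
Proof. by exists (fun=> 0) => x _; rewrite big1// => i _; rewrite mul0r. Qed.

Lemma in_span_sum n (I : finType) (f : I -> 'rV[R]_3 -> C) :
  (forall i, in_span n (f i)) -> in_span n (fun x => \sum_i f i x).
Proof.
move=> h; elim: (index_enum I) => [|i l ih].
  by apply: eq_in_span (in_span0 n) => x _; rewrite big_nil.
by apply: eq_in_span (in_spanD (h i) ih) => x _; rewrite big_cons.
Qed.

Lemma in_span_index n (i : 'I_(n.*2.+1)) : in_span n (eval (solid b n (n%:Z - (i : nat)%:Z))).
Proof.
exists (fun k => (k == i)%:R) => x _; rewrite (bigD1 i)//= eqxx mul1r big1 ?addr0//.
by move=> k /negbTE ->; rewrite mul0r.
Qed.

(** Orders beyond the degree give 0. The others sit at index n - k, and their conjugates, of order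
    -k up to a constant, at index n + k. *)
Lemma in_span_conj_base n k :
  in_span n (eval (b n k)) /\ in_span n (fun x => conjc (eval (b n k) x)).
Proof.
have [nk|kn] := ltnP n k.
  have z x : eval (b n k) x = 0 by rewrite hb /ang legder_eq0// !mulr0.
  by split; apply: eq_in_span (in_span0 n) => x _; rewrite z ?conjc0.
have E : in_span n (eval (b n k)).
  have h : (n - k < n.*2.+1)%N by rewrite ltnS -addnn (leq_trans (leq_subr _ _))// leq_addr.
  have := in_span_index (Ordinal h); rewrite /= -subzn// opprB addrC subrK => /(in_spanZ (yc n k)^-1).
  by apply: eq_in_span => x _; rewrite eval_Mul eval_Cst mulKf ?yc_neq0.
split => //; case: k kn E => [|k] kn E.
  apply: eq_in_span E => x _; rewrite hb /ang expr0 mul1r !conjcM !conjc_real//.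
have h : (n + k.+1 < n.*2.+1)%N by rewrite ltnS -addnn leq_add2l.
have := in_span_index (Ordinal h).
rewrite /= PoszD opprD addrA subrr sub0r -NegzE.
move=> /(in_spanZ ((-1) ^+ k.+1 * conjc (yc n k.+1))^-1).
apply: eq_in_span => x _.
rewrite solid_negE mulKf//.
by rewrite mulf_neq0 ?expf_neq0 ?oppr_eq0 ?oner_eq0 ?conjc_eq0 ?yc_neq0.
Qed.

Lemma in_span_conj n f : in_span n f -> in_span n (fun x => conjc (f x)).
Proof.
move=> [a ha].
have S i : in_span n (fun x => conjc (a i * eval (solid b n (n%:Z - (i : nat)%:Z)) x)).
  case: (n%:Z - _) => k.
    have [_ /(in_spanZ (conjc (a i) * conjc (yc n k)))] := in_span_conj_base n k.
    by apply: eq_in_span => x _; rewrite conjcM eval_Mul eval_Cst (conjcM (yc _ _)) mulrA.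
  have [/(in_spanZ (conjc (a i) * conjc ((-1) ^+ k.+1) * yc n k.+1)) h _] := in_span_conj_base n k.+1.
  apply: eq_in_span h => x _.
  by rewrite solid_negE conjcM (conjcM (_ * _)) conjcM !conjcK !mulrA.
apply: eq_in_span (in_span_sum S) => x x0; rewrite ha//.
by rewrite (rmorph_sum (@conjc R)).
Qed.

(** The derivatives d_1 and d_2 are recovered from d_1 + i d_2 and d_1 - i d_2 by half their sum and
    -i/2 times their difference; negative orders follow because real derivatives commute with
    conjugation. *)
Lemma in_span_der m n j (i : int) :
  (forall k, in_span n (eval (der 2%:R (b m k)))) ->
  (forall k, in_span n (fun x => eval (der 0 (b m k)) x + Complex 0 1 * eval (der 1 (b m k)) x)) ->
  (forall k, in_span n (fun x => eval (der 0 (b m k)) x - Complex 0 1 * eval (der 1 (b m k)) x)) ->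
  in_span n (eval (der j (solid b m i))).
Proof.
move=> hz hp hm.
have hi : (Complex 0 1 : C) * Complex 0 1 = -1 by rewrite -expr2; exact: sqr_i.
have D k : in_span n (eval (der j (b m k))).
  move: j; elim/ord3P.
  - have := in_spanZ (2^-1) (in_spanD (hp k) (hm k)); apply: eq_in_span => x _.
    by field.
  - have := in_spanZ (- Complex 0 1 / 2) (in_spanD (hp k) (in_spanZ (-1) (hm k))).
    apply: eq_in_span => x _; set u := eval _ x; set v := eval _ x.
    rewrite [LHS](_ : _ = - (Complex 0 1 * Complex 0 1) * v); last by field.
    by rewrite hi opprK mul1r.
  - exact: hz.
case: i => k.
  by apply: eq_in_span (in_spanZ (yc m k) (D k)) => x _; rewrite der_Mul der_Cst mul0r add0r.
apply: eq_in_span (in_spanZ ((-1) ^+ k.+1 * conjc (yc m k.+1)) (in_span_conj (D k.+1))) => x _.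
by rewrite der_Mul der_Cst mul0r add0r der_econj der_Mul der_Cst mul0r add0r !eval_Cst (conjcM (yc _ _)) mulrA.
Qed.

End Span.
End SolidVectors.

Section Operators.
Variable R : realType.
Local Notation C := R[i].
Implicit Types (x : 'rV[R]_3) (e : expr R).

Lemma partialC_eval j e x : dom e x -> partialC j (eval e) x = eval (der j e) x.
Proof.
move=> /differentiable_eval[_ _ pr pi].
by apply/eqP; rewrite eq_complex /= pr pi !eqxx.
Qed.

Lemma domT e x : x != 0 -> dom e x. Proof. by rewrite /dom orbC => ->. Qed.

(** [Dreg] is chosen by [xget] with default 0, so it has its defining property only through this
    existence statement. *)
Lemma is_Dreg_exists n j : exists D, @is_Dreg R n.+1 j D.
Proof.
have H (i : 'I_(n.+1.*2.+1)) : in_span (@reg R) n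
    (eval (der j (solid (@reg R) n.+1 (n.+1%:Z - (i : nat)%:Z)))).
  have hb (m k : nat) x : eval (reg R m k) x = (enorm x ^+ m)%:C * ang m k x.
    by rewrite eval_reg rmorphXn.
  have B := in_span_conj_base hb n.
  apply: (in_span_der hb) => k.
  - apply: eq_in_span (in_spanZ (n.+1 + k)%:R (B k).1) => x x0; by rewrite reg_z.
  - apply: eq_in_span (in_spanZ (-1) (B k.+1).1) => x x0; by rewrite reg_p// mulN1r.
  - case: k => [|k].
      apply: eq_in_span (in_spanZ (-1) (B 1).2) => x x0; by rewrite reg_m0// mulN1r.
    apply: eq_in_span (in_spanZ ((n.+2 + k)%:R * (n.+1 + k)%:R) (B k).1) => x x0.
    by rewrite reg_m.
have /choice[a ha] := H.
exists (\matrix_(i, k) a i k) => x i x0.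
have -> : (fun y => regsolid n.+1 y i 0) = eval (solid (@reg R) n.+1 (n.+1%:Z - (i : nat)%:Z)).
  by apply/funext => y; exact: regsolidE.
rewrite partialC_eval; last exact: domT.
by rewrite ha// mxE; apply: eq_bigr => k _; rewrite mxE regsolidE.
Qed.

Lemma is_Dirr_exists n j : exists D, @is_Dirr R n j D.
Proof.
have H (i : 'I_(n.*2.+1)) : in_span (@irr R) n.+1
    (eval (der j (solid (@irr R) n (n%:Z - (i : nat)%:Z)))).
  have hb (m k : nat) x : eval (irr R m k) x = (enorm x ^- m.+1)%:C * ang m k x.
    by rewrite eval_irr -rmorphXn exprVn.
  have B := in_span_conj_base hb n.+1.
  apply: (in_span_der hb) => k.
  - apply: eq_in_span (in_spanZ (- (n.+1%:R - k%:R)) (B k).1) => x x0; by rewrite irr_z.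
  - apply: eq_in_span (in_spanZ (-1) (B k.+1).1) => x x0; by rewrite irr_p// mulN1r.
  - case: k => [|k].
      apply: eq_in_span (in_spanZ (-1) (B 1).2) => x x0; by rewrite irr_m0// mulN1r.
    apply: eq_in_span (in_spanZ ((n%:R - k%:R) * (n.+1%:R - k%:R)) (B k).1) => x x0.
    by rewrite irr_m.
have /choice[a ha] := H.
exists (\matrix_(i, k) a i k) => x i x0.
have -> : (fun y => irrsolid n y i 0) = eval (solid (@irr R) n (n%:Z - (i : nat)%:Z)).
  by apply/funext => y; exact: irrsolidE.
rewrite partialC_eval; last exact: domT.
by rewrite ha// mxE; apply: eq_bigr => k _; rewrite mxE irrsolidE.
Qed.

Lemma DregP n j : is_Dreg j (Dreg R n.+1 j).
Proof. exact: (xgetPex 0 (is_Dreg_exists n j)). Qed.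

Lemma DirrP n j : is_Dirr j (Dirr R n j).
Proof. exact: (xgetPex 0 (is_Dirr_exists n j)). Qed.

(** Euler's relation in place of a scaling law: it fits the formal derivative and treats negative
    degrees alike. *)
Definition homog (s : C) e := forall x, x != 0 ->
  \sum_(j < 3) (x 0 j)%:C * eval (der j e) x = s * eval e x.
Definition harmonic e := forall x, x != 0 ->
  \sum_(j < 3) eval (der j (der j e)) x = 0.

Lemma eqe_homog s e1 e2 : eqe e1 e2 -> homog s e1 -> homog s e2.
Proof.
move=> e12 h x x0; rewrite -e12// -(h x x0); apply: eq_bigr => j _.
by rewrite (der_eqe j e12).
Qed.

Lemma eqe_harmonic e1 e2 : eqe e1 e2 -> harmonic e1 -> harmonic e2.
Proof.
move=> e12 h x x0; rewrite -[RHS](h x x0); apply: eq_bigr => j _.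
by rewrite (der_eqe j (der_eqe j e12)).
Qed.

Lemma homogZ s c e : homog s e -> homog s (Mul (Cst c) e).
Proof.
move=> h x x0; rewrite eval_Mul eval_Cst mulrCA -h// mulr_sumr; apply: eq_bigr => j _.
by rewrite der_Mul der_Cst eval_Cst mul0r add0r mulrCA.
Qed.

Lemma homogD s a b : homog s a -> homog s b -> homog s (Add a b).
Proof.
move=> ha hb x x0; rewrite eval_Add mulrDr -ha// -hb// -big_split.
by apply: eq_bigr => j _; rewrite der_Add mulrDr.
Qed.

Lemma der_derZ c j k e x : eval (der k (der j (Mul (Cst c) e))) x = c * eval (der k (der j e)) x.
Proof. by rewrite /= !mul0r !add0r. Qed.

Lemma harmonicZ c e : harmonic e -> harmonic (Mul (Cst c) e).
Proof.
move=> h x x0; rewrite -[RHS](mulr0 c) -[in RHS](h x x0) mulr_sumr; apply: eq_bigr => j _.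
exact: der_derZ.
Qed.

Lemma harmonicD a b : harmonic a -> harmonic b -> harmonic (Add a b).
Proof.
move=> ha hb x x0; rewrite -[RHS]addr0 -[X in _ = X + _](ha x x0) -[X in _ = _ + X](hb x x0) -big_split.
exact: eq_bigr.
Qed.

Lemma homog0 s : homog s (Cst 0).
Proof. by move=> x _; rewrite mulr0 big1// => j _; rewrite mulr0. Qed.

Lemma harmonic0 : harmonic (Cst 0).
Proof. by move=> x _; rewrite big1. Qed.

Lemma homog_conj s e : conjc s = s -> homog s e -> homog s (econj e).
Proof.
move=> cs h x x0; rewrite eval_econj -[in RHS]cs -conjcM -h// (rmorph_sum (@conjc R)).
by apply: eq_bigr => j _; rewrite der_econj /= conjcM conjc_real.
Qed.

Lemma econj_der j e : eqe (der j (econj e)) (econj (der j e)).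
Proof. by move=> x _; rewrite der_econj eval_econj. Qed.

Lemma harmonic_conj e : harmonic e -> harmonic (econj e).
Proof.
move=> h x x0; rewrite -[RHS](conjc0 R) -[in RHS](h x x0) (rmorph_sum (@conjc R)).
apply: eq_bigr => j _; rewrite (der_eqe j (@econj_der j e))//.
by rewrite der_econj.
Qed.

(** Differentiate Euler's relation in x_j; the derivative of the factor x_j yields the one unit that
    is lost. *)
Lemma homog_der s j e : homog s e -> homog (s - 1) (der j e).
Proof.
move=> h; pose E := Add (Add (Mul (Crd R 0) (der 0 e)) (Mul (Crd R 1) (der 1 e)))
  (Mul (Crd R 2%:R) (der 2%:R e)).
have hE : eqe E (Mul (Cst s) e).
  by move=> x x0; rewrite eval_Mul eval_Cst -h// sum_ord3.
move=> x x0; have := der_eqe j hE x0.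
rewrite der_Mul der_Cst eval_Cst mul0r add0r mulrBl mul1r => <-.
rewrite !der_Add !der_Mul !der_Crd !eval_Crd sum_ord3.
rewrite !(der_comm j).
by move: j; elim/ord3P => /=; ring.
Qed.

Lemma harmonic_der j e : harmonic e -> harmonic (der j e).
Proof.
move=> h; pose E := Add (Add (der 0 (der 0 e)) (der 1 (der 1 e))) (der 2%:R (der 2%:R e)).
have hE : eqe E (Cst 0).
  by move=> x x0; rewrite eval_Cst -(h x x0) sum_ord3.
move=> x x0; have := der_eqe j hE x0; rewrite der_Cst => h0; rewrite -[RHS]h0.
rewrite !der_Add sum_ord3.
have K i : eval (der i (der i (der j e))) x = eval (der j (der i (der i e))) x.
  have C2 : eqe (der i (der j e)) (der j (der i e)) by move=> y _; exact: der_comm.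
  by rewrite (der_eqe i C2)// der_comm.
by rewrite !K.
Qed.

Definition elin m (a : 'rV[C]_m) (X : 'I_m -> expr R) : expr R :=
  foldr (fun i acc => Add (Mul (Cst (a 0 i)) (X i)) acc) (Cst 0) (enum 'I_m).

Lemma eval_elin m (a : 'rV[C]_m) X x : eval (elin a X) x = \sum_i a 0 i * eval (X i) x.
Proof.
rewrite /elin -big_enum; elim: (enum _) => [|i l ih]; first by rewrite big_nil.
by rewrite big_cons [LHS]/= ih.
Qed.

Lemma der_elin j m (a : 'rV[C]_m) X x :
  eval (der j (elin a X)) x = \sum_i a 0 i * eval (der j (X i)) x.
Proof.
rewrite /elin -big_enum; elim: (enum _) => [|i l ih]; first by rewrite big_nil.
by rewrite big_cons [LHS]/= ih mul0r add0r.
Qed.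

Lemma rfree_elin m (a : 'rV[C]_m) X : (forall i, rfree (X i)) -> rfree (elin a X).
Proof. by move=> h; rewrite /elin; elim: (enum _) => //= i l ->; rewrite h. Qed.

Lemma homog_elin s m (a : 'rV[C]_m) X : (forall i, homog s (X i)) -> homog s (elin a X).
Proof.
move=> h; rewrite /elin; elim: (enum _) => [|i l ih]; first exact: homog0.
by apply: homogD => //; apply: homogZ.
Qed.

Lemma harmonic_elin m (a : 'rV[C]_m) X : (forall i, harmonic (X i)) -> harmonic (elin a X).
Proof.
move=> h; rewrite /elin; elim: (enum _) => [|i l ih]; first exact: harmonic0.
by apply: harmonicD => //; apply: harmonicZ.
Qed.

End Operators.

(** * Kelvin transform and harmonicity *)

Section Kelvin.
Variable R : realType.
Local Notation C := R[i].
Implicit Types (x : 'rV[R]_3) (e f : expr R).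
Local Notation rho x := ((enorm x)^-1)%:C.

Lemma eval_Rinv x : eval (Rinv R) x = rho x. Proof. by []. Qed.

(** The differential equation satisfied by constant multiples of |x|^N. *)
Definition radial (N : C) f := forall j x, x != 0 ->
  eval (der j f) x = N * eval f x * rho x ^+ 2 * (x 0 j)%:C.

Lemma rho_sqr x : x != 0 -> rho x ^+ 2 * \sum_(j < 3) (x 0 j)%:C ^+ 2 = 1.
Proof.
move=> x0; have -> : \sum_(j < 3) (x 0 j)%:C ^+ 2 = (enorm x)%:C ^+ 2.
  by rewrite -eval_esq sum_ord3 /esq !eval_Add !eval_Mul !eval_Crd -!expr2.
by rewrite -exprMn rho_r// expr1n.
Qed.

Lemma radial_rho m : radial (- m%:R) (epow (Rinv R) m).
Proof.
move=> j x x0; rewrite der_epow eval_epow der_rho// -(xhatC' x0).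
rewrite eval_Rinv.
case: m => [|m]; first by rewrite oppr0 !mul0r.
by rewrite succnK [_ ^+ m.+1]exprS; ring.
Qed.

Lemma radial_enrm m : radial m%:R (epow (enrm R) m).
Proof.
move=> j x x0; rewrite der_epow eval_epow der_enrm// -(xhatC' x0) eval_enrm.
case: m => [|m]; first by rewrite !mul0r.
rewrite succnK [_ ^+ m.+1]exprS [RHS](_ : _ = m.+1%:R * (rho x * (enorm x)%:C) * (enorm x)%:C ^+ m * rho x * (x 0 j)%:C);
  last by ring.
by rewrite rho_r//; ring.
Qed.

Lemma radial_esq : radial 2 (esq R).
Proof.
move=> j x x0; rewrite eval_esq.
rewrite [RHS](_ : _ = 2 * (rho x * (enorm x)%:C) ^+ 2 * (x 0 j)%:C); last by ring.
rewrite rho_r// expr1n mulr1 /esq !der_Add !der_Mul !der_Crd !eval_Crd.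
by move: j; elim/ord3P => /=; ring.
Qed.

Lemma homog_radialM N s f e : radial N f -> homog s e -> homog (N + s) (Mul f e).
Proof.
move=> rf he x x0; rewrite sum_ord3 !der_Mul !rf// eval_Mul.
have := he x x0; rewrite sum_ord3 => h.
have := rho_sqr x0; rewrite sum_ord3 => h2.
set u0 := (x 0 0)%:C in h h2 *; set u1 := (x 0 1)%:C in h h2 *; set u2 := (x 0 2%:R)%:C in h h2 *.
set d0 := eval (der 0 e) x in h *; set d1 := eval (der 1 e) x in h *.
set d2 := eval (der 2%:R e) x in h *; set F := eval f x; set E := eval e x in h *.
rewrite [LHS](_ : _ = N * F * E * (rho x ^+ 2 * (u0 ^+ 2 + u1 ^+ 2 + u2 ^+ 2)) +
  F * (u0 * d0 + u1 * d1 + u2 * d2)); last by ring.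
by rewrite h h2; ring.
Qed.

Lemma der_der_radial N f j x : radial N f -> x != 0 ->
  eval (der j (der j f)) x = N * eval f x * rho x ^+ 2 *
    ((N - 2) * rho x ^+ 2 * (x 0 j)%:C ^+ 2 + 1).
Proof.
move=> rf x0.
pose F := Mul (Cst N) (Mul f (Mul (Mul (Rinv R) (Rinv R)) (Crd R j))).
have hF : eqe (der j f) F.
  by move=> y y0; rewrite rf// !eval_Mul eval_Cst eval_Crd eval_Rinv; ring.
rewrite (der_eqe j hF)// /F !der_Mul der_Cst !(der_rho x0) (rf j x x0) !eval_Mul eval_Cst.
have e1 : (j == j)%:R = 1 :> C by rewrite eqxx.
by rewrite der_Crd e1 -(xhatC' x0) eval_Crd eval_Rinv; ring.
Qed.

(** The coefficient N (N + 1 + 2 s) vanishes for N = - (2 s + 1), which is the Kelvin transform.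
    With N = 2 the formula also serves for the factor |x|^2 of the ansatz. *)
Lemma laplacian_radialM N s f e x : radial N f -> homog s e -> x != 0 ->
  \sum_(j < 3) eval (der j (der j (Mul f e))) x =
  N * (N + 1 + 2 * s) * rho x ^+ 2 * eval f x * eval e x +
  eval f x * \sum_(j < 3) eval (der j (der j e)) x.
Proof.
move=> rf he x0.
have K j : eval (der j (der j (Mul f e))) x = eval (der j (der j f)) x * eval e x +
   2 * eval (der j f) x * eval (der j e) x + eval f x * eval (der j (der j e)) x.
  have -> : eval (der j (der j (Mul f e))) x =
    (eval (der j (der j f)) x * eval e x + eval (der j f) x * eval (der j e) x) +
    (eval (der j f) x * eval (der j e) x + eval f x * eval (der j (der j e)) x) by [].
  by ring.
rewrite !sum_ord3 !K !(der_der_radial _ rf)// !rf//.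
have := he x x0; rewrite sum_ord3 => h.
have := rho_sqr x0; rewrite sum_ord3 => h2.
set u0 := (x 0 0)%:C in h h2 *; set u1 := (x 0 1)%:C in h h2 *; set u2 := (x 0 2%:R)%:C in h h2 *.
set d0 := eval (der 0 e) x in h *; set d1 := eval (der 1 e) x in h *.
set d2 := eval (der 2%:R e) x in h *; set F := eval f x; set E := eval e x in h *.
set r2 := rho x ^+ 2 in h2 *.
rewrite [LHS](_ : _ = N * F * r2 * E * ((N - 2) * (r2 * (u0 ^+ 2 + u1 ^+ 2 + u2 ^+ 2)) + 3) +
  2 * N * F * r2 * (u0 * d0 + u1 * d1 + u2 * d2) +
  F * (eval (der 0 (der 0 e)) x + eval (der 1 (der 1 e)) x + eval (der 2%:R (der 2%:R e)) x));
  last by ring.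
by rewrite h h2; ring.
Qed.

Lemma homog_irr n k : homog (- n.+1%:R) (irr R n k).
Proof. by move=> x x0; rewrite euler_irr. Qed.

(** The Laplacian is (d_1 - i d_2)(d_1 + i d_2) + d_3^2, and the ladder identities turn the two
    summands into opposite multiples of the harmonic of degree n + 2. *)
Lemma harmonic_irr n k : harmonic (irr R n k).
Proof.
move=> x x0; rewrite sum_ord3.
pose ci : C := Complex 0 1.
have hi : ci ^+ 2 = -1 := sqr_i R.
pose ep := Add (der 0 (irr R n k)) (Mul (Cst ci) (der 1 (irr R n k))).
have hp : eqe ep (Mul (Cst (-1)) (irr R n.+1 k.+1)).
  by move=> y y0; rewrite eval_Add !eval_Mul !eval_Cst irr_p// mulN1r.
have hz : eqe (der 2%:R (irr R n k)) (Mul (Cst (- (n.+1%:R - k%:R))) (irr R n.+1 k)).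
  by move=> y y0; rewrite eval_Mul eval_Cst irr_z.
have h2 := der_eqe 2%:R hz x0; rewrite der_Mul der_Cst eval_Cst mul0r add0r irr_z// in h2.
have h0 := der_eqe 0 hp x0; rewrite der_Mul der_Cst eval_Cst mul0r add0r in h0.
have h1 := der_eqe 1 hp x0; rewrite der_Mul der_Cst eval_Cst mul0r add0r in h1.
rewrite der_Add der_Mul der_Cst eval_Cst mul0r add0r in h0.
rewrite der_Add der_Mul der_Cst eval_Cst mul0r add0r in h1.
have hm := irr_m x0 n.+1 k; rewrite -/ci in hm.
have c01 := der_comm 0 1 (irr R n k) x.
set d00 := eval (der 0 (der 0 _)) x in h0 *; set d11 := eval (der 1 (der 1 _)) x in h1 *.
set d01 := eval (der 0 (der 1 _)) x in h0 c01; rewrite -c01 in h1.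
set I2 := eval (irr R n.+2 k) x in h2 hm.
(* The factorisation as a polynomial identity in [ci]; the last term disappears once i^2 = -1 is
   used. *)
have -> : d00 + d11 = (d00 + ci * d01) - ci * (d01 + ci * d11) + (1 + ci ^+ 2) * d11 by ring.
rewrite h0 h1 h2 hi.
rewrite [LHS](_ : _ = - (eval (der 0 (irr R n.+1 k.+1)) x - ci * eval (der 1 (irr R n.+1 k.+1)) x) +
  (n.+1%:R - k%:R) * (n.+2%:R - k%:R) * I2); last by ring.
by rewrite hm; ring.
Qed.

Lemma reg_kelvin n k : eqe (reg R n k) (Mul (epow (enrm R) n.*2.+1) (irr R n k)).
Proof.
move=> x x0; rewrite [LHS]eval_reg eval_Mul eval_irr eval_epow eval_enrm mulrA; congr (_ * _).
rewrite -addnn -addSn exprD.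
rewrite [RHS](_ : _ = (enorm x)%:C ^+ n * (rho x * (enorm x)%:C) ^+ n.+1); last by rewrite exprMn; ring.
by rewrite rho_r// expr1n mulr1.
Qed.

Lemma kelvin_homog_exponent n : (n.*2.+1%:R + - n.+1%:R : C) = n%:R.
Proof. by rewrite -addnn -addSn natrD; ring. Qed.

Lemma homog_reg n k : homog n%:R (reg R n k).
Proof.
apply: eqe_homog; first by move=> x x0; apply/esym/reg_kelvin.
rewrite -kelvin_homog_exponent.
exact: homog_radialM (@radial_enrm _) (@homog_irr n k).
Qed.

Lemma harmonic_reg n k : harmonic (reg R n k).
Proof.
apply: eqe_harmonic; first by move=> x x0; apply/esym/reg_kelvin.
move=> x x0.
rewrite (laplacian_radialM (@radial_enrm _) (@homog_irr n k) x0) harmonic_irr// mulr0 addr0.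
(* Here N = 2n + 1 and s = - (n + 1), so N + 1 + 2 s = 0. *)
rewrite (_ : n.*2.+1%:R + 1 + _ = 0) ?mulr0 ?mul0r//.
by rewrite -addnn -addSn natrD -(natr1 n); ring.
Qed.

Lemma solid_ind b n m (P : expr R -> Prop) :
  (forall c e, P e -> P (Mul (Cst c) e)) -> (forall e, P e -> P (econj e)) ->
  (forall k, P (b n k)) -> P (solid b n m).
Proof. by move=> hZ hc hb; case: m => k; rewrite /solid; auto. Qed.

(** Combines smoothness at the origin, known for the polynomial representative, with homogeneity and
    harmonicity, known for the form with [Rinv] and transported along [eqe]. *)
Lemma regsolid_expr n : exists X : 'I_(n.*2.+1) -> expr R,
  [/\ forall i, rfree (X i), forall i x, eval (X i) x = regsolid n x i 0,
      forall i, homog n%:R (X i) & forall i, harmonic (X i)].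
Proof.
have H (i : 'I_(n.*2.+1)) : exists e, [/\ rfree e, forall x, eval e x = regsolid n x i 0,
    homog n%:R e & harmonic e].
  have /choice[b hb] := reg_rfree R n.
  pose e := solid (fun _ => b) n (n%:Z - (i : nat)%:Z).
  have he x : eval e x = regsolid n x i 0.
    rewrite regsolidE /e; case: (n%:Z - _) => k.
      by rewrite eval_Mul [RHS]eval_Mul (hb k).2.
    by rewrite !solid_negE (hb k.+1).2.
  have es : eqe (solid (@reg R) n (n%:Z - (i : nat)%:Z)) e.
    by move=> x x0; rewrite he regsolidE.
  exists e; split => //.
  - apply: (@solid_ind _ n _ (fun e => rfree e)) => [c e'|e'|k]; [by []|by rewrite rfree_econj|by case: (hb k)].
  - apply: eqe_homog es _; apply: (@solid_ind _ n _ (homog n%:R)); first exact: homogZ.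
      by move=> e' h; apply: homog_conj => //; exact: conjc_nat.
    by move=> k; exact: homog_reg.
  - apply: eqe_harmonic es _; apply: (@solid_ind _ n _ (@harmonic R)); first exact: harmonicZ.
      exact: harmonic_conj.
    by move=> k; exact: harmonic_reg.
have /choice[X hX] := H.
by exists X; split=> i; case: (hX i).
Qed.

Lemma irrsolid_kelvin n i x :
  irrsolid n x i 0 = rho x ^+ n.*2.+1 * regsolid n x i 0.
Proof.
rewrite /irrsolid /regsolid !mxE mulrA; congr (_ * _).
(* At the origin both sides are 0, since the inverse of 0 is 0. *)
have [->|x0] := eqVneq x 0.
  rewrite enorm0 invr0 -rmorphXn -rmorphM; congr _%:C.
  by rewrite (exprS _ n.*2) !mul0r (exprS _ n) mul0r invr0.
rewrite -addnn -addnS exprD.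
rewrite [RHS](_ : _ = (rho x * (enorm x)%:C) ^+ n * rho x ^+ n.+1); last first.
  by rewrite exprMn rmorphXn; ring.
by rewrite rho_r// expr1n mul1r -rmorphXn exprVn.
Qed.

End Kelvin.

(** * Linear independence of spherical harmonics of one degree *)

Section Independence.
Variable R : realType.
Local Notation C := R[i].

(** The polynomial is nonzero because differentiating it further gives a positive constant; the
    points 1/(j+2) are then too many to be all roots. *)
Lemma legder_nonroot n k : (k <= n)%N ->
  exists z : R, [/\ 0 < z, z < 1 & (legder R n k).[z] != 0].
Proof.
move=> kn; set p := legder R n k.
have p0 : p != 0.
  apply/eqP => h; have [c [c0 hc]] := legder_nn_gt0 R n.
  have E : p^`(n - k) = legder R n n by rewrite /p /legder /derivn -iterD subnK.
  by move: (hc 0); rewrite -E h linear0 horner0 => h0; rewrite -h0 ltxx in c0.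
pose zs := [seq (j.+2%:R : R)^-1 | j <- iota 0 (size p)].
have uz : uniq zs.
  rewrite map_inj_uniq ?iota_uniq// => i j /invr_inj/eqP.
  by rewrite eqr_nat => /eqP[].
have [hall|/allPn[z /mapP[j _ ->] hz]] := boolP (all (root p) zs); last first.
  by exists (j.+2%:R)^-1; split => //; rewrite invf_lt1// ltr1n.
by have := max_poly_roots p0 hall uz; rewrite size_map size_iota ltnn.
Qed.

(** The rational parametrisation of the unit circle, used to supply arbitrarily many distinct points
    on it. *)
Definition cayley (t : R) : C := ((1 - t ^+ 2) / (1 + t ^+ 2)) +i* (2 * t / (1 + t ^+ 2)).

Lemma cayley_den (t : R) : 1 + t ^+ 2 != 0.
Proof. by rewrite lt0r_neq0// ltr_wpDr// sqr_ge0. Qed.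

Lemma cayley_norm t : Re (cayley t) ^+ 2 + Im (cayley t) ^+ 2 = 1.
Proof. by rewrite /=; field; exact: cayley_den. Qed.

Lemma cayley_inj : injective cayley.
Proof.
apply: (can_inj (g := fun u => Im u / (1 + Re u))) => t /=.
have d := cayley_den t.
have -> : 1 + (1 - t ^+ 2) / (1 + t ^+ 2) = 2 / (1 + t ^+ 2) by field.
by field.
Qed.

Lemma poly_circle_eq0 (p : {poly C}) :
  (forall u : C, Re u ^+ 2 + Im u ^+ 2 = 1 -> p.[u] = 0) -> p = 0.
Proof.
move=> h; apply/eqP; apply: contraT => p0.
pose us := [seq cayley j%:R | j <- iota 0 (size p)].
have hall : all (root p) us.
  by apply/allP => u /mapP[j _ ->]; apply/rootP/h; exact: cayley_norm.
have uu : uniq us.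
  by rewrite map_inj_uniq ?iota_uniq// => i j /cayley_inj/eqP; rewrite eqr_nat => /eqP.
by have := max_poly_roots p0 hall uu; rewrite size_map size_iota ltnn.
Qed.

(** On a circle of latitude the combination is a trigonometric polynomial in the longitude. Each
    order owns one frequency, so a coefficient can be read off wherever its latitude factor is
    nonzero. *)
Lemma Yvec_free n (a : 'rV[C]_(n.*2.+1)) :
  (forall x, enorm x = 1 -> a *m Yvec n x = 0) -> a = 0.
Proof.
move=> h; apply/rowP => i0; rewrite mxE.
pose k0 : nat := `|n%:Z - (i0 : nat)%:Z|%N.
have k0n : (k0 <= n)%N by rewrite /k0; have := ltn_ord i0; lia.
(* The latitude is adapted to the one index [i0] under study; other latitude factors may vanish
   there. *)
have [z [z0 z1 hz]] := legder_nonroot k0n.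
pose s := Num.sqrt (1 - z ^+ 2).
have s2 : 0 < 1 - z ^+ 2 by rewrite subr_gt0 expr_lt1// ltW.
have s0 : 0 < s by rewrite sqrtr_gt0.
pose cf (m : int) : C := match m with
  | Posz k => yc R n k * s%:C ^+ k * ((legder R n k).[z])%:C
  | Negz k => (-1) ^+ k.+1 * conjc (yc R n k.+1) * s%:C ^+ k.+1 * ((legder R n k.+1).[z])%:C end.
(* Degree j collects the order m = j - n, stored at position 2n - j. *)
pose p : {poly C} := \poly_(j < n.*2.+1)
  (a 0 (inord (n.*2 - j)) * cf (n%:Z - (n.*2 - j)%N%:Z)).
have p0 : p = 0.
  apply: poly_circle_eq0 => u hu.
  pose x := row3 (s * Re u) (s * Im u) z.
  have xE0 : x 0 0 = s * Re u by rewrite mxE.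
  have xE1 : x 0 1 = s * Im u by rewrite mxE.
  have xE2 : x 0 2%:R = z by rewrite mxE.
  have ex : enorm x = 1.
    apply/eqP; rewrite -(eqrXn2 (_ : 0 < 2)%N) ?enorm_ge0// expr1n enorm_sqr sum_ord3 xE0 xE1 xE2.
    rewrite !exprMn -mulrDr hu mulr1 /s sqr_sqrtr ?(ltW s2)//; apply/eqP; ring.
  have xh : xhat x = x by rewrite /xhat ex invr1 scale1r.
  have omx : om x = s%:C * u.
    rewrite /om xh xE0 xE1; case: (u) => ur ui; apply/eqP; rewrite eq_complex /=.
    by rewrite /real_complex_def /=; apply/andP; split; apply/eqP; ring.
  have uu : conjc u * u = 1.
    case: (u) hu => ur ui /= hu; apply/eqP; rewrite eq_complex /=.
    by apply/andP; split; apply/eqP; rewrite -?hu; ring.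
  (* Multiplying by u^n clears negative frequencies: on the circle conjugation is inversion, so
     order m contributes u^(n + m). *)
  have := congr1 (fun M : 'M[C]_(1, 1) => u ^+ n * M 0 0) (h x ex).
  rewrite mxE [in RHS]mxE mulr0 => <-.
  rewrite horner_poly mulr_sumr (reindex_inj rev_ord_inj) /=.
  apply: eq_bigr => i _; rewrite !subSS.
  have hi : (i <= n.*2)%N by rewrite -ltnS.
  rewrite subKn// inord_val -mulrA [in RHS]mulrCA; congr (_ * _).
  rewrite mxE -[X in sphharm _ _ X]xh sphharmE /ang omx xh xE2 /cf.
  case E : (n%:Z - (i : nat)%:Z) => [k|k].
    have -> : (n.*2 - i = n + k)%N by move: E hi; lia.
    rewrite exprMn exprD; ring.
  have nk : (n = (n.*2 - i) + k.+1)%N by move: E hi; rewrite NegzE; lia.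
  rewrite [X in _ = u ^+ X * _]nk exprD.
  have cE (y v : C) (P : R) m : conjc (y * ((s%:C * v) ^+ m * P%:C)) =
      conjc y * (s%:C ^+ m * conjc v ^+ m * P%:C).
    rewrite conjcM conjcM conjc_real; congr (_ * (_ * _)).
    by rewrite exprMn conjcM !conjcX conjc_real.
  rewrite cE.
  rewrite [RHS](_ : _ = (-1) ^+ k.+1 * conjc (yc R n k.+1) * s%:C ^+ k.+1 *
    ((legder R n k.+1).[z])%:C * u ^+ (n.*2 - i) * (conjc u * u) ^+ k.+1); last first.
    by rewrite exprMn; ring.
  by rewrite uu expr1n mulr1.
have hi : (i0 <= n.*2)%N by rewrite -ltnS.
have := congr1 (fun q : {poly C} => q`_(n.*2 - i0)) p0.
rewrite coef_poly coef0 ltnS leq_subr subKn// inord_val => /eqP; rewrite mulf_eq0.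
move=> /orP[/eqP//|/eqP cf0]; exfalso; move: cf0; apply/eqP.
have sC : s%:C != 0 :> C.
  by rewrite -(rmorph0 (real_complex R)) (inj_eq (@complexI R)) lt0r_neq0.
have zC : ((legder R n k0).[z])%:C != 0 :> C.
  by rewrite -(rmorph0 (real_complex R)) (inj_eq (@complexI R)).
move: zC; rewrite /k0 /cf; case: (n%:Z - _) => k /= zC.
  by apply: mulf_neq0 => //; apply: mulf_neq0; [exact: yc_neq0|exact: expf_neq0].
apply: mulf_neq0 => //; apply: mulf_neq0; last exact: expf_neq0.
by apply: mulf_neq0; rewrite ?expf_neq0 ?oppr_eq0 ?oner_eq0 ?conjc_eq0 ?yc_neq0.
Qed.

End Independence.

(** * Lame fields built from harmonic fields *)

Section Ansatz.
Variables (R : realType) (Rad : R).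
Local Notation C := R[i].
Implicit Types (x : 'rV[R]_3) (e : expr R).

Lemma homog_Add3 s (a b c : expr R) : homog s a -> homog s b -> homog s c ->
  homog s (Add (Add a b) c).
Proof. by move=> *; apply: homogD => //; apply: homogD. Qed.

Section Stress.
Variables (l u : R) (w : 'I_3 -> expr R).

Lemma eval_estress i j x : eval (estress l u w i j) x =
  l%:C *+ (i == j) * eval (ediv w) x + u%:C * (eval (der j (w i)) x + eval (der i (w j)) x).
Proof. by []. Qed.

Lemma eval_div_stress i x : eval (ediv (estress l u w i)) x =
  (l%:C + u%:C) * eval (der i (ediv w)) x +
  u%:C * \sum_(j < 3) eval (der j (der j (w i))) x.
Proof.
rewrite eval_ediv.
have E j : eval (der j (estress l u w i j)) x =
    l%:C *+ (i == j) * eval (der j (ediv w)) x +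
    u%:C * (eval (der j (der j (w i))) x + eval (der j (der i (w j))) x).
  by rewrite /estress der_Add !der_Mul !der_Cst !eval_Cst !mul0r !add0r der_Add.
rewrite !sum_ord3 !E.
have Dd : eval (der i (ediv w)) x = eval (der 0 (der i (w 0))) x +
   eval (der 1 (der i (w 1))) x + eval (der 2%:R (der i (w 2%:R))) x.
  by rewrite /ediv !der_Add !(der_comm i).
have K (T t0 t1 t2 a b d a' b' d' : C) : l%:C * T = t0 + t1 + t2 -> T = a' + b' + d' ->
   t0 + u%:C * (a + a') + (t1 + u%:C * (b + b')) + (t2 + u%:C * (d + d')) =
   (l%:C + u%:C) * T + u%:C * (a + b + d).
  by move=> h1 h2; rewrite [RHS]addrC mulrDl h1 h2; ring.
apply: K Dd.
have KK (T : 'I_3 -> C) : l%:C * T i =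
    l%:C *+ (i == 0) * T 0 + l%:C *+ (i == 1) * T 1 + l%:C *+ (i == 2%:R) * T 2%:R.
  by move: i {E}; elim/ord3P => /=; rewrite ?mulr1n ?mulr0n; ring.
exact: (KK (fun j => eval (der j (ediv w)) x)).
Qed.

Lemma flux_stress i x : \sum_(j < 3) (x 0 j)%:C * eval (estress l u w i j) x =
  l%:C * (x 0 i)%:C * eval (ediv w) x + u%:C *
  (\sum_(j < 3) (x 0 j)%:C * eval (der j (w i)) x + \sum_(j < 3) (x 0 j)%:C * eval (der i (w j)) x).
Proof.
rewrite !sum_ord3 !eval_estress.
set T := eval (ediv w) x; set a := eval (der 0 (w i)) x; set b := eval (der 1 (w i)) x.
set d := eval (der 2%:R (w i)) x; set a' := eval (der i (w 0)) x; set b' := eval (der i (w 1)) x.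
set d' := eval (der i (w 2%:R)) x.
move: a b d a' b' d' => a b d a' b' d'.
by move: i; elim/ord3P => /=; rewrite ?mulr1n ?mulr0n; ring.
Qed.

End Stress.

Variables (P : 'I_3 -> expr R) (s kap : C).
Hypothesis hP : forall i, harmonic (P i).
Hypothesis sP : forall i, homog s (P i).

Let D := ediv P.
Let v i := der i D.

Definition ansatz i : expr R := Add (P i) (Mul (Cst kap)
  (Add (Mul (esq R) (v i)) (Mul (Cst (- (Rad ^+ 2)%:C)) (v i)))).

Lemma homog_ediv : homog (s - 1) D.
Proof. by apply: homog_Add3; apply: homog_der. Qed.

Lemma harmonic_ediv : harmonic D.
Proof. by apply: harmonicD; [apply: harmonicD|]; apply: harmonic_der. Qed.

Lemma eval_ansatz i x : eval (ansatz i) x = eval (P i) x +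
  kap * ((enorm x)%:C ^+ 2 - (Rad ^+ 2)%:C) * eval (v i) x.
Proof. by rewrite eval_Add eval_Mul eval_Add !eval_Mul !eval_Cst eval_esq; ring. Qed.

Lemma der_esq j x : eval (der j (esq R)) x = 2 * (x 0 j)%:C.
Proof.
rewrite /esq !der_Add !der_Mul !der_Crd !eval_Crd.
by move: j; elim/ord3P => /=; ring.
Qed.

Lemma der_ansatz j i x : eval (der j (ansatz i)) x = eval (der j (P i)) x +
  kap * (2 * (x 0 j)%:C * eval (v i) x +
    ((enorm x)%:C ^+ 2 - (Rad ^+ 2)%:C) * eval (der j (v i)) x).
Proof.
rewrite /ansatz der_Add der_Mul der_Cst der_Add !der_Mul der_Cst !eval_Cst der_esq eval_esq.
by ring.
Qed.

(** The gradient of |x|^2 contracts with that of [D] to 2 (s - 1) D by Euler's relation, and the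
    remaining term is a Laplacian of [D]. *)
Lemma div_ansatz : eqe (ediv ansatz) (Mul (Cst (1 + 2 * kap * (s - 1))) D).
Proof.
move=> x x0; rewrite eval_ediv eval_Mul eval_Cst sum_ord3 !der_ansatz.
have h := homog_ediv x0; rewrite sum_ord3 in h.
have g := harmonic_ediv x0; rewrite sum_ord3 in g.
have dE : eval D x = eval (der 0 (P 0)) x + eval (der 1 (P 1)) x + eval (der 2%:R (P 2%:R)) x.
  by rewrite eval_ediv sum_ord3.
have K (a b d X0 X1 X2 v0 v1 v2 w0 w1 w2 q : C) :
  (a + kap * (2 * X0 * v0 + q * w0)) + (b + kap * (2 * X1 * v1 + q * w1)) +
  (d + kap * (2 * X2 * v2 + q * w2)) =
  (a + b + d) + 2 * kap * (X0 * v0 + X1 * v1 + X2 * v2) + kap * q * (w0 + w1 + w2) by ring.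
by rewrite K -dE h g; ring.
Qed.

(** The components of grad div P are harmonic of degree s - 2, and Delta(|x|^2 v) = (6 + 4 (s - 2))
    v = (4 s - 2) v. *)
Lemma laplacian_ansatz i x : x != 0 ->
  \sum_(j < 3) eval (der j (der j (ansatz i))) x = kap * (4 * s - 2) * eval (v i) x.
Proof.
move=> x0.
have hv : homog (s - 1 - 1) (v i) by apply: homog_der; exact: homog_ediv.
have Hv : harmonic (v i) by apply: harmonic_der; exact: harmonic_ediv.
have := laplacian_radialM (@radial_esq R) hv x0.
rewrite Hv// mulr0 addr0 eval_esq => lv.
have -> : \sum_(j < 3) eval (der j (der j (ansatz i))) x =
   \sum_(j < 3) eval (der j (der j (P i))) x +
   kap * \sum_(j < 3) eval (der j (der j (Mul (esq R) (v i)))) x -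
   kap * (Rad ^+ 2)%:C * \sum_(j < 3) eval (der j (der j (v i))) x.
  have E j : eval (der j (der j (ansatz i))) x = eval (der j (der j (P i))) x +
    (kap * (eval (der j (der j (Mul (esq R) (v i)))) x +
      - (Rad ^+ 2)%:C * eval (der j (der j (v i))) x)).
    have -> : eval (der j (der j (ansatz i))) x = eval (der j (der j (P i))) x +
      eval (der j (der j (Mul (Cst kap) (Add (Mul (esq R) (v i)) (Mul (Cst (- (Rad ^+ 2)%:C)) (v i)))))) x by [].
    rewrite der_derZ; congr (_ + kap * _).
    have -> : eval (der j (der j (Add (Mul (esq R) (v i)) (Mul (Cst (- (Rad ^+ 2)%:C)) (v i))))) x =
      eval (der j (der j (Mul (esq R) (v i)))) x +
      eval (der j (der j (Mul (Cst (- (Rad ^+ 2)%:C)) (v i)))) x by [].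
    by rewrite der_derZ.
  by rewrite !sum_ord3 !E; ring.
rewrite hP// Hv// lv.
rewrite [LHS](_ : _ = kap * (2 * (2 + 1 + 2 * (s - 1 - 1))) * eval (v i) x *
  (((enorm x)^-1)%:C * (enorm x)%:C) ^+ 2); last by ring.
by rewrite rho_r//; ring.
Qed.

Lemma ansatz_equilibrium (l u : R) i x : x != 0 ->
  u%:C * kap * (4 * s - 2) + (l%:C + u%:C) * (1 + 2 * kap * (s - 1)) = 0 ->
  eval (ediv (estress l u ansatz i)) x = 0.
Proof.
move=> x0 h; rewrite eval_div_stress laplacian_ansatz// (der_eqe i div_ansatz)//.
rewrite der_Mul der_Cst eval_Cst mul0r add0r -/(v i).
by rewrite -(mul0r (eval (v i) x)) -h; ring.
Qed.

(** On the sphere the factor |x|^2 - Rad^2 is zero, so the correction contributes only through the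
    gradient 2x of that factor. *)
Lemma ansatz_flux (l u : R) i x : x != 0 -> enorm x = Rad ->
  \sum_(j < 3) (x 0 j)%:C * eval (estress l u ansatz i j) x =
  (l%:C * (1 + 2 * kap * (s - 1)) + 2 * u%:C * kap * (s - 1)) * (x 0 i)%:C * eval D x +
  u%:C * (s * eval (P i) x + \sum_(j < 3) (x 0 j)%:C * eval (der i (P j)) x +
    2 * kap * (Rad ^+ 2)%:C * eval (v i) x).
Proof.
move=> x0 xR; rewrite flux_stress div_ansatz// eval_Mul eval_Cst.
have q0 : (enorm x)%:C ^+ 2 - (Rad ^+ 2)%:C = 0 by rewrite xR rmorphXn subrr.
rewrite !sum_ord3 !der_ansatz q0 !mul0r !addr0.
have h := homog_ediv x0; rewrite sum_ord3 in h.
have g := sP i x0; rewrite sum_ord3 in g.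
have r2 : (x 0 0)%:C ^+ 2 + (x 0 1)%:C ^+ 2 + (x 0 2%:R)%:C ^+ 2 = (Rad ^+ 2)%:C.
  by rewrite -xR rmorphXn -eval_esq /esq !eval_Add !eval_Mul !eval_Crd -!expr2.
rewrite -g -r2.
have K (L U X0 X1 X2 Xi a b d a' b' d' v0 v1 v2 vi dd : C) : X0 * v0 + X1 * v1 + X2 * v2 = (s - 1) * dd ->
  L * Xi * ((1 + 2 * kap * (s - 1)) * dd) +
  U * (X0 * (a + kap * (2 * X0 * vi)) + X1 * (b + kap * (2 * X1 * vi)) + X2 * (d + kap * (2 * X2 * vi)) +
  (X0 * (a' + kap * (2 * Xi * v0)) + X1 * (b' + kap * (2 * Xi * v1)) + X2 * (d' + kap * (2 * Xi * v2)))) =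
  (L * (1 + 2 * kap * (s - 1)) + 2 * U * kap * (s - 1)) * Xi * dd +
  U * (X0 * a + X1 * b + X2 * d + (X0 * a' + X1 * b' + X2 * d') +
   2 * kap * (X0 ^+ 2 + X1 ^+ 2 + X2 ^+ 2) * vi).
  move=> hh; rewrite [LHS](_ : _ = L * Xi * ((1 + 2 * kap * (s - 1)) * dd) +
    U * ((X0 * a + X1 * b + X2 * d) + (X0 * a' + X1 * b' + X2 * d') +
      2 * kap * (X0 ^+ 2 + X1 ^+ 2 + X2 ^+ 2) * vi + 2 * kap * Xi * (X0 * v0 + X1 * v1 + X2 * v2))); last by ring.
  by rewrite hh; ring.
exact: K.
Qed.

End Ansatz.

Section Fields.
Variables (R : realType).
Local Notation C := R[i].
Implicit Types (x : 'rV[R]_3) (e : expr R).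

(** A fixed choice of polynomial representatives; the irregular solid harmonics below are built as
    their Kelvin transforms and inherit harmonicity from them. *)
Definition regx n : 'I_(n.*2.+1) -> expr R := sval (cid (regsolid_expr R n)).
Definition irrx n (i : 'I_(n.*2.+1)) : expr R := Mul (epow (Rinv R) n.*2.+1) (regx i).

Lemma regx_rfree n (i : 'I_(n.*2.+1)) : rfree (regx i).
Proof. by rewrite /regx; case: cid => X []. Qed.

Lemma eval_regx n (i : 'I_(n.*2.+1)) x : eval (regx i) x = regsolid n x i 0.
Proof. by rewrite /regx; case: cid => X []. Qed.

Lemma homog_regx n (i : 'I_(n.*2.+1)) : homog n%:R (regx i).
Proof. by rewrite /regx; case: cid => X []. Qed.

Lemma harmonic_regx n (i : 'I_(n.*2.+1)) : harmonic (regx i).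
Proof. by rewrite /regx; case: cid => X []. Qed.

Lemma eval_irrx n (i : 'I_(n.*2.+1)) x : eval (irrx i) x = irrsolid n x i 0.
Proof. by rewrite eval_Mul eval_epow eval_regx irrsolid_kelvin. Qed.

Lemma irrx_exponent n : (- n.*2.+1%:R + n%:R : C) = - n.+1%:R.
Proof. by rewrite -addnn -addSn natrD; ring. Qed.

Lemma homog_irrx n (i : 'I_(n.*2.+1)) : homog (- n.+1%:R) (irrx i).
Proof.
by rewrite -irrx_exponent; exact: homog_radialM (@radial_rho R _) (homog_regx i).
Qed.

Lemma harmonic_irrx n (i : 'I_(n.*2.+1)) : harmonic (irrx i).
Proof.
move=> x x0; rewrite (laplacian_radialM (@radial_rho R _) (homog_regx i) x0) harmonic_regx//.
rewrite (_ : - n.*2.+1%:R + 1 + _ = 0) ?mulr0 ?mul0r ?addr0//.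
by rewrite -addnn -addSn natrD -(natr1 n); ring.
Qed.

Lemma der_regx n j (i : 'I_(n.+1.*2.+1)) x : x != 0 ->
  eval (der j (regx i)) x = (Dreg R n.+1 j *m regsolid n x) i 0.
Proof.
move=> x0; rewrite -(DregP j i x0) -partialC_eval; last exact: domT.
by congr (partialC j _ x); apply/funext => y; rewrite eval_regx.
Qed.

Lemma der_irrx n j (i : 'I_(n.*2.+1)) x : x != 0 ->
  eval (der j (irrx i)) x = (Dirr R n j *m irrsolid n.+1 x) i 0.
Proof.
move=> x0; rewrite -(DirrP j i x0) -partialC_eval; last exact: domT.
by congr (partialC j _ x); apply/funext => y; rewrite eval_irrx.
Qed.

Lemma eval_elin_regx n (a : 'rV[C]_(n.*2.+1)) x :
  eval (elin a (@regx n)) x = (a *m regsolid n x) 0 0.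
Proof. by rewrite eval_elin mxE; apply: eq_bigr => i _; rewrite eval_regx. Qed.

Lemma eval_elin_irrx n (a : 'rV[C]_(n.*2.+1)) x :
  eval (elin a (@irrx n)) x = (a *m irrsolid n x) 0 0.
Proof. by rewrite eval_elin mxE; apply: eq_bigr => i _; rewrite eval_irrx. Qed.

Lemma elin_kelvin n (a : 'rV[C]_(n.*2.+1)) x :
  eval (elin a (@irrx n)) x = ((enorm x)^-1)%:C ^+ n.*2.+1 * eval (elin a (@regx n)) x.
Proof.
rewrite !eval_elin mulr_sumr; apply: eq_bigr => i _.
by rewrite eval_Mul eval_epow mulrCA.
Qed.

Lemma der_elin_regx n j (a : 'rV[C]_(n.+1.*2.+1)) :
  eqe (der j (elin a (@regx n.+1))) (elin (a *m Dreg R n.+1 j) (@regx n)).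
Proof.
move=> x x0; rewrite der_elin eval_elin_regx -mulmxA mxE; apply: eq_bigr => i _.
by rewrite der_regx.
Qed.

Lemma der_elin_irrx n j (a : 'rV[C]_(n.*2.+1)) :
  eqe (der j (elin a (@irrx n))) (elin (a *m Dirr R n j) (@irrx n.+1)).
Proof.
move=> x x0; rewrite der_elin eval_elin_irrx -mulmxA mxE; apply: eq_bigr => i _.
by rewrite der_irrx.
Qed.

Lemma rfree_eqe (a b : expr R) : rfree a -> rfree b -> eqe a b -> forall x, eval a x = eval b x.
Proof.
move=> fa fb ab x; have [->|x0] := eqVneq x 0; last exact: ab.
have h := @rfree_eq0 R (Add a (Mul (Cst (-1)) b)).
apply/eqP; rewrite -subr_eq0 -mulN1r; apply/eqP; apply: h; first by rewrite /= fa fb.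
by move=> y y0; rewrite eval_Add eval_Mul eval_Cst ab// mulN1r subrr.
Qed.

Variables (n : nat) (G : 'M[C]_(3, n.+1.*2.+1)).

Definition field_in (i : 'I_3) : expr R := elin (row i G) (@regx n.+1).
Definition field_out (Rad : R) (i : 'I_3) : expr R :=
  Mul (Cst (Rad ^+ n.+1.*2.+1)%:C) (elin (row i G) (@irrx n.+1)).

Lemma rfree_field_in i : rfree (field_in i).
Proof. by apply: rfree_elin => k; exact: regx_rfree. Qed.

Lemma harmonic_field_in i : harmonic (field_in i).
Proof. by apply: harmonic_elin => k; exact: harmonic_regx. Qed.

Lemma homog_field_in i : homog n.+1%:R (field_in i).
Proof. by apply: homog_elin => k; exact: homog_regx. Qed.

Lemma harmonic_field_out Rad i : harmonic (field_out Rad i).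
Proof. by apply: harmonicZ; apply: harmonic_elin => k; exact: harmonic_irrx. Qed.

Lemma homog_field_out Rad i : homog (- n.+2%:R) (field_out Rad i).
Proof. by apply: homogZ; apply: homog_elin => k; exact: homog_irrx. Qed.

Lemma ediv_field_in : eqe (ediv field_in) (elin (t3 G) (@regx n)).
Proof.
move=> x x0; rewrite eval_ediv eval_elin_regx /t3 mulmx_suml summxE.
by apply: eq_bigr => j _; rewrite der_elin_regx// eval_elin_regx.
Qed.

Lemma ediv_field_out Rad : eqe (ediv (field_out Rad))
  (Mul (Cst (Rad ^+ n.+1.*2.+1)%:C) (elin (t1 G) (@irrx n.+2))).
Proof.
move=> x x0; rewrite eval_ediv eval_Mul eval_Cst eval_elin_irrx /t1 mulmx_suml summxE mulr_sumr.
apply: eq_bigr => j _.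
by rewrite der_Mul der_Cst mul0r add0r eval_Cst der_elin_irrx// eval_elin_irrx.
Qed.

Lemma field_out_kelvin (Rad : R) i x : eval (field_out Rad i) x =
  (Rad ^+ n.+1.*2.+1)%:C * (((enorm x)^-1)%:C ^+ n.+1.*2.+1 * eval (field_in i) x).
Proof. by rewrite eval_Mul eval_Cst elin_kelvin. Qed.

Lemma field_out_sphere (Rad : R) i x : 0 < Rad -> enorm x = Rad ->
  eval (field_out Rad i) x = eval (field_in i) x.
Proof.
move=> R0 xR; rewrite field_out_kelvin xR mulrA -rmorphXn -rmorphM.
by rewrite -exprMn mulfV ?lt0r_neq0// expr1n mul1r.
Qed.

End Fields.

Section Decay.
Variable R : realType.
Local Notation C := R[i].

(** By homogeneity the value at x is |x|^-(n+1) times the value of a polynomial on the unit sphere,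
    where it is bounded. *)
Lemma irr_decay n (a : 'rV[C]_(n.*2.+1)) : exists K, 0 <= K /\
  forall x : 'rV[R]_3, x != 0 -> normc (eval (elin a (@irrx R n)) x) <= K * (enorm x)^-1 ^+ n.+1.
Proof.
have f : rfree (elin a (@regx R n)) by apply: rfree_elin => k; exact: regx_rfree.
have [K [K0 hK]] := eval_bounded (elin a (@regx R n)) (1 : R) (@ltr01 R).
exists K; split => // x x0.
have xr : 0 < enorm x by rewrite enorm_gt0.
have e1 : enorm (xhat x) = 1.
  by rewrite /xhat enormZ ger0_norm ?invr_ge0 ?enorm_ge0// mulVf// lt0r_neq0.
have -> : eval (elin a (@irrx R n)) x = ((enorm x)^-1 ^+ n.+1)%:C * eval (elin a (@regx R n)) (xhat x).
  rewrite eval_elin_irrx eval_elin_regx /irrsolid -scalemxAr mxE exprVn; congr (_ * _).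
  rewrite /regsolid e1 expr1n.
  have -> : xhat (xhat x) = xhat x by rewrite {1}/xhat e1 invr1 scale1r.
  by rewrite (_ : 1%:C = 1) // scale1r.
rewrite normcM normc_real ger0_norm ?exprn_ge0 ?invr_ge0 ?enorm_ge0// mulrC.
by rewrite ler_wpM2r ?exprn_ge0 ?invr_ge0 ?enorm_ge0// hK ?f ?e1.
Qed.

End Decay.

Section Modes.
Variables (R : realType) (lam mu Rad : R).
Hypothesis hRad : 0 < Rad.
Local Notation C := R[i].
Implicit Types (x : 'rV[R]_3) (e : expr R).

Lemma neq0_sphere x : enorm x = Rad -> x != 0.
Proof. by move=> xR; rewrite -enorm_gt0 xR. Qed.

Section General.
Variables (n : nat) (G : 'M[C]_(3, n.+1.*2.+1)) (c : R) (kin kout : C).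
Local Notation P := (field_in G).
Local Notation W := (field_out G Rad).
Local Notation uin := (ansatz Rad P kin).
Local Notation uout := (ansatz Rad W kout).

Lemma rfree_uin i : rfree (uin i).
Proof.
have f := rfree_field_in G.
by rewrite /= !f /= !rfree_der.
Qed.

Lemma uout_decay : exists K M : R, 0 < M /\ forall x, M <= enorm x ->
  forall i, normc (eval (uout i) x) <= K / enorm x.
Proof.
have [q qE q0] : exists2 q, Rad ^+ n.+1.*2.+1 = q & 0 <= q.
  by exists (Rad ^+ n.+1.*2.+1) => //; rewrite exprn_ge0// ltW.
have /choice[K1 h1] : forall i : 'I_3, exists K, 0 <= K /\ forall x, x != 0 ->
    normc (eval (elin (row i G) (@irrx R n.+1)) x) <= K * (enorm x)^-1 ^+ n.+2.
  by move=> i; exact: irr_decay.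
have /choice[K2 h2] : forall i : 'I_3, exists K, 0 <= K /\ forall x, x != 0 ->
    normc (eval (elin (t1 G *m Dirr R n.+2 i) (@irrx R n.+3)) x) <= K * (enorm x)^-1 ^+ n.+4.
  by move=> i; exact: irr_decay.
pose B i := q * K1 i + normc kout * q * K2 i.
have B0 i : 0 <= B i.
  apply: addr_ge0; first exact: mulr_ge0 q0 (h1 i).1.
  exact: mulr_ge0 (mulr_ge0 (normc_ge0 _) q0) (h2 i).1.
exists (\sum_i B i), (Num.max 1 Rad); split; first by rewrite lt_max ltr01.
move=> x; rewrite ge_max => /andP[x1 xR] i.
have xgt : 0 < enorm x by exact: lt_le_trans ltr01 x1.
have x0 : x != 0 by rewrite -enorm_gt0.
apply: (@le_trans _ _ (B i / enorm x)); last first.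
  by rewrite ler_wpM2r ?invr_ge0 ?enorm_ge0// (bigD1 i)//= lerDl sumr_ge0.
have vE : eval (der i (ediv W)) x = q%:C * eval (elin (t1 G *m Dirr R n.+2 i) (@irrx R n.+3)) x.
  rewrite (der_eqe i (ediv_field_out G Rad))// der_Mul der_Cst mul0r add0r eval_Cst qE.
  by rewrite der_elin_irrx.
have r1 : (enorm x)^-1 <= 1 by rewrite invf_le1.
have r0 : 0 <= (enorm x)^-1 by rewrite invr_ge0 enorm_ge0.
have rp m : (enorm x)^-1 ^+ m.+1 <= (enorm x)^-1.
  rewrite exprS -[leRHS]mulr1; apply: ler_wpM2l => //; exact: exprn_ile1 r0 r1.
rewrite eval_ansatz vE eval_Mul eval_Cst qE mulrDl (le_trans (le_normcD _ _))// lerD//.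
  rewrite normcM normc_real (ger0_norm q0) -mulrA ler_wpM2l//.
  apply: (le_trans ((h1 i).2 x x0)); rewrite ler_wpM2l ?(h1 i).1//.
rewrite !normcM normc_real (ger0_norm q0).
have -> : (enorm x)%:C ^+ 2 - (Rad ^+ 2)%:C = (enorm x ^+ 2 - Rad ^+ 2)%:C.
  by rewrite rmorphB !rmorphXn.
have sq0 : 0 <= enorm x ^+ 2 - Rad ^+ 2.
  by rewrite subr_ge0 ler_pXn2r// ?nnegrE ?enorm_ge0// ltW.
rewrite normc_real (ger0_norm sq0).
rewrite -!mulrA; apply: ler_wpM2l; first exact: normc_ge0.
rewrite [X in X <= _]mulrCA; apply: ler_wpM2l => //.
have h := (h2 i).2 x x0.
(* The correction grows by |x|^2 but involves harmonics of two degrees more, so it decays as fast as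
   the leading term. *)
apply: (@le_trans _ _ (enorm x ^+ 2 * (K2 i * (enorm x)^-1 ^+ n.+4))).
  apply: ler_pM => //; first exact: normc_ge0.
  by rewrite lerBlDr lerDl sqr_ge0.
have -> : (enorm x)^-1 ^+ n.+4 = (enorm x)^-1 ^+ 2 * (enorm x)^-1 ^+ n.+2 by rewrite -exprD.
rewrite mulrCA [X in _ * X]mulrA -exprMn mulfV ?lt0r_neq0// expr1n mul1r.
by rewrite ler_wpM2l ?(h2 i).1.
Qed.

Hypothesis cond_in : mu%:C * kin * (4 * n.+1%:R - 2) +
  (lam%:C + mu%:C) * (1 + 2 * kin * (n.+1%:R - 1)) = 0.
Hypothesis cond_out : mu%:C * kout * (4 * - n.+2%:R - 2) +
  (lam%:C + mu%:C) * (1 + 2 * kout * (- n.+2%:R - 1)) = 0.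

(** For the ansatz only the traction balance remains to be checked: the corrections vanish on the
    sphere, [cond_in] and [cond_out] give equilibrium, and decay comes from homogeneity. The
    contrast scales both interior coefficients and so leaves [cond_in] unchanged. *)
Lemma mode_solves (u : 'rV[R]_3 -> 'cV[C]_3) :
  (forall x i, u x i 0 = piece Rad (uin i) (uout i) x) ->
  (forall i x, enorm x = Rad ->
    \sum_(j < 3) (x 0 j)%:C * eval (estress lam mu uout i j) x =
    \sum_(j < 3) (x 0 j)%:C * eval (estress (c * lam) (c * mu) uin i j) x) ->
  solves lam mu Rad c u.
Proof.
move=> uE hf; apply: (transmission_solves hRad rfree_uin uE).
- move=> x i xR; rewrite !eval_ansatz field_out_sphere//.
  by rewrite xR rmorphXn subrr !(mulr0, mul0r).
- move=> i x x0; apply: (ansatz_equilibrium Rad (harmonic_field_in G) (homog_field_in G)) => //.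
  by rewrite !rmorphM -(mulr0 c%:C) -cond_in; ring.
- by move=> i x x0; apply: (ansatz_equilibrium Rad (harmonic_field_out G Rad) (homog_field_out G Rad)).
- move=> i x xR; have := hf i x xR; rewrite !sum_ord3 !mulrBr => h.
  rewrite [LHS](_ : _ = ((x 0 0)%:C * eval (estress lam mu uout i 0) x +
     (x 0 1)%:C * eval (estress lam mu uout i 1) x +
     (x 0 2%:R)%:C * eval (estress lam mu uout i 2%:R) x) -
     ((x 0 0)%:C * eval (estress (c * lam) (c * mu) uin i 0) x +
     (x 0 1)%:C * eval (estress (c * lam) (c * mu) uin i 1) x +
     (x 0 2%:R)%:C * eval (estress (c * lam) (c * mu) uin i 2%:R) x)); last first.
    have K (a b d a' b' d' : C) : a - a' + (b - b') + (d - d') = a + b + d - (a' + b' + d') by ring.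
    exact: K.
  by rewrite h subrr.
- exact: uout_decay.
Qed.

Lemma flux_in i x : enorm x = Rad ->
  \sum_(j < 3) (x 0 j)%:C * eval (estress (c * lam) (c * mu) uin i j) x =
  c%:C * ((lam%:C * (1 + 2 * kin * (n.+1%:R - 1)) + 2 * mu%:C * kin * (n.+1%:R - 1)) *
    (x 0 i)%:C * eval (ediv P) x +
  mu%:C * (n.+1%:R * eval (P i) x + \sum_(j < 3) (x 0 j)%:C * eval (der i (P j)) x +
    2 * kin * (Rad ^+ 2)%:C * eval (der i (ediv P)) x)).
Proof.
move=> xR; rewrite (ansatz_flux kin (harmonic_field_in G) (homog_field_in G) _ _ _ (neq0_sphere xR) xR).
by rewrite !rmorphM; ring.
Qed.

Lemma flux_out i x : enorm x = Rad ->
  \sum_(j < 3) (x 0 j)%:C * eval (estress lam mu uout i j) x =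
  (lam%:C * (1 + 2 * kout * (- n.+2%:R - 1)) + 2 * mu%:C * kout * (- n.+2%:R - 1)) *
    (x 0 i)%:C * eval (ediv W) x +
  mu%:C * (- n.+2%:R * eval (W i) x + \sum_(j < 3) (x 0 j)%:C * eval (der i (W j)) x +
    2 * kout * (Rad ^+ 2)%:C * eval (der i (ediv W)) x).
Proof.
by move=> xR; rewrite (ansatz_flux kout (harmonic_field_out G Rad) (homog_field_out G Rad) _ _ _ (neq0_sphere xR) xR).
Qed.

End General.
End Modes.

(** * Matching of the tractions in the three cases *)

Section Flux.
Variables (R : realType) (lam mu Rad : R).
Hypothesis hRad : 0 < Rad.
Local Notation C := R[i].
Local Notation rho x := ((enorm x)^-1)%:C.
Implicit Types (x : 'rV[R]_3) (e : expr R).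

Definition xdot (w : 'I_3 -> expr R) : expr R :=
  Add (Add (Mul (Crd R 0) (w 0)) (Mul (Crd R 1) (w 1))) (Mul (Crd R 2%:R) (w 2%:R)).

Lemma eval_xdot w x : eval (xdot w) x = \sum_(j < 3) (x 0 j)%:C * eval (w j) x.
Proof. by rewrite sum_ord3 !eval_Add !eval_Mul !eval_Crd. Qed.

Lemma der_xdot w i x : eval (der i (xdot w)) x =
  eval (w i) x + \sum_(j < 3) (x 0 j)%:C * eval (der i (w j)) x.
Proof.
rewrite sum_ord3 !der_Add !der_Mul !der_Crd !eval_Crd.
by move: i; elim/ord3P => /=; ring.
Qed.

(** Differentiate x . w = 0 in direction [i]. *)
Lemma rot_xdot w i x : eqe (xdot w) (Cst 0) -> x != 0 ->
  \sum_(j < 3) (x 0 j)%:C * eval (der i (w j)) x = - eval (w i) x.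
Proof.
move=> w0 x0; apply/eqP; rewrite -subr_eq0 opprK addrC -der_xdot; apply/eqP.
by rewrite (der_eqe i w0)// der_Cst.
Qed.

Lemma der_radialM N f e j x : radial N f -> x != 0 ->
  eval (der j (Mul f e)) x =
  N * eval f x * rho x ^+ 2 * ((x 0 j)%:C * eval e x) + eval f x * eval (der j e) x.
Proof. by move=> hf x0; rewrite der_Mul hf// mulrA. Qed.

Lemma ediv_radialM N f w x : radial N f -> x != 0 ->
  eval (ediv (fun i => Mul f (w i))) x =
  N * eval f x * rho x ^+ 2 * eval (xdot w) x + eval f x * eval (ediv w) x.
Proof.
move=> hf x0; rewrite !eval_ediv eval_xdot !mulr_sumr -big_split/=.
by apply: eq_bigr => i _; exact: der_radialM.
Qed.

Lemma realC_neq0 (a : R) : a != 0 -> a%:C != 0.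
Proof. by move=> a0; rewrite -(rmorph0 (real_complex R)) (inj_eq (@complexI R)). Qed.

Lemma rho_neq0 x : x != 0 -> rho x != 0.
Proof. by move=> x0; rewrite realC_neq0// invr_eq0 enorm_eq0. Qed.

Section Curl.
Variables (n : nat) (G : 'M[C]_(3, n.+1.*2.+1)) (c : R).
Local Notation P := (field_in G).
Local Notation W := (field_out G Rad).
Hypotheses (t10 : t1 G = 0) (t30 : t3 G = 0).
Hypothesis hc : c * n%:R = - n.+3%:R.

Lemma elin0 m (X : 'I_m -> expr R) x : eval (elin 0 X) x = 0.
Proof. by rewrite eval_elin big1// => i _; rewrite mxE mul0r. Qed.

Lemma ediv_in0 : eqe (ediv P) (Cst 0).
Proof. by move=> x x0; rewrite ediv_field_in// t30 elin0 eval_Cst. Qed.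

Lemma ediv_out0 : eqe (ediv W) (Cst 0).
Proof. by move=> x x0; rewrite ediv_field_out// eval_Mul t10 elin0 mulr0 eval_Cst. Qed.

Lemma field_outE i x : eval (W i) x =
  eval (Mul (Mul (Cst (Rad ^+ n.+1.*2.+1)%:C) (epow (Rinv R) n.+1.*2.+1)) (P i)) x.
Proof.
by rewrite field_out_kelvin [RHS]eval_Mul [X in _ = X * _]eval_Mul eval_Cst eval_epow eval_Rinv mulrA.
Qed.

Lemma radialZ (a N : C) (f : expr R) : radial N f -> radial N (Mul (Cst a) f).
Proof. by move=> h j x x0; rewrite der_Mul der_Cst eval_Mul eval_Cst h//; ring. Qed.

Lemma ediv_eqe (w w' : 'I_3 -> expr R) : (forall i, eqe (w i) (w' i)) -> eqe (ediv w) (ediv w').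
Proof. by move=> h x x0; rewrite !eval_ediv; apply: eq_bigr => i _; rewrite (der_eqe i (h i)). Qed.

(** The exterior field is f P with f a multiple of a negative power of |x|, and div(f P) = f div P +
    N f |x|^-2 (x . P). Both divergences vanish and N f does not. *)
Lemma xdot_in0 : eqe (xdot P) (Cst 0).
Proof.
move=> x x0; rewrite eval_Cst; apply/eqP.
have := ediv_radialM P (radialZ (Rad ^+ n.+1.*2.+1)%:C (@radial_rho R n.+1.*2.+1)) x0.
rewrite -(ediv_eqe (fun i y _ => field_outE i y) x0) ediv_out0// ediv_in0// !eval_Cst.
rewrite mulr0 addr0 => /esym/eqP; rewrite mulf_eq0 => /orP[|//].
apply: contraTT => _; apply: mulf_neq0; last by rewrite expf_neq0// rho_neq0.
apply: mulf_neq0; first by rewrite oppr_eq0 pnatr_eq0.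
rewrite eval_Mul eval_Cst eval_epow eval_Rinv; apply: mulf_neq0.
  by rewrite realC_neq0// expf_neq0// gt_eqF.
by rewrite expf_neq0// rho_neq0.
Qed.

Lemma xdot_out0 : eqe (xdot W) (Cst 0).
Proof.
move=> x x0; rewrite eval_Cst eval_xdot.
have := xdot_in0 x0; rewrite eval_xdot eval_Cst => h.
transitivity ((Rad ^+ n.+1.*2.+1)%:C * rho x ^+ n.+1.*2.+1 *
    \sum_(j < 3) (x 0 j)%:C * eval (P j) x); last by rewrite h mulr0.
rewrite mulr_sumr.
by apply: eq_bigr => j _; rewrite field_out_kelvin; ring.
Qed.

(** With no divergence and no radial component, |x| times the traction is mu times (degree - 1)
    times the field: - (n + 3) outside and c n inside, the interior degree being n + 1. *)
Lemma flux_curl (kin kout : C) i x : enorm x = Rad ->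
  \sum_(j < 3) (x 0 j)%:C * eval (estress lam mu (ansatz Rad W kout) i j) x =
  \sum_(j < 3) (x 0 j)%:C * eval (estress (c * lam) (c * mu) (ansatz Rad P kin) i j) x.
Proof.
move=> xR; have x0 := neq0_sphere hRad xR.
rewrite (flux_in lam mu hRad)// (flux_out lam mu hRad)//.
rewrite (ediv_in0 x0) (ediv_out0 x0) (der_eqe i ediv_in0 x0) (der_eqe i ediv_out0 x0).
rewrite !der_Cst (rot_xdot i xdot_in0 x0) (rot_xdot i xdot_out0 x0) field_out_sphere//.
have hcC : c%:C * n%:R = - n.+3%:R :> C by rewrite -!natrC -rmorphM hc rmorphN.
set p := eval _ x.
rewrite [RHS](_ : _ = mu%:C * (c%:C * n%:R) * p); last by rewrite -(natr1 n); ring.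
by rewrite hcC -(natr1 n.+2); ring.
Qed.

End Curl.
End Flux.

Section FluxGrad.
Variables (R : realType) (lam mu Rad : R).
Hypothesis hRad : 0 < Rad.
Local Notation C := R[i].
Local Notation rho x := ((enorm x)^-1)%:C.
Implicit Types (x : 'rV[R]_3) (e : expr R).

Lemma eval_rowmx m n (A : 'I_3 -> 'M[C]_(n, m)) k i (X : 'cV[C]_m) :
  (row i (\matrix_(j < 3) row k (A j)) *m X) 0 0 = (A i *m X) k 0.
Proof. by rewrite rowK -row_mul mxE. Qed.

Section Exterior.
Variables (n : nat) (k : 'I_(n.*2.+1)) (c : R) (kin kout : C).
(** Row i holds the coefficients of d_i of the k-th irregular harmonic of degree n, so the exterior
    field is a multiple of a gradient and is divergence-free. *)
Definition grad_irr : 'M[C]_(3, n.+1.*2.+1) := \matrix_(i < 3) row k (Dirr R n i).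
Local Notation G := grad_irr.
Local Notation P := (field_in G).
Local Notation W := (field_out G Rad).
Local Notation Q := (regx R k).
Let Kc : C := (Rad ^+ n.+1.*2.+1)%:C.
Let d : C := - (n.+1%:R * n.+1.*2.+1%:R).

Lemma field_out_grad i : eqe (W i) (Mul (Cst Kc) (der i (irrx R k))).
Proof.
move=> x x0; rewrite !eval_Mul !eval_Cst eval_elin_irrx /grad_irr eval_rowmx.
by rewrite der_irrx.
Qed.

(** The product rule for Q / |x|^(2n+1), multiplied through by |x|^(2n+3). *)
Lemma field_in_grad i : eqe (P i)
  (Add (Mul (esq R) (der i Q)) (Mul (Cst (- n.*2.+1%:R)) (Mul (Crd R i) Q))).
Proof.
move=> x x0; have := field_out_grad i x0.
rewrite field_out_kelvin eval_Mul eval_Cst => /(mulfI _) h.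
have {}h : rho x ^+ n.+1.*2.+1 * eval (P i) x = eval (der i (irrx R k)) x.
  by apply: h; rewrite realC_neq0// expf_neq0// gt_eqF.
apply: (@mulfI _ (rho x ^+ n.+1.*2.+1)); first by rewrite expf_neq0// rho_neq0.
rewrite h (der_radialM Q i (@radial_rho R _) x0) eval_epow eval_Rinv.
rewrite eval_Add !eval_Mul eval_Cst eval_esq eval_Crd.
have -> : rho x ^+ n.+1.*2.+1 = rho x ^+ n.*2.+1 * rho x ^+ 2 by rewrite -exprD addn2.
rewrite [RHS](_ : _ = rho x ^+ n.*2.+1 * ((rho x * (enorm x)%:C) ^+ 2 * eval (der i Q) x -
   n.*2.+1%:R * rho x ^+ 2 * ((x 0 i)%:C * eval Q x))); last by ring.
by rewrite rho_r//; ring.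
Qed.

Lemma div_grad_irr : eqe (ediv W) (Cst 0).
Proof.
move=> x x0; rewrite eval_ediv.
under eq_bigr => i _ do rewrite (der_eqe i (field_out_grad i) x0) der_Mul der_Cst mul0r add0r.
by rewrite -mulr_sumr harmonic_irrx// mulr0.
Qed.

Lemma der_field_in j i x : x != 0 -> eval (der j (P i)) x =
  2 * (x 0 j)%:C * eval (der i Q) x + (enorm x)%:C ^+ 2 * eval (der j (der i Q)) x -
  n.*2.+1%:R * ((i == j)%:R * eval Q x + (x 0 i)%:C * eval (der j Q) x).
Proof.
move=> x0; rewrite (der_eqe j (field_in_grad i) x0) der_Add !der_Mul der_Cst.
by rewrite der_esq eval_esq der_Crd eval_Crd eval_Cst; ring.
Qed.

Lemma ediv_grad_irr : eqe (ediv P) (Mul (Cst d) Q).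
Proof.
move=> x x0; rewrite eval_ediv eval_Mul eval_Cst.
have hQ := homog_regx k x0; have lQ := harmonic_regx k x0.
rewrite !sum_ord3 in hQ lQ *; rewrite !der_field_in//= !mulr1n.
have K (X0 X1 X2 a b e q a' b' e' r m N : C) : m = n%:R -> N = m * 2 + 1 ->
  X0 * a + X1 * b + X2 * e = m * q -> a' + b' + e' = 0 ->
  2 * X0 * a + r * a' - N * (1 * q + X0 * a) + (2 * X1 * b + r * b' - N * (1 * q + X1 * b)) +
  (2 * X2 * e + r * e' - N * (1 * q + X2 * e)) = - ((m + 1) * (m * 2 + 3)) * q.
  move=> _ -> h1 h2.
  rewrite [LHS](_ : _ = (2 - (m * 2 + 1)) * (X0 * a + X1 * b + X2 * e) +
    r * (a' + b' + e') - 3 * (m * 2 + 1) * q); last by ring.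
  by rewrite h1 h2; ring.
have dE : d = - ((n%:R + 1) * (n%:R * 2 + 3)).
  by rewrite /d -(natr1 n) doubleS -muln2 -!natr1 natrM; ring.
rewrite dE; apply: K hQ lQ => //.
by rewrite -muln2 -natr1 natrM.
Qed.

Lemma rot_field_in i x : x != 0 ->
  \sum_(j < 3) (x 0 j)%:C * eval (der i (P j)) x =
  - (n%:R + 2) * (enorm x)%:C ^+ 2 * eval (der i Q) x - (x 0 i)%:C * eval Q x.
Proof.
move=> x0; have hQ := homog_regx k x0.
have hd := homog_der i (homog_regx k) x0.
rewrite !sum_ord3 in hQ hd *; rewrite !der_field_in//.
have r2 : (x 0 0)%:C ^+ 2 + (x 0 1)%:C ^+ 2 + (x 0 2%:R)%:C ^+ 2 = (enorm x)%:C ^+ 2.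
  by rewrite -eval_esq /esq !eval_Add !eval_Mul !eval_Crd -!expr2.
rewrite (der_comm i 0) (der_comm i 1) (der_comm i 2%:R).
have dd : (x 0 0)%:C * (0 == i)%:R + (x 0 1)%:C * (1 == i)%:R + (x 0 2%:R)%:C * (2%:R == i)%:R
   = (x 0 i)%:C :> C.
  by move: i {hd}; elim/ord3P => /=; ring.
have K (X0 X1 X2 Xi d0 d1 d2 a b e ai q a' b' e' r m N : C) : N = m * 2 + 1 ->
  X0 * a + X1 * b + X2 * e = m * q -> X0 * a' + X1 * b' + X2 * e' = (m - 1) * ai ->
  X0 ^+ 2 + X1 ^+ 2 + X2 ^+ 2 = r -> X0 * d0 + X1 * d1 + X2 * d2 = Xi ->
  X0 * (2 * Xi * a + r * a' - N * (d0 * q + X0 * ai)) +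
  X1 * (2 * Xi * b + r * b' - N * (d1 * q + X1 * ai)) +
  X2 * (2 * Xi * e + r * e' - N * (d2 * q + X2 * ai)) = - (m + 2) * r * ai - Xi * q.
  move=> -> h1 h2 h3 h4.
  rewrite [LHS](_ : _ = 2 * Xi * (X0 * a + X1 * b + X2 * e) + r * (X0 * a' + X1 * b' + X2 * e') -
   (m * 2 + 1) * (q * (X0 * d0 + X1 * d1 + X2 * d2) + ai * (X0 ^+ 2 + X1 ^+ 2 + X2 ^+ 2))); last by ring.
  by rewrite h1 h2 h3 h4; ring.
apply: K hQ hd r2 dd.
by rewrite -muln2 -natr1 natrM.
Qed.

Lemma rot_field_out i x : x != 0 ->
  \sum_(j < 3) (x 0 j)%:C * eval (der i (W j)) x = - n.+2%:R * eval (W i) x.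
Proof.
move=> x0; rewrite field_out_grad// eval_Mul eval_Cst.
have hd := homog_der i (homog_irrx k) x0.
transitivity (Kc * \sum_(j < 3) (x 0 j)%:C * eval (der j (der i (irrx R k))) x).
  rewrite mulr_sumr; apply: eq_bigr => j _.
  by rewrite (der_eqe i (field_out_grad j) x0) der_Mul der_Cst mul0r add0r eval_Cst der_comm mulrCA.
by rewrite hd -(natr1 n.+1); ring.
Qed.

Hypothesis cond_in : mu%:C * kin * (4 * n.+1%:R - 2) +
  (lam%:C + mu%:C) * (1 + 2 * kin * (n.+1%:R - 1)) = 0.
Hypothesis hc : c%:C * (1 - 2 * kin * d) = 2 * n.+2%:R.

(** Both tractions are combinations of |x|^2 grad Q and x Q. Modulo the equilibrium relation the
    interior one is a multiple of P, as is the exterior one, so a single scalar condition [hc] is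
    left. *)
Lemma flux_grad_irr i x : enorm x = Rad ->
  \sum_(j < 3) (x 0 j)%:C * eval (estress lam mu (ansatz Rad W kout) i j) x =
  \sum_(j < 3) (x 0 j)%:C * eval (estress (c * lam) (c * mu) (ansatz Rad P kin) i j) x.
Proof.
move=> xR; have x0 := neq0_sphere hRad xR.
rewrite (flux_in lam mu hRad)// (flux_out lam mu hRad)//.
rewrite (div_grad_irr x0) (der_eqe i div_grad_irr x0) der_Cst rot_field_out// rot_field_in//.
rewrite field_out_sphere// (ediv_grad_irr x0) (der_eqe i ediv_grad_irr x0).
rewrite der_Mul der_Cst (field_in_grad i x0) eval_Add !eval_Mul eval_esq eval_Crd !eval_Cst xR rmorphXn.
have K (l u cc ki ko m X q a r dd : C) : 
  u * ki * (4 * (m + 1) - 2) + (l + u) * (1 + 2 * ki * (m + 1 - 1)) = 0 ->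
  cc * (1 - 2 * ki * dd) = 2 * (m + 2) -> dd = - ((m + 1) * (m * 2 + 3)) ->
  (l * (1 + 2 * ko * (- (m + 2) - 1)) + 2 * u * ko * (- (m + 2) - 1)) * X * 0 +
  u * (- (m + 2) * (r * a + - (m * 2 + 1) * (X * q)) +
    - (m + 2) * (r * a + - (m * 2 + 1) * (X * q)) + 2 * ko * r * 0) =
  cc * ((l * (1 + 2 * ki * (m + 1 - 1)) + 2 * u * ki * (m + 1 - 1)) * X * (dd * q) +
  u * ((m + 1) * (r * a + - (m * 2 + 1) * (X * q)) + (- (m + 2) * r * a - X * q) +
     2 * ki * r * (0 * q + dd * a))).
  move=> e1 e2 ddE; rewrite [in RHS]ddE; apply/eqP; rewrite -subr_eq0; apply/eqP.
  set D := - ((m + 1) * (m * 2 + 3)).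
  (* The first summand is a multiple of [cond_in]; the second is proportional to the field P, up to
     sign. *)
  rewrite (_ : cc * _ = cc * D * X * q * (u * ki * (4 * (m + 1) - 2) + (l + u) * (1 + 2 * ki * (m + 1 - 1)))
    + u * (cc * (1 - 2 * ki * D)) * ((m * 2 + 1) * X * q - r * a)); last by rewrite /D; ring.
  rewrite e1 /D.
  have -> : cc * (1 - 2 * ki * - ((m + 1) * (m * 2 + 3))) = 2 * (m + 2).
    by rewrite -ddE.
  ring.
have n1 : n.+1%:R = n%:R + 1 :> C by rewrite -natr1.
have n2 : n.+2%:R = n%:R + 2 :> C by rewrite -!natr1; ring.
have n3 : n.*2.+1%:R = n%:R * 2 + 1 :> C by rewrite -muln2 -natr1 natrM.
have dE : d = - ((n%:R + 1) * (n%:R * 2 + 3)).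
  by rewrite /d -(natr1 n) doubleS -muln2 -!natr1 natrM; ring.
have := hc; have := cond_in; rewrite n1 n2 n3 => h1 h2; apply: K h1 h2 dE.
Qed.

End Exterior.

Section Interior.
Variables (n : nat) (k : 'I_(n.+2.*2.+1)) (c : R) (kin kout : C).
(** The mirror image of [grad_irr]: here the interior field is the gradient of a regular harmonic,
    of degree n + 2, and the exterior one carries the divergence. *)
Definition grad_reg : 'M[C]_(3, n.+1.*2.+1) := \matrix_(i < 3) row k (Dreg R n.+2 i).
Local Notation G := grad_reg.
Local Notation P := (field_in G).
Local Notation W := (field_out G Rad).
Local Notation Q := (regx R k).
Let Kc : C := (Rad ^+ n.+1.*2.+1)%:C.
Let s0 : C := - (n.+2%:R * n.+1.*2.+1%:R).

Lemma field_in_greg i : eqe (P i) (der i Q).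
Proof.
by move=> x x0; rewrite eval_elin_regx /grad_reg eval_rowmx der_regx.
Qed.

Lemma field_out_greg i : eqe (W i)
  (Mul (Cst Kc) (Mul (epow (Rinv R) n.+1.*2.+1) (der i Q))).
Proof.
move=> x x0; rewrite field_out_kelvin (field_in_greg i x0).
by rewrite eval_Mul [X in _ = _ * X]eval_Mul eval_Cst eval_epow eval_Rinv.
Qed.

Lemma div_greg_in : eqe (ediv P) (Cst 0).
Proof.
move=> x x0; rewrite eval_ediv.
under eq_bigr => i _ do rewrite (der_eqe i (field_in_greg i) x0).
by rewrite harmonic_regx.
Qed.

Lemma der_greg_out j i x : x != 0 -> eval (der j (W i)) x =
  Kc * rho x ^+ n.+1.*2.+1 * (- n.+1.*2.+1%:R * rho x ^+ 2 * ((x 0 j)%:C * eval (der i Q) x) +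
    eval (der j (der i Q)) x).
Proof.
move=> x0; rewrite (der_eqe j (field_out_greg i) x0) der_Mul der_Cst mul0r add0r eval_Cst.
by rewrite (der_radialM (der i Q) j (@radial_rho R _) x0) eval_epow eval_Rinv; ring.
Qed.

Lemma div_greg_out : eqe (ediv W)
  (Mul (Cst (Kc * s0)) (Mul (epow (Rinv R) n.+2.*2.+1) Q)).
Proof.
move=> x x0; rewrite eval_ediv eval_Mul [X in _ = _ * X]eval_Mul eval_Cst eval_epow eval_Rinv.
have hQ := homog_regx k x0; have lQ := harmonic_regx k x0.
rewrite !sum_ord3 in hQ lQ *; rewrite !der_greg_out//.
have -> : rho x ^+ n.+2.*2.+1 = rho x ^+ n.+1.*2.+1 * rho x ^+ 2 by rewrite -exprD addn2.
have K (a p r N M b0 b1 b2 c0 c1 c2 q : C) : b0 + b1 + b2 = M * q -> c0 + c1 + c2 = 0 ->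
  a * p * (- N * r * b0 + c0) + a * p * (- N * r * b1 + c1) + a * p * (- N * r * b2 + c2) =
  a * - (M * N) * (p * r * q).
  move=> h1 h2; rewrite [LHS](_ : _ = a * p * (- N * r * (b0 + b1 + b2) + (c0 + c1 + c2))); last by ring.
  by rewrite h1 h2; ring.
exact: K hQ lQ.
Qed.

Lemma der_div_greg i x : x != 0 -> eval (der i (ediv W)) x =
  Kc * s0 * rho x ^+ n.+1.*2.+1 * rho x ^+ 2 *
   (- n.+2.*2.+1%:R * rho x ^+ 2 * ((x 0 i)%:C * eval Q x) + eval (der i Q) x).
Proof.
move=> x0; rewrite (der_eqe i div_greg_out x0) der_Mul der_Cst mul0r add0r eval_Cst.
rewrite (der_radialM Q i (@radial_rho R _) x0) eval_epow eval_Rinv.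
have -> : rho x ^+ n.+2.*2.+1 = rho x ^+ n.+1.*2.+1 * rho x ^+ 2 by rewrite -exprD addn2.
move: (rho x ^+ n.+1.*2.+1) => p; ring.
Qed.

Lemma rot_greg_in i x : x != 0 ->
  \sum_(j < 3) (x 0 j)%:C * eval (der i (P j)) x = n.+1%:R * eval (der i Q) x.
Proof.
move=> x0; have hd := homog_der i (homog_regx k) x0.
have -> : n.+1%:R = n.+2%:R - 1 :> C by rewrite -(natr1 n.+1); ring.
rewrite -hd; apply: eq_bigr => j _.
by rewrite (der_eqe i (field_in_greg j) x0) der_comm.
Qed.

Lemma rot_greg_out i x : x != 0 ->
  \sum_(j < 3) (x 0 j)%:C * eval (der i (W j)) x =
  Kc * rho x ^+ n.+1.*2.+1 * (s0 * rho x ^+ 2 * ((x 0 i)%:C * eval Q x) +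
    n.+1%:R * eval (der i Q) x).
Proof.
move=> x0; have hd := homog_der i (homog_regx k) x0; have hQ := homog_regx k x0.
rewrite !sum_ord3 in hd hQ *; rewrite !der_greg_out//.
rewrite (der_comm i 0) (der_comm i 1) (der_comm i 2%:R).
have K (p r N M X0 X1 X2 Xi b0 b1 b2 c0 c1 c2 q m bi : C) : m = M - 1 ->
  X0 * c0 + X1 * c1 + X2 * c2 = (M - 1) * bi -> X0 * b0 + X1 * b1 + X2 * b2 = M * q ->
  X0 * (p * (- N * r * (Xi * b0) + c0)) + X1 * (p * (- N * r * (Xi * b1) + c1)) +
  X2 * (p * (- N * r * (Xi * b2) + c2)) = p * (- (M * N) * r * (Xi * q) + m * bi).
  move=> -> h1 h2; rewrite [LHS](_ : _ = p * (- N * r * Xi * (X0 * b0 + X1 * b1 + X2 * b2) +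
    (X0 * c0 + X1 * c1 + X2 * c2))); last by ring.
  by rewrite h1 h2; ring.
have hm : n.+1%:R = n.+2%:R - 1 :> C by rewrite -(natr1 n.+1); ring.
exact: (K _ _ _ _ _ _ _ _ _ _ _ _ _ _ _ _ _ hm hd hQ).
Qed.

Hypothesis cond_out : mu%:C * kout * (4 * - n.+2%:R - 2) +
  (lam%:C + mu%:C) * (1 + 2 * kout * (- n.+2%:R - 1)) = 0.
Hypothesis hc : 2 * n.+1%:R * c%:C = -1 + 2 * kout * s0.

(** The equilibrium relation cancels the x Q component of the exterior traction. What is left on
    both sides is a multiple of grad Q, and [hc] compares the two factors. *)
Lemma flux_grad_reg i x : enorm x = Rad ->
  \sum_(j < 3) (x 0 j)%:C * eval (estress lam mu (ansatz Rad W kout) i j) x =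
  \sum_(j < 3) (x 0 j)%:C * eval (estress (c * lam) (c * mu) (ansatz Rad P kin) i j) x.
Proof.
move=> xR; have x0 := neq0_sphere hRad xR.
rewrite (flux_in lam mu hRad)// (flux_out lam mu hRad)//.
rewrite (div_greg_in x0) (der_eqe i div_greg_in x0) der_Cst rot_greg_out// rot_greg_in//.
have eD : eval (ediv W) x = Kc * s0 * (rho x ^+ n.+1.*2.+1 * rho x ^+ 2 * eval Q x).
  rewrite (div_greg_out x0) eval_Mul [X in _ * X = _]eval_Mul eval_Cst eval_epow eval_Rinv.
  by rewrite -exprD addn2.
rewrite der_div_greg// field_out_sphere// eD (field_in_greg i x0).
have e1 : Kc * rho x ^+ n.+1.*2.+1 = 1.
  rewrite xR -rmorphXn -rmorphM -exprMn mulfV ?expr1n//; exact: lt0r_neq0.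
have e2 : (Rad ^+ 2)%:C * rho x ^+ 2 = 1.
  rewrite xR -rmorphXn -rmorphM -exprMn mulfV ?expr1n//; exact: lt0r_neq0.
have K (kc p R2 r2 l u cc ki ko m X q a s : C) : kc * p = 1 -> R2 * r2 = 1 ->
  u * ko * (4 * - (m + 1) - 2) + (l + u) * (1 + 2 * ko * (- (m + 1) - 1)) = 0 ->
  2 * m * cc = -1 + 2 * ko * s ->
  (l * (1 + 2 * ko * (- (m + 1) - 1)) + 2 * u * ko * (- (m + 1) - 1)) * X * (kc * s * (p * r2 * q)) +
  u * (- (m + 1) * a + kc * p * (s * r2 * (X * q) + m * a) +
    2 * ko * R2 * (kc * s * p * r2 * (- (m * 2 + 3) * r2 * (X * q) + a))) =
  cc * ((l * (1 + 2 * ki * (m - 1)) + 2 * u * ki * (m - 1)) * X * 0 +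
  u * (m * a + m * a + 2 * ki * R2 * 0)).
  move=> e1' e2' e3 e4.
  rewrite [RHS](_ : _ = u * (2 * m * cc) * a); last by ring.
  rewrite e4 [LHS](_ : _ = (kc * p) * s * r2 * X * q *
    (u * ko * (4 * - (m + 1) - 2) + (l + u) * (1 + 2 * ko * (- (m + 1) - 1)) +
      u * ko * (4 * m + 6) * (1 - R2 * r2)) +
    u * a * (- (m + 1) + kc * p * m + 2 * ko * s * (kc * p) * (R2 * r2))); last by ring.
  by rewrite e1' e2' e3; ring.
have n2 : n.+2%:R = n.+1%:R + 1 :> C by rewrite -[n.+2%:R]natr1.
have n3 : n.+2.*2.+1%:R = n.+1%:R * 2 + 3 :> C by rewrite doubleS -muln2 -!natr1 natrM -?natr1; ring.
have := hc; have := cond_out; rewrite n2 n3 => h1 h2; apply: K e1 e2 h1 h2.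
Qed.

End Interior.
End FluxGrad.

Section Coefficients.
Variables (R : realType) (lam mu N : R).
Hypotheses (hmu : 0 < mu) (hlam : 0 < 3 * lam + 2 * mu) (hN : 2 <= N).

Let N2_ge0 : 0 <= N - 2. Proof. by rewrite subr_ge0. Qed.

(** As [lam] may be negative, three times the quantity is expanded in [3 * lam + 2 * mu] and [mu],
    with nonnegative coefficients once N >= 2. *)
Lemma den_in_gt0 : 0 < (N - 1) * lam + (3 * N - 2) * mu.
Proof.
rewrite -(pmulr_rgt0 _ (ltr0n R 3)).
rewrite [ltRHS](_ : _ = (N - 2) * (3 * lam + 2 * mu) + (3 * lam + 2 * mu) +
  (7 * (N - 2) + 10) * mu); last by ring.
rewrite ltr_pwDr// ?mulr_gt0 ?ltr_wpDl ?mulr_ge0// addr_ge0 ?mulr_ge0// ltW//.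
Qed.

Lemma den_out_gt0 : 0 < (N + 2) * lam + (3 * N + 5) * mu.
Proof.
rewrite -(pmulr_rgt0 _ (ltr0n R 3)).
rewrite [ltRHS](_ : _ = (N - 2) * (3 * lam + 2 * mu) + 4 * (3 * lam + 2 * mu) +
  (7 * (N - 2) + 25) * mu); last by ring.
rewrite ltr_pwDr// ?mulr_gt0 ?ltr_wpDl ?mulr_ge0// addr_ge0 ?mulr_ge0// ltW//.
Qed.

Lemma den_zeta2_gt0 : 0 < (2 * N ^+ 2 + 1) * lam + (2 + 2 * N * (N - 1)) * mu.
Proof.
rewrite -(pmulr_rgt0 _ (ltr0n R 3)).
rewrite [ltRHS](_ : _ = (2 * N ^+ 2 + 1) * (3 * lam + 2 * mu) +
  2 * ((N - 2) * ((N - 2) + 1)) * mu); last by ring.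
apply: ltr_pwDl; first by rewrite mulr_gt0// ltr_wpDl// mulr_ge0// sqr_ge0.
by rewrite mulr_ge0 ?(ltW hmu)// mulr_ge0// mulr_ge0// addr_ge0.
Qed.

Let km := (lam + mu) / (2 * ((N - 1) * lam + (3 * N - 2) * mu)).
Let ko := (lam + mu) / (2 * ((N + 2) * lam + (3 * N + 5) * mu)).

Lemma equil_in : mu * - km * (4 * N - 2) + (lam + mu) * (1 + 2 * - km * (N - 1)) = 0.
Proof. by rewrite /km; field; rewrite gt_eqF// den_in_gt0. Qed.

Lemma equil_out : mu * ko * (4 * - (N + 1) - 2) + (lam + mu) * (1 + 2 * ko * (- (N + 1) - 1)) = 0.
Proof. by rewrite /ko; field; rewrite gt_eqF// den_out_gt0. Qed.

Lemma zeta1_flux : (- 1 - 3 / (N - 1)) * (N - 1) = - (N + 2).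
Proof. by field; rewrite subr_eq0 gt_eqF// (lt_le_trans _ hN)// ltr1n. Qed.

(** The origin of [zeta2]: with D = (N - 1) lam + (3 N - 2) mu, the bracket 1 - 2 km N (2 N + 1) is
    minus ((2 N^2 + 1) lam + (2 + 2 N (N - 1)) mu) / D. *)
Lemma zeta2_flux : - ((2 * N + 2) * ((N - 1) * lam + (3 * N - 2) * mu)) /
    ((2 * N ^+ 2 + 1) * lam + (2 + 2 * N * (N - 1)) * mu) *
  (1 - 2 * - km * - (N * (2 * N + 1))) = 2 * (N + 1).
Proof. by rewrite /km; field; rewrite !gt_eqF// ?den_in_gt0 ?den_zeta2_gt0. Qed.

(** The numerator of [zeta3] is what results from putting 1 + 2 ko (N + 1)(2 N + 1) over the
    denominator of [ko]. *)
Lemma zeta3_flux : 2 * N * (- ((2 * N ^+ 2 + 4 * N + 3) * lam + (2 * N ^+ 2 + 6 * N + 6) * mu) /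
    (2 * N * ((N + 2) * lam + (3 * N + 5) * mu))) = -1 + 2 * ko * - ((N + 1) * (2 * N + 1)).
Proof.
by rewrite /ko; field; rewrite !gt_eqF// ?den_out_gt0// (lt_le_trans _ hN).
Qed.

End Coefficients.

(** * The modes *)

Section Identification.
Variables (R : realType) (Rad : R).
Hypothesis hRad : 0 < Rad.
Local Notation C := R[i].
Implicit Types (x : 'rV[R]_3).

Lemma mulmx_Yvec_free m n (G : 'M[C]_(m, n.*2.+1)) :
  (forall x : 'rV[R]_3, enorm x = 1 -> G *m Yvec n x = 0) -> G = 0.
Proof.
move=> h; apply/row_matrixP => i; rewrite row0; apply: Yvec_free => x x1.
by rewrite -row_mul h// row0.
Qed.

Lemma xhat1 x : enorm x = 1 -> xhat x = x.
Proof. by move=> x1; rewrite /xhat x1 invr1 scale1r. Qed.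

Lemma elin_regx_free n (a : 'rV[C]_(n.*2.+1)) : eqe (elin a (@regx R n)) (Cst 0) -> a = 0.
Proof.
move=> h; apply: Yvec_free => x x1; apply/rowP => i; rewrite ord1 [RHS]mxE.
have x0 : x != 0 by rewrite -enorm_gt0 x1.
rewrite -[RHS](h x x0) eval_elin_regx /regsolid x1 expr1n xhat1//.
by rewrite (_ : 1%:C = 1) // scale1r.
Qed.

Lemma elin_irrx_free n (a : 'rV[C]_(n.*2.+1)) : eqe (elin a (@irrx R n)) (Cst 0) -> a = 0.
Proof.
move=> h; apply: elin_regx_free => x x0; have := h x x0; rewrite !eval_Cst elin_kelvin.
by move/eqP; rewrite mulf_eq0 (negbTE (expf_neq0 _ (rho_neq0 x0))) => /eqP.
Qed.

(** On the sphere all corrections vanish, and the spherical harmonics transfer a relation between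
    fields to their coefficient matrices. *)
Lemma sphere_free m n (G : 'I_m -> 'M[C]_(3, n.*2.+1)) (u : 'I_m -> 'rV[R]_3 -> 'cV[C]_3)
    (a : 'I_m -> C) :
  (forall k x, enorm x = Rad -> u k x = (Rad ^+ n)%:C *: (G k *m Yvec n (xhat x))) ->
  (forall x, \sum_k a k *: u k x = 0) -> \sum_k a k *: G k = 0.
Proof.
move=> hu h; apply: mulmx_Yvec_free => y y1.
have eR : enorm (Rad *: y) = Rad by rewrite enormZ y1 mulr1 gtr0_norm.
have := h (Rad *: y); under eq_bigr => k _ do rewrite (hu k _ eR) scalerA mulrC -scalerA.
rewrite -scaler_sumr => /eqP; rewrite scaler_eq0 => /orP[|/eqP].
  by rewrite (negbTE (realC_neq0 _))// expf_neq0// gt_eqF.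
rewrite mulmx_suml {1}/xhat eR scalerA mulVf ?gt_eqF// scale1r => {}h; rewrite -[RHS]h.
by apply: eq_bigr => k _; rewrite scalemxAl.
Qed.

(** The case of a family with one member. *)
Lemma sphere_nontrivial n (G : 'M[C]_(3, n.*2.+1)) (u : 'rV[R]_3 -> 'cV[C]_3) :
  (forall x, enorm x = Rad -> u x = (Rad ^+ n)%:C *: (G *m Yvec n (xhat x))) ->
  G <> 0 -> exists x, u x <> 0.
Proof.
move=> hu G0; apply: contrapT => /forallNP h; apply: G0.
have := @sphere_free 1 n (fun=> G) (fun=> u) (fun=> 1) (fun _ => hu).
rewrite big_ord1 scale1r; apply=> x.
by rewrite big_ord1 scale1r; apply: contrapT; exact: h.
Qed.

Variables (n : nat) (G : 'M[C]_(3, n.+2.*2.+1)) (kin kout : C).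

Lemma eval_uin i x : eval (ansatz Rad (field_in G) kin i) x =
  ((enorm x ^+ n.+2)%:C *: (G *m Yvec n.+2 (xhat x)) +
   (kin * ((enorm x ^+ 2 - Rad ^+ 2) * enorm x ^+ n)%:C) *:
     ((\matrix_(j < 3) (t3 G *m Dreg R n.+1 j)) *m Yvec n (xhat x))) i 0.
Proof.
(* The formula is claimed at the origin too, so the identity between derivatives is extended there
   by continuity. *)
have v : forall x, eval (der i (ediv (field_in G))) x = eval (elin (t3 G *m Dreg R n.+1 i) (@regx R n)) x.
  apply: rfree_eqe.
  - by apply: rfree_der; rewrite /= !(rfree_der _ (rfree_field_in G _)).
  - by apply: rfree_elin => k; exact: regx_rfree.
  by move=> y y0; rewrite (der_eqe i (ediv_field_in G))// der_elin_regx.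
rewrite eval_ansatz v !eval_elin_regx /regsolid -!scalemxAr -row_mul.
rewrite !mxE; congr (_ + _).
have -> : ((enorm x ^+ 2 - Rad ^+ 2) * enorm x ^+ n)%:C =
    ((enorm x)%:C ^+ 2 - (Rad ^+ 2)%:C) * (enorm x ^+ n)%:C :> C.
  by rewrite rmorphM rmorphB [in LHS]rmorphXn.
rewrite -!mulrA; congr (_ * (_ * (_ * _))).
by apply: eq_bigr => j _; rewrite !mxE.
Qed.

Lemma eval_uout i x : x != 0 -> eval (ansatz Rad (field_out G Rad) kout i) x =
  ((Rad ^+ n.+2.*2.+1 / enorm x ^+ n.+3)%:C *: (G *m Yvec n.+2 (xhat x)) +
   (kout * ((enorm x ^+ 2 - Rad ^+ 2) * (Rad ^+ n.+2.*2.+1 / enorm x ^+ n.+4.+1))%:C) *: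
     ((\matrix_(j < 3) (t1 G *m Dirr R n.+3 j)) *m Yvec n.+4 (xhat x))) i 0.
Proof.
move=> x0; rewrite eval_ansatz (der_eqe i (ediv_field_out G Rad))// der_Mul der_Cst.
rewrite mul0r add0r eval_Mul !eval_Cst der_elin_irrx// !eval_elin_irrx /irrsolid.
rewrite -!scalemxAr -row_mul !mxE; congr (_ + _); first by rewrite mulrA -rmorphM.
have -> : ((enorm x ^+ 2 - Rad ^+ 2) * (Rad ^+ n.+2.*2.+1 / enorm x ^+ n.+4.+1))%:C =
    ((enorm x)%:C ^+ 2 - (Rad ^+ 2)%:C) *
    ((Rad ^+ n.+2.*2.+1)%:C * (enorm x ^- n.+4.+1)%:C) :> C.
  by rewrite -[(enorm x)%:C ^+ 2]rmorphXn -rmorphB -!rmorphM.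
rewrite -!mulrA; congr (_ * (_ * (_ * (_ * _)))).
by apply: eq_bigr => j _; rewrite !mxE.
Qed.

End Identification.

(** Rank-nullity; the family consists of the first [m] rows of a basis of the kernel. *)
Lemma ker_family (F : fieldType) p q (f : {linear 'rV[F]_p -> 'rV[F]_q}) m :
  (m + q <= p)%N -> exists v : 'I_m -> 'rV[F]_p, (forall k, f (v k) = 0) /\
    forall a, \sum_k a k *: v k = 0 -> forall k, a k = 0.
Proof.
move=> mq; pose A := lin1_mx f; pose B := row_base (kermx A).
have le_m : (m <= \rank (kermx A))%N.
  by rewrite mxrank_ker; have := rank_leq_col A; lia.
pose w := widen_ord le_m.
have wI : injective w by move=> i j /(congr1 val)/= /val_inj.
exists (fun k => row (w k) B); split => [k|a].
  have /sub_kermxP BA : (B <= kermx A)%MS by rewrite eq_row_base.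
  by rewrite -(mul_rV_lin1 f) -row_mul BA row0.
pose a' : 'rV_(\rank (kermx A)) := \sum_k a k *: delta_mx 0 (w k).
have aB : a' *m B = \sum_k a k *: row (w k) B.
  by rewrite mulmx_suml; apply: eq_bigr => k _; rewrite -scalemxAl rowE.
rewrite -aB -[X in _ = X](mul0mx _ B) => /(row_free_inj (row_base_free _)) a0 k.
have := congr1 (fun M : 'rV_(\rank (kermx A)) => M 0 (w k)) a0; rewrite summxE (bigD1 k)//= big1 ?addr0.
  by rewrite !mxE !eqxx mulr1.
by move=> l lk; rewrite !mxE eqxx (inj_eq wI) eq_sym (negbTE lk) mulr0.
Qed.

Section Linear.
Variables (R : realType) (n : nat).
Local Notation C := R[i].

Lemma t1_is_linear : linear (@t1 R n).
Proof.
move=> a G H; rewrite /t1 scaler_sumr -big_split/=; apply: eq_bigr => j _.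
by rewrite linearP mulmxDl scalemxAl.
Qed.

Lemma t3_is_linear : linear (@t3 R n).
Proof.
move=> a G H; rewrite /t3 scaler_sumr -big_split/=; apply: eq_bigr => j _.
by rewrite linearP mulmxDl scalemxAl.
Qed.

HB.instance Definition _ := GRing.isLinear.Build C _ _ _ (@t1 R n) t1_is_linear.
HB.instance Definition _ := GRing.isLinear.Build C _ _ _ (@t3 R n) t3_is_linear.

Definition t13 (v : 'rV[C]_(3 * n.*2.+1)) := row_mx (t1 (vec_mx v)) (t3 (vec_mx v)).

Lemma t13_is_linear : linear t13.
Proof. by move=> a u v; rewrite /t13 !linearP/= scale_row_mx add_row_mx. Qed.

HB.instance Definition _ := GRing.isLinear.Build C _ _ _ t13 t13_is_linear.

End Linear.

Section Solutions.
Variables (R : realType) (lam mu Rad : R).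
Hypotheses (hmu : 0 < mu) (hlam : 0 < 3 * lam + 2 * mu) (hRad : 0 < Rad).
Local Notation C := R[i].
Implicit Types (x : 'rV[R]_3).

(** Turns a computed divergence, a multiple of one solid harmonic, into the exact value of [t3]. *)
Lemma elin_regx_delta m (a : 'rV[C]_(m.*2.+1)) (d : C) k :
  eqe (elin a (@regx R m)) (Mul (Cst d) (regx R k)) -> a = d *: delta_mx 0 k.
Proof.
move=> h; apply/eqP; rewrite -subr_eq0; apply/eqP; apply: elin_regx_free => x x0.
have := h x x0; rewrite !eval_elin eval_Mul !eval_Cst => hx.
transitivity (\sum_i a 0 i * eval (regx R i) x - d * eval (regx R k) x); last by rewrite hx subrr.
have -> : d * eval (regx R k) x = \sum_i d * (i == k)%:R * eval (regx R i) x.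
  rewrite (bigD1 k)//= eqxx mulr1 big1 ?addr0// => i /negbTE->.
  by rewrite mulr0 mul0r.
by rewrite -sumrB; apply: eq_bigr => i _; rewrite !mxE eqxx mulrBl.
Qed.

Lemma Rad_pow_neq0 m : (Rad ^+ m)%:C != 0.
Proof. by rewrite realC_neq0// expf_neq0// gt_eqF. Qed.

Lemma elin_irrx_delta m (a : 'rV[C]_(m.*2.+1)) (d : C) k :
  eqe (elin a (@irrx R m)) (Mul (Cst d) (irrx R k)) -> a = d *: delta_mx 0 k.
Proof.
move=> h; apply: elin_regx_delta => x x0; have := h x x0.
rewrite elin_kelvin !eval_Mul !eval_Cst eval_epow eval_Rinv mulrCA.
by rewrite -exprS => /(mulfI (expf_neq0 _ (rho_neq0 x0))).
Qed.

Section Degree.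
Variable n : nat.
Local Notation N := (n.+2%:R : R).
Let kin : C := (- Mcoef lam mu n.+2)%:C.
Let kout : C := (kcoef lam mu n.+2)%:C.

Let N_ge2 : 2 <= N. Proof. by rewrite ler_nat. Qed.

Lemma cond_in : mu%:C * kin * (4 * n.+2%:R - 2) +
  (lam%:C + mu%:C) * (1 + 2 * kin * (n.+2%:R - 1)) = 0.
Proof.
rewrite -(natrC R n.+2) -[RHS](rmorph0 (real_complex R)) -(equil_in hmu hlam N_ge2) /kin /Mcoef.
move: (_ / _) => k; ring.
Qed.

Lemma cond_out : mu%:C * kout * (4 * - n.+3%:R - 2) +
  (lam%:C + mu%:C) * (1 + 2 * kout * (- n.+3%:R - 1)) = 0.
Proof.
rewrite -(natrC R n.+3) -(natr1 n.+2) -[RHS](rmorph0 (real_complex R)).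
rewrite -(equil_out hmu hlam N_ge2) /kout /kcoef.
move: (_ / _) => k; ring.
Qed.

Lemma rows_mul0 p q (D : 'I_3 -> 'M[C]_(p, q)) : \matrix_(j < 3) ((0 : 'rV_p) *m D j) = 0.
Proof. by apply/row_matrixP => j; rewrite rowK mul0mx row0. Qed.

Lemma xgtR_neq0 x : (enorm x <= Rad) = false -> x != 0.
Proof. by apply: contraFN => /eqP->; rewrite enorm0 ltW. Qed.

Section Modes.
Variables (G : 'M[C]_(3, n.+2.*2.+1)).
Local Notation uin := (ansatz Rad (field_in G) kin).
Local Notation uout := (ansatz Rad (field_out G Rad) kout).

Lemma mode1_piece x i : t1 G = 0 -> t3 G = 0 ->
  mode1 Rad G x i 0 = piece Rad (uin i) (uout i) x.
Proof.
move=> h1 h3; rewrite /mode1 /piece; case: ifP => [_|/xgtR_neq0 x0].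
  by rewrite eval_uin h3 rows_mul0 mul0mx scaler0 addr0.
by rewrite eval_uout// h1 rows_mul0 mul0mx scaler0 addr0.
Qed.

Lemma mode2_piece x i : t1 G = 0 ->
  mode2 lam mu Rad G x i 0 = piece Rad (uin i) (uout i) x.
Proof.
move=> h1; rewrite /mode2 /piece; case: ifP => [_|/xgtR_neq0 x0].
  by rewrite eval_uin /kin -scaleNr -rmorphM -rmorphN mulNr mulrA.
by rewrite eval_uout// h1 rows_mul0 mul0mx scaler0 addr0.
Qed.

Lemma mode3_piece x i : t3 G = 0 ->
  mode3 lam mu Rad G x i 0 = piece Rad (uin i) (uout i) x.
Proof.
move=> h3; rewrite /mode3 /piece; case: ifP => [_|/xgtR_neq0 x0].
  by rewrite eval_uin h3 rows_mul0 mul0mx scaler0 addr0.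
by rewrite eval_uout// -(mulrA (kcoef lam mu n.+2)) (rmorphM (real_complex R) (kcoef lam mu n.+2)).
Qed.

Lemma mode1_sphere x : enorm x = Rad ->
  mode1 Rad G x = (Rad ^+ n.+2)%:C *: (G *m Yvec n.+2 (xhat x)).
Proof. by move=> xR; rewrite /mode1 xR lexx. Qed.

Lemma mode2_sphere x : enorm x = Rad ->
  mode2 lam mu Rad G x = (Rad ^+ n.+2)%:C *: (G *m Yvec n.+2 (xhat x)).
Proof. by move=> xR; rewrite /mode2 xR lexx subrr mulr0 mul0r scale0r subr0. Qed.

Lemma mode3_sphere x : enorm x = Rad ->
  mode3 lam mu Rad G x = (Rad ^+ n.+2)%:C *: (G *m Yvec n.+2 (xhat x)).
Proof. by move=> xR; rewrite /mode3 xR lexx. Qed.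

End Modes.

Lemma mode1_solves (G : 'M[C]_(3, n.+2.*2.+1)) : t1 G = 0 -> t3 G = 0 ->
  solves lam mu Rad (zeta1 R n.+2) (mode1 Rad G).
Proof.
move=> h1 h3; apply: (mode_solves hRad cond_in cond_out (fun x i => mode1_piece x i h1 h3)).
move=> i x xR; apply: flux_curl => //.
rewrite /zeta1 (_ : n.+1%:R = N - 1); last by rewrite -(natr1 n.+1) addrK.
by rewrite zeta1_flux// -[n.+4%:R]natr1 -[n.+3%:R]natr1; congr (- _); ring.
Qed.

Section Exterior.
Variable k : 'I_(n.+1.*2.+1).
Local Notation G := (grad_irr R k).

Lemma t1_grad_irr : t1 G = 0.
Proof.
apply: elin_irrx_free => x x0; have := div_grad_irr Rad k x0.
rewrite ediv_field_out// eval_Mul !eval_Cst => /eqP.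
by rewrite mulf_eq0 (negbTE (Rad_pow_neq0 _)) => /eqP.
Qed.

Lemma t3_grad_irr : t3 G = (- (n.+2%:R * n.+2.*2.+1%:R)) *: delta_mx 0 k.
Proof.
apply: elin_regx_delta => x x0.
by rewrite -(ediv_grad_irr hRad k x0) ediv_field_in.
Qed.

Lemma mode2_solves : solves lam mu Rad (zeta2 lam mu n.+2) (mode2 lam mu Rad G).
Proof.
apply: (mode_solves hRad cond_in cond_out (fun x i => mode2_piece x i t1_grad_irr)).
move=> i x xR; apply: flux_grad_irr => //; first exact: cond_in.
have dC : - (n.+2%:R * n.+2.*2.+1%:R) = (- (N * (2 * N + 1)))%:C :> C.
  by rewrite -muln2 -(natr1 (n.+2 * 2)) natrM -(natrC R n.+2); ring.
rewrite dC -(natr1 n.+2) -(natrC R n.+2).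
have := congr1 (real_complex R) (zeta2_flux hmu hlam N_ge2).
rewrite /zeta2 /kin /Mcoef.
move: (_ / (2 * _)) => a; move: (_ / _) => c h.
rewrite [RHS](_ : _ = (2 * (N + 1))%:C); last by ring.
by rewrite -h; ring.
Qed.

End Exterior.

Section Interior.
Variable k : 'I_(n.+3.*2.+1).
Local Notation G := (grad_reg R k).

Lemma t3_grad_reg : t3 G = 0.
Proof.
apply: elin_regx_free => x x0.
by rewrite -(div_greg_in k x0) ediv_field_in.
Qed.

Lemma t1_grad_reg : t1 G = (- (n.+3%:R * n.+2.*2.+1%:R)) *: delta_mx 0 k.
Proof.
apply: elin_irrx_delta => x x0; have := div_greg_out Rad k x0.
rewrite ediv_field_out// eval_Mul [RHS]eval_Mul !eval_Cst -mulrA.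
by move/(mulfI (Rad_pow_neq0 _)) => ->; rewrite [RHS]eval_Mul eval_Cst.
Qed.

Lemma mode3_solves : solves lam mu Rad (zeta3 lam mu n.+2) (mode3 lam mu Rad G).
Proof.
apply: (mode_solves hRad cond_in cond_out (fun x i => mode3_piece x i t3_grad_reg)).
move=> i x xR; apply: flux_grad_reg => //; first exact: cond_out.
have dC : - (n.+3%:R * n.+2.*2.+1%:R) = (- ((N + 1) * (2 * N + 1)))%:C :> C.
  by rewrite -muln2 -(natr1 (n.+2 * 2)) natrM -(natr1 n.+2) -(natrC R n.+2); ring.
rewrite dC -(natrC R n.+2).
have := congr1 (real_complex R) (zeta3_flux hmu hlam N_ge2).
rewrite /zeta3 /kout /kcoef.
move: (_ / (2 * (_ + _))) => a; move: (_ / _) => c h.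
rewrite [LHS](_ : _ = (2 * N * c)%:C); last by ring.
by rewrite h; ring.
Qed.

End Interior.
End Degree.
End Solutions.

Section Families.
Variables (R : realType) (lam mu Rad : R) (n : nat).
Hypotheses (hmu : 0 < mu) (hlam : 0 < 3 * lam + 2 * mu) (hRad : 0 < Rad).
Local Notation C := R[i].

Lemma delta_free m q (s : C) (w : 'I_m -> 'I_q) (a : 'I_m -> C) : injective w -> s != 0 ->
  \sum_k a k *: (s *: delta_mx 0 (w k)) = 0 :> 'rV[C]_q -> forall k, a k = 0.
Proof.
move=> wI s0 h k; have := congr1 (fun M : 'rV_q => M 0 (w k)) h.
rewrite summxE (bigD1 k)//= big1 ?addr0 => [|l lk].
  by rewrite !mxE !eqxx mulr1 => /eqP; rewrite mulf_eq0 (negbTE s0) orbF => /eqP.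
by rewrite !mxE eqxx (inj_eq wI) eq_sym (negbTE lk) !mulr0.
Qed.

Lemma delta_neq0 q (s : C) (k : 'I_q) : s != 0 -> s *: delta_mx 0 k <> 0 :> 'rV[C]_q.
Proof.
move=> s0 /(congr1 (fun M : 'rV_q => M 0 k)); rewrite !mxE !eqxx mulr1 => /eqP.
by rewrite (negbTE s0).
Qed.

Lemma mode1_family : exists G : 'I_(2 * n.+2 + 1) -> 'M[C]_(3, n.+2.*2.+1),
  (forall k, [/\ t1 (G k) = 0, t3 (G k) = 0, exists x, mode1 Rad (G k) x <> 0 &
     solves lam mu Rad (zeta1 R n.+2) (mode1 Rad (G k))]) /\
  lin_indep (fun k => mode1 Rad (G k)).
Proof.
(* Both sides are in fact equal, so the family has the largest size that the dimension count
   guarantees. *)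
have le : (2 * n.+2 + 1 + (n.+3.*2.+1 + n.+2.-1.*2.+1) <= 3 * n.+2.*2.+1)%N by lia.
have [v [v0 vI]] := ker_family (@t13 R n.+2) le.
have G0 k : t1 (vec_mx (v k)) = 0 /\ t3 (vec_mx (v k)) = 0.
  by have := v0 k; rewrite /t13 -[0]row_mx0 => /eq_row_mx.
have vecI (a : 'I_(2 * n.+2 + 1) -> C) : \sum_k a k *: vec_mx (v k) = 0 -> forall k, a k = 0.
  move=> h; apply: vI; apply: (can_inj vec_mxK); rewrite linear0 linear_sum -[RHS]h.
  by apply: eq_bigr => k _; rewrite linearZ.
exists (fun k => vec_mx (v k)); split => [k|a h]; last first.
  exact: vecI (sphere_free hRad (fun k x => @mode1_sphere _ _ _ _ x) h).
have [h1 h3] := G0 k; split => //; last exact: mode1_solves.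
apply: (sphere_nontrivial hRad (@mode1_sphere _ _ _ _)) => vk0.
have := @vecI (fun l => (l == k)%:R); rewrite (bigD1 k)//= vk0 scaler0 add0r.
rewrite big1 => [|l /negbTE->]; last by rewrite scale0r.
by move=> /(_ erefl k)/eqP; rewrite eqxx oner_eq0.
Qed.

Lemma mode2_family : exists G : 'I_(2 * n.+2 - 1) -> 'M[C]_(3, n.+2.*2.+1),
  (forall k, [/\ t1 (G k) = 0, t3 (G k) <> 0, exists x, mode2 lam mu Rad (G k) x <> 0 &
     solves lam mu Rad (zeta2 lam mu n.+2) (mode2 lam mu Rad (G k))]) /\
  lin_indep (fun k => mode2 lam mu Rad (G k)).
Proof.
(* One mode for each harmonic of the degree one lower. *)
have e : (2 * n.+2 - 1 = n.+1.*2.+1)%N by lia.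
have d0 : - (n.+2%:R * n.+2.*2.+1%:R) != 0 :> C by rewrite oppr_eq0 mulf_neq0 ?pnatr_eq0.
exists (fun k => grad_irr R (cast_ord e k)); split => [k|a h].
  have h3 : t3 (grad_irr R (cast_ord e k)) <> 0.
    by rewrite (t3_grad_irr hRad); exact: delta_neq0.
  split => //; [exact: (t1_grad_irr hRad)| |exact: mode2_solves].
  apply: (sphere_nontrivial hRad (@mode2_sphere _ _ _ _ _ _)) => G0.
  by apply: h3; rewrite G0 linear0.
have := sphere_free hRad (fun k x => @mode2_sphere _ _ _ _ _ _ x) h.
move/(congr1 (@t3 R n.+2)); rewrite linear0 linear_sum => h3.
apply: (delta_free (@cast_ord_inj _ _ e) d0); rewrite -[RHS]h3.
by apply: eq_bigr => k _; rewrite -(t3_grad_irr hRad); apply/esym/linearZ.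
Qed.

Lemma mode3_family : exists G : 'I_(2 * n.+2 + 3) -> 'M[C]_(3, n.+2.*2.+1),
  (forall k, [/\ t1 (G k) <> 0, t3 (G k) = 0, exists x, mode3 lam mu Rad (G k) x <> 0 &
     solves lam mu Rad (zeta3 lam mu n.+2) (mode3 lam mu Rad (G k))]) /\
  lin_indep (fun k => mode3 lam mu Rad (G k)).
Proof.
(* One mode for each harmonic of the degree one higher. *)
have e : (2 * n.+2 + 3 = n.+3.*2.+1)%N by lia.
have s0 : - (n.+3%:R * n.+2.*2.+1%:R) != 0 :> C by rewrite oppr_eq0 mulf_neq0 ?pnatr_eq0.
exists (fun k => grad_reg R (cast_ord e k)); split => [k|a h].
  have h1 : t1 (grad_reg R (cast_ord e k)) <> 0.
    by rewrite (t1_grad_reg hRad); exact: delta_neq0.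
  split => //; [exact: t3_grad_reg| |exact: mode3_solves].
  apply: (sphere_nontrivial hRad (@mode3_sphere _ _ _ _ _ _)) => G0.
  by apply: h1; rewrite G0 linear0.
have := sphere_free hRad (fun k x => @mode3_sphere _ _ _ _ _ _ x) h.
move/(congr1 (@t1 R n.+2)); rewrite linear0 linear_sum => h1.
apply: (delta_free (@cast_ord_inj _ _ e) s0); rewrite -[RHS]h1.
by apply: eq_bigr => k _; rewrite -(t1_grad_reg hRad); apply/esym/linearZ.
Qed.

End Families.

Theorem theorem3p1 (R : realType) (lam mu Rad : R) (n : nat)
    (hmu : 0 < mu) (hlam : 0 < 3 * lam + 2 * mu) (hRad : 0 < Rad)
    (hn : (2 <= n)%N) :
  [/\ exists G : 'I_(2 * n + 1) -> 'M[R[i]]_(3, n.*2.+1),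
        (forall k, [/\ t1 (G k) = 0, t3 (G k) = 0,
                       exists x, mode1 Rad (G k) x <> 0 &
                       solves lam mu Rad (zeta1 R n) (mode1 Rad (G k))]) /\
        lin_indep (fun k => mode1 Rad (G k)),
      exists G : 'I_(2 * n - 1) -> 'M[R[i]]_(3, n.*2.+1),
        (forall k, [/\ t1 (G k) = 0, t3 (G k) <> 0,
                       exists x, mode2 lam mu Rad (G k) x <> 0 &
                       solves lam mu Rad (zeta2 lam mu n)
                         (mode2 lam mu Rad (G k))]) /\
        lin_indep (fun k => mode2 lam mu Rad (G k)) &
      exists G : 'I_(2 * n + 3) -> 'M[R[i]]_(3, n.*2.+1),
        (forall k, [/\ t1 (G k) <> 0, t3 (G k) = 0,
                       exists x, mode3 lam mu Rad (G k) x <> 0 &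
                       solves lam mu Rad (zeta3 lam mu n)
                         (mode3 lam mu Rad (G k))]) /\
        lin_indep (fun k => mode3 lam mu Rad (G k))].
Proof.
(* Writing the degree as [n.+2] makes the predecessors in the types of [t3] and [mode2] compute. *)
case: n hn => [|[|n]]// _.
by split; [exact: mode1_family|exact: mode2_family|exact: mode3_family].
Qed.
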